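(* Let $\pi \in I_\mathbb{Z}$. Then $\mathfrak{ib}_\pi$ is an isomorphism of $\mathfrak{q}_n$-crystals $\displaystyle\bigsqcup_{\sigma\in I_\mathbb{Z}} \mathcal{R}^{\mathsf{O}}_n(\sigma) \to \bigsqcup_{\sigma\in I_\mathbb{Z}} \mathcal{R}^{\mathsf{O}}_n(\sigma)$.
   Context: Fix a positive integer $n$. Let $S_\mathbb{Z}$ be the permutations of $\mathbb{Z}$ fixing all but finitely many integers, $s_i=(i,i+1)$, $I_\mathbb{Z}$ the involutions in $S_\mathbb{Z}$. With the Demazure product ($\pi\circ s_i=\pi s_i$ if $\pi(i)<\pi(i+1)$, else $\pi$), an involution word for $\pi\in I_\mathbb{Z}$ is a minimal-length word $i_1\cdots i_l$ with $\pi=s_{i_l}\circ\cdots\circ s_{i_1}\circ1\circ s_{i_1}\circ\cdots\circ s_{i_l}$; $\mathcal{R}^{\mathsf{O}}(\pi)$ is the set of these, and $\mathcal{R}^{\mathsf{O}}_n(\pi)$ is the set of $n$-tuples of strictly increasing words whose concatenation lies in $\mathcal{R}^{\mathsf{O}}(\pi)$. This set carries Hiroshima's $\mathfrak{q}_n$-crystal structure: weight = factor lengths; $e_i,f_i$ ($i\in[n-1]$) are the Morse–Schilling operators (pair letters of $w^{i+1}$, from largest to smallest, with the smallest unpaired larger letter of $w^i$; $f_i$ removes the largest unpaired letter $x$ of $w^i$ and adds to $w^{i+1}$ the smallest $y\ge x$ not already present, or gives $0$ if none is unpaired; $e_i$ removes the smallest unpaired letter $y$ of $w^{i+1}$ and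 adds to $w^i$ the largest $x\le y$ not already present, or gives $0$); $f_{\overline1}$ moves the first letter of $w^1$ to $w^2$ if it is smaller than all letters of $w^2$ (else $0$), and $e_{\overline1}$ moves the first letter of $w^2$ to $w^1$ if it is smaller than all letters of $w^1$ (else $0$). Involution Little bumps: for $\pi\in I_\mathbb{Z}$, a $\pi$-marked involution word is a pair $(w,i)$ such that deleting the $i$th letter of $w$ gives an involution word for $\pi$; it is inv-reduced if $w$ itself is an involution word (for some element of $I_\mathbb{Z}$). If $(w,i)$ is not inv-reduced there is a unique $j\neq i$ such that $(w,j)$ is also a $\pi$-marked involution word; set $j=i$ if $(w,i)$ is inv-reduced, and define $\textsf{ipush}(w,i)=(v,j)$ where $v$ is $w$ with its $j$th letter increased by one. For an involution word $w$, if some (necessarily unique) $i$ makes $(w,i)$ a $\pi$-marked involution word, let $N>0$ be minimal with $\textsf{ipush}^N(w,i)=(v,j)$ inv-reduced and set $\mathfrak{ib}_\pi(w)=v$; otherwise $\mathfrak{ib}_\pi(w)=w$. Since $\mathfrak{ib}_\pi$ preserves the descent set of words, it is extended to factorizations: $\mathfrak{ib}_\pi(w^1,\dots,w^n)=(v^1,\dots,v^n)$ where $v^1\cdots v^n=\mathfrak{ib}_\pi(w^1\cdots w^n)$ and $\ell(v^i)=\ell(w^i)$ (each $v^i$ is again strictly increasing). *)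

(* Defs.v *)
(* with classical choice (Stdlib ClassicalEpsilon) used only to
   define the Little-bump map, whose definition in the paper involves choices
   ("the unique j", "the minimal N") justified by facts proved in the paper. *)
From Stdlib Require Import ClassicalEpsilon.
From mathcomp Require Import all_boot all_order all_algebra.
Set Implicit Arguments. Unset Strict Implicit. Unset Printing Implicit Defensive.
Import Order.TTheory GRing.Theory Num.Theory.
Local Open Scope ring_scope.

Definition sgen (i x : int) : int :=
  if x == i then i + 1 else if x == i + 1 then i else x.

(* a permutation is represented by the pair (function, inverse function) *)
Definition dperm := ((int -> int) * (int -> int))%type.

Definition demR (p : dperm) (i : int) : dperm :=
  if p.1 i < p.1 (i + 1) then (p.1 \o sgen i, sgen i \o p.2) else p.

(* left Demazure product  s_i o p  (length goes up iff p^-1(i) < p^-1(i+1)) *)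
Definition demL (i : int) (p : dperm) : dperm :=
  if p.2 i < p.2 (i + 1) then (sgen i \o p.1, p.2 \o sgen i) else p.

Definition demconj (i : int) (p : dperm) : dperm := demL i (demR p i).

Definition inv_of_word (w : seq int) : int -> int :=
  (foldl (fun p i => demconj i p) (id, id) w).1.

Definition is_involution_Z (pi : int -> int) : Prop :=
  (forall x, pi (pi x) = x) /\ exists N : nat, forall x, (N < `|x|)%N -> pi x = x.

Definition inv_word_for (w : seq int) (pi : int -> int) : Prop :=
  (forall x, inv_of_word w x = pi x) /\
  forall v : seq int, (forall x, inv_of_word v x = pi x) -> (size w <= size v)%N.

(* w is an involution word (for some element of I_Z, necessarily inv_of_word w) *)
Definition is_inv_word (w : seq int) : Prop := inv_word_for w (inv_of_word w).

(** * Involution Little bumps (positions are 0-based) *)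

Definition delete_at (w : seq int) (i : nat) : seq int := take i w ++ drop i.+1 w.

Definition marked (pi : int -> int) (w : seq int) (i : nat) : Prop :=
  (i < size w)%N /\ inv_word_for (delete_at w i) pi.

Definition incr_at (w : seq int) (j : nat) : seq int := set_nth 0 w j (nth 0 w j + 1).

Definition ipush (pi : int -> int) (p : seq int * nat) : seq int * nat :=
  let: (w, i) := p in
  let j := if excluded_middle_informative (is_inv_word w) then i
           else epsilon (inhabits 0%N) (fun j => j <> i /\ marked pi w j) in
  (incr_at w j, j).

Definition ib (pi : int -> int) (w : seq int) : seq int :=
  match excluded_middle_informative (exists i, marked pi w i) with
  | left _ =>
      let i := epsilon (inhabits 0%N) (marked pi w) in
      let N := epsilon (inhabits 0%N) (fun N =>
                 [/\ (0 < N)%N, is_inv_word (iter N (ipush pi) (w, i)).1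
                   & forall M, (0 < M < N)%N -> ~ is_inv_word (iter M (ipush pi) (w, i)).1])
      in (iter N (ipush pi) (w, i)).1
  | right _ => w
  end.

(* extension to factorizations (w^1,...,w^n), represented as a list of n words *)
Definition ibF (pi : int -> int) (ws : seq (seq int)) : seq (seq int) :=
  reshape (map size ws) (ib pi (flatten ws)).

(* disjoint union over sigma in I_Z of R^O_n(sigma) *)
Definition fdom (n : nat) (ws : seq (seq int)) : Prop :=
  [/\ size ws = n, all (sorted <%O) ws & is_inv_word (flatten ws)].

Definition wt (ws : seq (seq int)) : seq nat := map size ws.

Definition minl (s : seq int) : option int :=
  if s is x :: s' then Some (foldl Order.min x s') else None.
Definition maxl (s : seq int) : option int :=
  if s is x :: s' then Some (foldl Order.max x s') else None.

Definition next_absent (b : seq int) (x : int) : int :=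
  let fix go k (x : int) := match k with
    | 0%N => x | k.+1 => if x \in b then go k (x + 1) else x end
  in go (size b) x.

Definition prev_absent (a : seq int) (x : int) : int :=
  let fix go k (x : int) := match k with
    | 0%N => x | k.+1 => if x \in a then go k (x - 1) else x end
  in go (size a) x.

(* Morse--Schilling pairing of a = w^i and b = w^(i+1): letters of b, from
   largest to smallest, are paired with the smallest unpaired larger letter
   of a.  Returns (unpaired letters of a, unpaired letters of b). *)
Definition ms_pair (a b : seq int) : seq int * seq int :=
  foldl (fun st y =>
           let: (avail, ub) := st in
           match minl [seq x <- avail | y < x] with
           | None => (avail, y :: ub)
           | Some x0 => (rem x0 avail, ub)
           end) (a, [::]) (rev (sort <=%O b)).

(* f_i, e_i for i in [n-1] (1-based factor index i); None stands for 0 *)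
Definition fop (i : nat) (ws : seq (seq int)) : option (seq (seq int)) :=
  if ~~ ((0 < i)%N && (i < size ws)%N) then None else
  let a := nth [::] ws i.-1 in let b := nth [::] ws i in
  match maxl (ms_pair a b).1 with
  | None => None
  | Some x => let y := next_absent b x in
      Some (set_nth [::] (set_nth [::] ws i.-1 (rem x a)) i (sort <=%O (y :: b)))
  end.

Definition eop (i : nat) (ws : seq (seq int)) : option (seq (seq int)) :=
  if ~~ ((0 < i)%N && (i < size ws)%N) then None else
  let a := nth [::] ws i.-1 in let b := nth [::] ws i in
  match minl (ms_pair a b).2 with
  | None => None
  | Some y => let x := prev_absent a y in
      Some (set_nth [::] (set_nth [::] ws i.-1 (sort <=%O (x :: a))) i (rem y b))
  end.

Definition fbar1 (ws : seq (seq int)) : option (seq (seq int)) :=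
  match ws with
  | (x :: a) :: b :: rest => if all (fun z => x < z) b then Some (a :: (x :: b) :: rest) else None
  | _ => None
  end.

Definition ebar1 (ws : seq (seq int)) : option (seq (seq int)) :=
  match ws with
  | a :: (y :: b) :: rest => if all (fun z => y < z) a then Some ((y :: a) :: b :: rest) else None
  | _ => None
  end.

Definition qcrystal_iso (n : nat) (D : seq (seq int) -> Prop)
    (phi : seq (seq int) -> seq (seq int)) : Prop :=
  (forall b, D b -> D (phi b)) /\
  [/\ forall b1 b2, D b1 -> D b2 -> phi b1 = phi b2 -> b1 = b2,
      forall b, D b -> exists2 b', D b' & phi b' = b,
      forall b, D b -> wt (phi b) = wt b,
      forall i, (0 < i < n)%N -> forall b, D b ->
        omap phi (fop i b) = fop i (phi b) /\ omap phi (eop i b) = eop i (phi b)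
    & forall b, D b ->
        omap phi (fbar1 b) = fbar1 (phi b) /\ omap phi (ebar1 b) = ebar1 (phi b)].

(* Main.v *)
Require Import Defs.
From Stdlib Require Import ClassicalEpsilon FunctionalExtensionality.
From mathcomp Require Import all_boot all_order all_algebra zify.
Set Implicit Arguments. Unset Strict Implicit. Unset Printing Implicit Defensive.
Import Order.TTheory GRing.Theory Num.Theory.
Local Open Scope ring_scope.

(* Marked involution words are studied through the rank order on involutions, for which the
   Demazure conjugations and their inverses are monotone. A reduced word with a letter deleted
   is then a cover relation that can be carried through the word, which gives the exchange
   property and shows that a marked word has one mark if it is reduced and two if it is not.
   Hence pushing is a bijection on marked words, and the letter sum forces the first return to
   the reduced ones, forwards and backwards.

   Two marked words differing by a Coxeter--Knuth move (or by an exchange of the first two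
   letters) stay so related while they are pushed, so bumps commute with these moves; they also
   preserve descents. The crystal operators are determined by this data: inserting the first
   letter of w^(i+1) into w^i by row insertion is a sequence of Coxeter--Knuth moves whose
   positions depend on lengths only, and it intertwines f_i with f_i of a shorter pair, down to
   the case where w^i w^(i+1) is increasing and f_i only moves the bar. The operators e_i follow
   by reversing and negating words, and the operators with index 1-bar slide one letter through
   an increasing factor by such moves. *)

(** In terms of ranks a Demazure product rewrites one row or column as a minimum of neighbouring
    entries, with no case split on ascents; braid relations, commutation and monotonicity become
    integer inequalities. Bumps terminate because in a word with two marks every letter survives one
    of the two deletions, so all letters lie in a window supporting [pi]. The obstacle to commuting
    with moves is that an increment may make neighbouring letters collide and destroy the shape of
    the move. A collision forces the next push, after which some move at the same place relates the
    words again; so the two bumps are compared after one or two pushes on each side, not always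
    equally many. A move is determined by its place and its source. Hence a list of places has at
    most one end point from a given word, and a map respecting each move is known at the end of a
    path once it is known at the start. This and a few facts on descents and forbidden factors form
    [equivariant], kept abstract so that it also applies to the bump conjugated by reversal and
    negation. *)

Definition swapd (p : dperm) : dperm := (p.2, p.1).
Definition rmul (p : dperm) (i : int) : dperm := (p.1 \o sgen i, sgen i \o p.2).
(** Downward counterparts of the Demazure operators: they strip a generator at a descent. They are
    monotone too, which transports covers downwards. *)
Definition rdown (p : dperm) (i : int) : dperm :=
  if p.1 (i + 1) < p.1 i then rmul p i else p.
Definition ldown (i : int) (p : dperm) : dperm := swapd (rdown (swapd p) i).
Definition downconj (i : int) (p : dperm) : dperm := ldown i (rdown p i).

(** Working inside the window [-N, N] makes ranks finite sums; [in_rng] lists the i for which s_i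
    preserves that window. *)
Definition perm_in (N : int) (p : dperm) : Prop :=
  [/\ cancel p.1 p.2, cancel p.2 p.1 &
      forall x : int, (x < - N) || (N < x) -> p.1 x = x].

Definition in_rng (N i : int) : bool := (- N <= i) && (i < N).

(** Number of positions k in [-N, p] with f k > q. [absz] gives the length of this interval only for
    p >= -N - 1, hence that bound in the later statements. *)
Definition rk (N : int) (f : int -> int) (p q : int) : int :=
  \sum_(0 <= k < absz (p + N + 1)) (nat_of_bool (q < f (k%:Z - N))%R)%:Z.

Lemma sgenK i : involutive (sgen i).
Proof. by move=> x; rewrite /sgen; do !case: eqP => //; lia. Qed.

Lemma sgenl i : sgen i i = i + 1.
Proof. by rewrite /sgen eqxx. Qed.

Lemma sgenr i : sgen i (i + 1) = i.
Proof. by rewrite /sgen eqxx; case: eqP => //; lia. Qed.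

Lemma sgen_id (i x : int) : x != i -> x != i + 1 -> sgen i x = x.
Proof. by rewrite /sgen => /negPf -> /negPf ->. Qed.

Lemma swapdK : involutive swapd.
Proof. by case. Qed.

Lemma demL_swap i p : demL i p = swapd (demR (swapd p) i).
Proof. by case: p => f g; rewrite /demL /demR /swapd /=; case: ifP. Qed.

Lemma demR_swap i p : demR p i = swapd (demL i (swapd p)).
Proof. by rewrite demL_swap !swapdK. Qed.

Lemma perm_in_swap (N : int) p : perm_in N p -> perm_in N (swapd p).
Proof.
case: p => f g [/= fK gK fix_]; split=> //= x hx.
by rewrite -{1}(fix_ x hx) fK.
Qed.

Lemma perm_in_rmul (N : int) p (i : int) : in_rng N i -> perm_in N p -> perm_in N (rmul p i).
Proof.
case: p => f g /andP[h1 h2] [/= fK gK fix_]; split=> [x|x|x hx] /=.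
- by rewrite fK sgenK.
- by rewrite sgenK gK.
- by rewrite sgen_id ?fix_ //; apply/eqP; lia.
Qed.

Lemma perm_in_demR (N : int) p (i : int) : in_rng N i -> perm_in N p -> perm_in N (demR p i).
Proof. by move=> hi hp; rewrite /demR; case: ifP => // _; apply: perm_in_rmul. Qed.

Lemma perm_in_rdown (N : int) p (i : int) : in_rng N i -> perm_in N p -> perm_in N (rdown p i).
Proof. by move=> hi hp; rewrite /rdown; case: ifP => // _; apply: perm_in_rmul. Qed.

Lemma perm_in_demL (N : int) p (i : int) : in_rng N i -> perm_in N p -> perm_in N (demL i p).
Proof.
move=> hi hp; rewrite demL_swap; apply/perm_in_swap/perm_in_demR => //.
exact: perm_in_swap.
Qed.

Lemma perm_in_ldown (N : int) p (i : int) : in_rng N i -> perm_in N p -> perm_in N (ldown i p).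
Proof.
move=> hi hp; apply/perm_in_swap/perm_in_rdown => //.
exact: perm_in_swap.
Qed.

Lemma perm_in_id N : perm_in N (id, id).
Proof. by []. Qed.

Lemma perm_in_bnd (N : int) p (x : int) : perm_in N p -> - N <= x <= N -> - N <= p.1 x <= N.
Proof.
move=> [fK gK fix_] hx; apply/negPn/negP => h.
have h' : (p.1 x < - N) || (N < p.1 x) by lia.
by have := fix_ _ h'; move/(can_inj fK) => e; rewrite e in h'; lia.
Qed.

(** * Rank functions *)

Lemma rng_ind (N : int) (P : int -> Prop) : P (- N - 1) ->
  (forall p : int, - N <= p -> P (p - 1) -> P p) -> forall p : int, - N - 1 <= p -> P p.
Proof.
move=> h0 hS p hp.
have [k ->] : exists k : nat, p = k%:Z - N - 1 by exists (absz (p + N + 1)); lia.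
elim: k {p hp} => [|k IH]; first by rewrite sub0r.
apply: hS; first lia.
by have -> : k.+1%:Z - N - 1 - 1 = k%:Z - N - 1 by lia.
Qed.

Lemma rk0 (N : int) f (q : int) : rk N f (- N - 1) q = 0.
Proof. by rewrite /rk big_geq //; lia. Qed.

Lemma rkS (N : int) f (p q : int) : - N <= p -> rk N f p q = rk N f (p - 1) q + (nat_of_bool (q < f p)%R)%:Z.
Proof.
move=> hp; rewrite /rk; have -> : absz (p + N + 1) = (absz (p - 1 + N + 1)).+1 by lia.
rewrite big_nat_recr //=; congr (_ + _).
by have -> : (absz (p - 1 + N + 1))%:Z - N = p by lia.
Qed.

Lemma rk_col (N : int) p (x q : int) : perm_in N p -> - N <= q <= N -> - N - 1 <= x ->
  rk N p.1 x (q - 1) = rk N p.1 x q + (nat_of_bool (p.2 q <= x)%R)%:Z.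
Proof.
move=> hp hq; move: x; have hg := perm_in_bnd (perm_in_swap hp) hq.
rewrite /swapd /= in hg.
apply: rng_ind => [|x hx IH].
  by rewrite !rk0; case: lerP => //=; lia.
rewrite (rkS _ (q - 1)) // (rkS _ q) // IH.
case: hp => fK gK _.
have : (p.2 q == x) = (p.1 x == q) by apply/eqP/eqP => [<-|<-].
case: eqP; case: eqP; lia.
Qed.

Definition perm_le N (y z : dperm) : Prop :=
  forall p q : int, - N - 1 <= p -> rk N y.1 p q <= rk N z.1 p q.

Lemma perm_le_refl N y : perm_le N y y.
Proof. by move=> p q _. Qed.

Lemma perm_le_trans N y x z : perm_le N x y -> perm_le N y z -> perm_le N x z.
Proof. by move=> h1 h2 p q hp; apply: le_trans (h1 p q hp) (h2 p q hp). Qed.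

Lemma rk_inj (N : int) y z : perm_in N y -> perm_in N z ->
  (forall p q : int, - N - 1 <= p -> rk N y.1 p q = rk N z.1 p q) -> y = z.
Proof.
case: y z => [f g] [f' g'] [/= fK gK ff] [/= fK' gK' ff'] /= h.
have e : f = f'.
  apply: functional_extensionality => x.
  case: (lerP (- N) x) => hx; last by rewrite ff ?ff' ?hx.
  have hh (q : int) : (q < f x) = (q < f' x).
    have e1 := h x q ltac:(lia); have e2 := h (x - 1) q ltac:(lia).
    by move: e1; rewrite (rkS f) // (rkS f') // e2 => /addrI; case: (q < f x); case: (q < f' x).
  by have := hh (f x); have := hh (f' x); lia.
congr (_, _) => //; apply: functional_extensionality => x.
by apply: (can_inj fK); rewrite gK e gK'.
Qed.

Lemma perm_le_anti (N : int) y z : perm_in N y -> perm_in N z ->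
  perm_le N y z -> perm_le N z y -> y = z.
Proof.
move=> hy hz h1 h2; apply: (rk_inj hy hz) => p q hp.
by apply/eqP; rewrite eq_le h1 // h2.
Qed.

Lemma rk_rmul (N : int) p (i x q : int) : in_rng N i -> perm_in N p -> - N - 1 <= x ->
  rk N (rmul p i).1 x q =
  if x == i then rk N p.1 (i - 1) q + (nat_of_bool (q < p.1 (i + 1))%R)%:Z else rk N p.1 x q.
Proof.
case: p => f g /andP[h1 h2] hp; move: x; rewrite /rmul /=.
apply: rng_ind => [|x hx IH].
  by rewrite !rk0; case: eqP => //; lia.
rewrite rkS // IH /=.
case: (x =P i) => [-> |hxi].
  by rewrite sgenl; case: eqP => //; lia.
case: (x =P i + 1) => [e|hxi1].
  rewrite e sgenr; have -> : i + 1 - 1 = i by lia.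
  rewrite eqxx (rkS _ _ (p := i + 1)); last lia.
  have -> : i + 1 - 1 = i by lia.
  by rewrite (rkS _ _ (p := i)); lia.
rewrite sgen_id; try by apply/eqP.
rewrite [RHS]rkS //.
by case: eqP => //; lia.
Qed.

(** After the product position i holds the larger of the two values, so row i exceeds row i - 1
    exactly when one of them is above q. Written as a minimum this is visibly monotone; [rk_rdown]
    gets the dual maximum. *)
Lemma rk_demR (N : int) p (i x q : int) : in_rng N i -> perm_in N p -> - N - 1 <= x ->
  rk N (demR p i).1 x q =
  if x == i then Num.min (rk N p.1 (i - 1) q + 1) (rk N p.1 (i + 1) q) else rk N p.1 x q.
Proof.
move=> hi hp hx; have /andP[h1 h2] := hi.
have e1 := @rkS N p.1 i q h1; have e2 := @rkS N p.1 (i + 1) q ltac:(lia).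
have e3 : i + 1 - 1 = i by lia. rewrite e3 in e2.
rewrite /demR; case: ifP => hlt.
  by rewrite (rk_rmul q hi hp hx); case: eqP => // _; lia.
by case: eqP => // ->; lia.
Qed.

Lemma rk_rdown (N : int) p (i x q : int) : in_rng N i -> perm_in N p -> - N - 1 <= x ->
  rk N (rdown p i).1 x q =
  if x == i then Num.max (rk N p.1 (i - 1) q) (rk N p.1 (i + 1) q - 1) else rk N p.1 x q.
Proof.
move=> hi hp hx; have /andP[h1 h2] := hi.
have e1 := @rkS N p.1 i q h1; have e2 := @rkS N p.1 (i + 1) q ltac:(lia).
have e3 : i + 1 - 1 = i by lia. rewrite e3 in e2.
rewrite /rdown; case: ifP => hlt.
  by rewrite (rk_rmul q hi hp hx); case: eqP => // _; lia.
by case: eqP => // ->; lia.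
Qed.

Lemma rk_lmul (N : int) p (i x q : int) : in_rng N i -> perm_in N p -> - N - 1 <= x ->
  rk N (sgen i \o p.1) x q =
  if q == i then rk N p.1 x (i - 1) - (nat_of_bool (p.2 (i + 1) <= x)%R)%:Z
  else rk N p.1 x q.
Proof.
move=> hi hp hx; have /andP[h1 h2] := hi.
have key (q' : int) : q' != i -> rk N (sgen i \o p.1) x q' = rk N p.1 x q'.
  move=> hq; apply: eq_bigr => k _ /=; congr (nat_of_bool _)%:Z.
  by move: hq; rewrite /sgen; do !case: eqP => //; lia.
case: eqP => [->|/eqP /key //].
have hp' := perm_in_swap (perm_in_rmul hi (perm_in_swap hp)).
have := rk_col hp' (q := i) (x := x); rewrite /= sgenl key; last by apply/eqP; lia.
by move=> -> //; [rewrite addrK | lia].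
Qed.

Lemma rk_demL (N : int) p (i x q : int) : in_rng N i -> perm_in N p -> - N - 1 <= x ->
  rk N (demL i p).1 x q =
  if q == i then Num.min (rk N p.1 x (i + 1) + 1) (rk N p.1 x (i - 1)) else rk N p.1 x q.
Proof.
move=> hi hp hx; have /andP[h1 h2] := hi.
have e1 := rk_col (x := x) (q := i) hp ltac:(lia) hx.
have e2 := rk_col (x := x) (q := i + 1) hp ltac:(lia) hx.
have e3 : i + 1 - 1 = i by lia. rewrite e3 in e2.
rewrite /demL; case: ifP => hlt.
  by rewrite (rk_lmul q hi hp hx); case: eqP => // _; lia.
by case: eqP => // ->; lia.
Qed.

Lemma rk_ldown (N : int) p (i x q : int) : in_rng N i -> perm_in N p -> - N - 1 <= x ->
  rk N (ldown i p).1 x q =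
  if q == i then Num.max (rk N p.1 x (i + 1)) (rk N p.1 x (i - 1) - 1) else rk N p.1 x q.
Proof.
move=> hi hp hx; have /andP[h1 h2] := hi.
have e1 := rk_col (x := x) (q := i) hp ltac:(lia) hx.
have e2 := rk_col (x := x) (q := i + 1) hp ltac:(lia) hx.
have e3 : i + 1 - 1 = i by lia. rewrite e3 in e2.
rewrite /ldown /rdown; case: ifP => /= hlt.
  by rewrite (rk_lmul q hi hp hx); case: eqP => // _; lia.
by case: eqP => // ->; lia.
Qed.

(** * Commutation and braid relations of the Demazure operators *)

Lemma demLR (N : int) (i j : int) p : in_rng N i -> in_rng N j -> perm_in N p ->
  demL i (demR p j) = demR (demL i p) j.
Proof.
move=> hi hj hp; have /andP[h1 h2] := hj.
apply: (@rk_inj N) => [||x q hx].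
- exact/perm_in_demL/perm_in_demR.
- exact/perm_in_demR/perm_in_demL.
rewrite rk_demL ?rk_demR ?rk_demL //; try exact/perm_in_demR; try exact/perm_in_demL; try lia.
by case: eqP => // _; case: eqP => // _; lia.
Qed.

Lemma demR_idem p (i : int) : demR (demR p i) i = demR p i.
Proof.
rewrite {2 3}/demR; case: ifP => h; last by rewrite /demR h.
by rewrite /demR /= sgenl sgenr; case: ifP => //; lia.
Qed.

Lemma demR_far (N : int) (i j : int) p : in_rng N i -> in_rng N j -> perm_in N p ->
  (i + 1 < j) || (j + 1 < i) -> demR (demR p i) j = demR (demR p j) i.
Proof.
move=> hi hj hp hij; have /andP[h1 h2] := hj; have /andP[h3 h4] := hi.
apply: (@rk_inj N) => [||x q hx]; try by do !apply: perm_in_demR.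
rewrite !rk_demR //; try (by do !apply: perm_in_demR); try lia.
by do !case: eqP; lia.
Qed.

Lemma demR_braid (N : int) (i : int) p : in_rng N i -> in_rng N (i + 1) -> perm_in N p ->
  demR (demR (demR p i) (i + 1)) i = demR (demR (demR p (i + 1)) i) (i + 1).
Proof.
move=> hi hj hp; have /andP[h1 h2] := hj; have /andP[h3 h4] := hi.
apply: (@rk_inj N) => [||x q hx]; try by do !apply: perm_in_demR.
rewrite !rk_demR //; try (by do !apply: perm_in_demR); try lia.
have e1 := @rkS N p.1 i q ltac:(lia); have e2 := @rkS N p.1 (i + 1) q ltac:(lia).
have e3 := @rkS N p.1 (i + 1 + 1) q ltac:(lia).
have e4 : i + 1 - 1 = i by lia. have e5 : i + 1 + 1 - 1 = i + 1 by lia.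
rewrite !e4 e5 in e2 e3 *.
by do !case: eqP; lia.
Qed.

Lemma demL_idem (i : int) p : demL i (demL i p) = demL i p.
Proof. by rewrite !demL_swap swapdK demR_idem. Qed.

Lemma demL_far (N : int) (i j : int) p : in_rng N i -> in_rng N j -> perm_in N p ->
  (i + 1 < j) || (j + 1 < i) -> demL j (demL i p) = demL i (demL j p).
Proof.
move=> hi hj hp hij; rewrite !demL_swap !swapdK (@demR_far N) //.
exact: perm_in_swap.
Qed.

Lemma demL_braid (N : int) (i : int) p : in_rng N i -> in_rng N (i + 1) -> perm_in N p ->
  demL i (demL (i + 1) (demL i p)) = demL (i + 1) (demL i (demL (i + 1) p)).
Proof.
move=> hi hj hp; rewrite !demL_swap !swapdK (@demR_braid N) //.
exact: perm_in_swap.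
Qed.

Lemma perm_in_conj (N : int) p (i : int) : in_rng N i -> perm_in N p -> perm_in N (demconj i p).
Proof. by move=> hi hp; apply/perm_in_demL/perm_in_demR. Qed.

Lemma conj_far (N : int) (i j : int) p : in_rng N i -> in_rng N j -> perm_in N p ->
  (i + 1 < j) || (j + 1 < i) -> demconj j (demconj i p) = demconj i (demconj j p).
Proof.
move=> hi hj hp hij; rewrite /demconj.
have R k q := @perm_in_demR N q k.
rewrite -(demLR hi hj (R i p hi hp)) -(demLR hj hi (R j p hj hp)).
by rewrite (demL_far hi hj (R _ _ hj (R _ _ hi hp)) hij) (demR_far hi hj hp hij).
Qed.

(** Left and right operators commute, so three conjugations regroup into a left word and a right
    word, each subject to the braid relation. *)
Lemma conj_braid (N : int) (i : int) p : in_rng N i -> in_rng N (i + 1) -> perm_in N p ->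
  demconj i (demconj (i + 1) (demconj i p)) =
  demconj (i + 1) (demconj i (demconj (i + 1) p)).
Proof.
move=> hi hj hp; rewrite /demconj.
have R k q := @perm_in_demR N q k; have L k q := @perm_in_demL N q k.
set j := i + 1 in hj *.
have hR k l : in_rng N k -> in_rng N l ->
    demL k (demR (demL l (demR (demL k (demR p k)) l)) k) =
    demL k (demL l (demL k (demR (demR (demR p k) l) k))).
  move=> hk hl.
  rewrite -(demLR hk hl (R k p hk hp)).
  rewrite -(demLR hl hk (L k _ hk (R l _ hl (R k p hk hp)))).
  by rewrite -(demLR hk hk (R l _ hl (R k p hk hp))).
rewrite !hR // (demR_braid hi hj hp) (demL_braid hi hj) //.
exact: R _ _ hj (R _ _ hi (R _ _ hj hp)).
Qed.

(** Both sides are threefold Demazure products, of s_j s_i s_j and s_i s_j s_i, equal by braiding or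
    by commutation and idempotence. This is why the first two letters of an involution word may be
    exchanged. *)
Lemma conj_id (i j : int) :
  demconj j (demconj i (id, id)) = demconj i (demconj j (id, id)).
Proof.
set N := `|i| + `|j| + 2; have hi : in_rng N i by rewrite /in_rng /N; lia.
have hj : in_rng N j by rewrite /in_rng /N; lia.
have h0 := perm_in_id N.
have LR (k : int) : demL k (id, id) = demR (id, id) k.
  by rewrite /demL /demR /=; case: ifP.
have LRR (k : int) : demL k (demR (id, id) k) = demR (id, id) k.
  by rewrite -LR demL_idem.
have step (k l : int) : in_rng N k -> in_rng N l ->
    demconj l (demconj k (id, id)) = demR (demR (demR (id, id) l) k) l.
  move=> hk hl; rewrite /demconj LRR (demLR hl hl) ?(demLR hl hk) ?LR //.
  exact: perm_in_demR.
rewrite !step //.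
have [e|h] := eqVneq i j; first by rewrite e.
have [h1|h1] := boolP ((i + 1 < j) || (j + 1 < i)).
  rewrite -(demR_far hi hj h0 h1) demR_idem.
  by rewrite -(demR_far hi hj (perm_in_demR hi h0) h1) demR_idem.
have [e|e] : j = i + 1 \/ i = j + 1 by lia.
  by rewrite e in hj *; rewrite (demR_braid hi hj h0).
by rewrite e in hi *; rewrite (demR_braid hj hi h0).
Qed.

Lemma rdown_ldown (N : int) (i j : int) p : in_rng N i -> in_rng N j -> perm_in N p ->
  ldown i (rdown p j) = rdown (ldown i p) j.
Proof.
move=> hi hj hp; have /andP[h1 h2] := hj.
apply: (@rk_inj N) => [||x q hx].
- exact/perm_in_ldown/perm_in_rdown.
- exact/perm_in_rdown/perm_in_ldown.
rewrite rk_ldown ?rk_rdown ?rk_ldown //; try exact/perm_in_rdown; try exact/perm_in_ldown; try lia.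
by case: eqP => // _; case: eqP => // _; lia.
Qed.

(** * Demazure conjugation of involutions *)

Definition inv_in (N : int) (p : dperm) : Prop := perm_in N p /\ swapd p = p.
Definition asc (p : dperm) (i : int) : bool := p.1 i < p.1 (i + 1).

Lemma inv_in_id (N : int) : inv_in N (id, id).
Proof. by []. Qed.

Lemma inv_in_conj (N : int) (i : int) p : in_rng N i -> inv_in N p -> inv_in N (demconj i p).
Proof.
move=> hi [hp e]; split; first exact: perm_in_conj.
by rewrite /demconj {1}(demLR hi hi hp) (demR_swap i (demL i p)) (demL_swap i p) !swapdK e.
Qed.

Lemma inv_in_downconj (N : int) (i : int) p : in_rng N i -> inv_in N p -> inv_in N (downconj i p).
Proof.
move=> hi [hp e]; split; first exact/perm_in_ldown/perm_in_rdown.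
by rewrite /downconj {1}(rdown_ldown hi hi hp) /ldown e.
Qed.

Lemma asc_neq (N : int) p (i : int) : perm_in N p -> ~~ asc p i -> p.1 (i + 1) < p.1 i.
Proof.
case=> fK _ _; rewrite /asc -leNgt le_eqVlt => /orP[/eqP /(can_inj fK)|//]; lia.
Qed.

Lemma conj_desc (N : int) p (i : int) : inv_in N p -> ~~ asc p i -> demconj i p = p.
Proof.
case: p => f g [hp [_ e]]; rewrite /= in e; subst g; rewrite /asc /= => /negPf h.
by rewrite /demconj /demR /= h /demL /= h.
Qed.

Lemma down_asc (N : int) p (i : int) : inv_in N p -> asc p i -> downconj i p = p.
Proof.
case: p => f g [hp [_ e]]; rewrite /= in e; subst g; rewrite /asc /= => h.
have h' : (f (i + 1) < f i) = false by lia.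
by rewrite /downconj /ldown /rdown /= h' /= h'.
Qed.

Lemma sgen_lt (i x y : int) : x < y -> (sgen i x < sgen i y) = ~~ ((x == i) && (y == i + 1)).
Proof. by rewrite /sgen => h; do !case: eqP => //=; lia. Qed.

Lemma conj_asc (N : int) p (i : int) : inv_in N p -> asc p i ->
  downconj i (demconj i p) = p /\ ~~ asc (demconj i p) i.
Proof.
case: p => f g [hp [_ e]]; rewrite /= in e; subst g; rewrite /asc /= => h.
rewrite /demconj /demR /= h /demL /= sgen_lt //.
(* The left factor s_i acts unless f fixes both i and i + 1; in that case the right factor alone
   already yields an involution. *)
case: ifP => /= h2.
  rewrite /downconj /rdown /= sgenl sgenr sgen_lt // h2 /=.
  rewrite /ldown /rdown /= !sgenK sgenl sgenr h /rmul /swapd /=.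
  split; first by congr (_, _); apply: functional_extensionality => x /=; rewrite !sgenK.
  by move: (sgen_lt i h); rewrite h2; lia.
rewrite /downconj /rdown /= sgenl sgenr h /= /ldown /rdown /= !sgenK.
rewrite (_ : (f (i + 1) < f i) = false) /swapd /=; last by lia.
split; last by lia.
by congr (_, _); apply: functional_extensionality => x /=; rewrite !sgenK.
Qed.

Lemma down_desc (N : int) p (i : int) : inv_in N p -> ~~ asc p i ->
  demconj i (downconj i p) = p /\ asc (downconj i p) i.
Proof.
move=> hp ha; have := asc_neq hp.1 ha.
case: p hp {ha} => f g [hp [_ e]]; rewrite /= in e; subst g => /= h; rewrite /asc.
rewrite /downconj /rdown /= h /ldown /rdown /= sgen_lt //.
case: ifP => /= h2.
  rewrite /demconj /demR /= sgenl sgenr sgen_lt // h2 /=.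
  rewrite /demL /= !sgenK sgenl sgenr h /=.
  split; last by move: (sgen_lt i h); rewrite h2; lia.
  by congr (_, _); apply: functional_extensionality => x /=; rewrite !sgenK.
rewrite /demconj /demR /= sgenl sgenr h /= /demL /= !sgenK.
rewrite (_ : (f i < f (i + 1)) = false) /swapd /=; last by lia.
split; last by lia.
by congr (_, _); apply: functional_extensionality => x /=; rewrite !sgenK.
Qed.

Lemma conj_le (N : int) p (i : int) : in_rng N i -> perm_in N p -> perm_le N p (demconj i p).
Proof.
move=> hi hp; have /andP[h1 h2] := hi.
apply: (@perm_le_trans _ (demR p i)) => x q hx.
  rewrite (rk_demR q hi hp hx); case: eqP => // ->.
  have e1 := @rkS N p.1 i q h1; have e2 := @rkS N p.1 (i + 1) q ltac:(lia).
  have e3 : i + 1 - 1 = i by lia. rewrite e3 in e2; lia.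
have hp' := perm_in_demR hi hp.
rewrite (rk_demL q hi hp' hx); case: eqP => // ->.
have e1 := rk_col (x := x) (q := i) hp' ltac:(lia) hx.
have e2 := rk_col (x := x) (q := i + 1) hp' ltac:(lia) hx.
have e3 : i + 1 - 1 = i by lia. rewrite e3 in e2; lia.
Qed.

Lemma conj_mono (N : int) p p' (i : int) : in_rng N i -> perm_in N p -> perm_in N p' ->
  perm_le N p p' -> perm_le N (demconj i p) (demconj i p').
Proof.
move=> hi hp hp' h x q hx; have /andP[h1 h2] := hi.
rewrite !(rk_demL _ hi) //; try exact: perm_in_demR.
rewrite !(rk_demR _ hi) //.
have := h x q hx; have := h x (i - 1) hx; have := h x (i + 1) hx.
have := h (i - 1) q ltac:(lia); have := h (i - 1) (i - 1) ltac:(lia).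
have := h (i - 1) (i + 1) ltac:(lia).
have := h (i + 1) q ltac:(lia); have := h (i + 1) (i - 1) ltac:(lia).
have := h (i + 1) (i + 1) ltac:(lia).
by case: eqP => _; case: eqP => _; lia.
Qed.

Lemma down_mono (N : int) p p' (i : int) : in_rng N i -> perm_in N p -> perm_in N p' ->
  perm_le N p p' -> perm_le N (downconj i p) (downconj i p').
Proof.
move=> hi hp hp' h x q hx; have /andP[h1 h2] := hi.
rewrite !(rk_ldown _ hi) //; try exact: perm_in_rdown.
rewrite !(rk_rdown _ hi) //.
have := h x q hx; have := h x (i - 1) hx; have := h x (i + 1) hx.
have := h (i - 1) q ltac:(lia); have := h (i - 1) (i - 1) ltac:(lia).
have := h (i - 1) (i + 1) ltac:(lia).
have := h (i + 1) q ltac:(lia); have := h (i + 1) (i - 1) ltac:(lia).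
have := h (i + 1) (i + 1) ltac:(lia).
by case: eqP => _; case: eqP => _; lia.
Qed.

(** * Covers in the rank order on involutions *)

Definition covers (N : int) (y z : dperm) : Prop :=
  [/\ inv_in N y, inv_in N z, perm_le N y z, y <> z &
      forall m, inv_in N m -> perm_le N y m -> perm_le N m z -> m = y \/ m = z].

Lemma down_le (N : int) p (i : int) : in_rng N i -> inv_in N p -> perm_le N (downconj i p) p.
Proof.
move=> hi hp; case: (boolP (asc p i)) => ha.
  by rewrite (down_asc hp ha); apply: perm_le_refl.
have [e _] := down_desc hp ha; rewrite -{2}e; apply: conj_le => //.
by case: (inv_in_downconj hi hp).
Qed.

Lemma covers_conj (N : int) y (i : int) : in_rng N i -> inv_in N y -> asc y i ->
  covers N y (demconj i y).
Proof.
move=> hi hy ha; have hz := inv_in_conj hi hy.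
have [e nz] := conj_asc hy ha.
split=> //; first by apply: conj_le => //; case: hy.
  by move=> e'; rewrite -e' ha in nz.
move=> m hm h1 h2; case: (boolP (asc m i)) => hma.
  left; apply: (@perm_le_anti N) => //; [by case: hm|by case: hy|].
  rewrite -(down_asc hm hma) -e; apply: down_mono => //; [by case: hm|by case: hz].
right; apply: (@perm_le_anti N) => //; [by case: hm|by case: hz|].
rewrite -(conj_desc hm hma); apply: conj_mono => //; [by case: hy|by case: hm].
Qed.

(** Lifting property: by monotonicity [demconj i y] lies below [demconj i z], which is z, so it sits
    in the cover and cannot be y. *)
Lemma covers_lift (N : int) y z (i : int) : in_rng N i -> covers N y z ->
  asc y i -> ~~ asc z i -> z = demconj i y.
Proof.
move=> hi [hy hz hle hne hcov] ha hd.
have [e nz] := conj_asc hy ha.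
have [] := hcov _ (inv_in_conj hi hy) (conj_le hi hy.1).
- by rewrite -(conj_desc hz hd); apply: conj_mono => //; [case: hy|case: hz].
- by move=> e'; rewrite e' ha in nz.
- by [].
Qed.

(** A middle element with a descent at i comes down to a middle element of y and z. One with an
    ascent at i would put [demconj i y] between y and z, although both ascend at i. *)
Lemma covers_up (N : int) y z (i : int) : in_rng N i -> covers N y z ->
  asc y i -> asc z i -> covers N (demconj i y) (demconj i z).
Proof.
move=> hi [hy hz hle hne hcov] ha hd.
have [ey ny] := conj_asc hy ha; have [ez nz] := conj_asc hz hd.
have hy' := inv_in_conj hi hy; have hz' := inv_in_conj hi hz.
split=> //; first by apply: conj_mono => //; [case: hy|case: hz].
  by move=> e; apply: hne; rewrite -ey -ez e.
move=> m hm h1 h2; case: (boolP (asc m i)) => hma.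
  have hyz : perm_le N (demconj i y) z.
    apply: perm_le_trans h1 _.
    by rewrite -(down_asc hm hma) -ez; apply: down_mono => //; [case: hm|case: hz'].
  have [e|e] := hcov _ hy' (conj_le hi hy.1) hyz; first by rewrite e ha in ny.
  by rewrite e hd in ny.
have hm' := inv_in_downconj hi hm; have [em am] := down_desc hm hma.
have [||e|e] := hcov _ hm'.
- by rewrite -ey; apply: down_mono => //; [case: hy'|case: hm].
- by rewrite -ez; apply: down_mono => //; [case: hm|case: hz'].
- by left; rewrite -em e.
- by right; rewrite -em e.
Qed.

Lemma covers_down (N : int) y z (i : int) : in_rng N i -> covers N y z ->
  ~~ asc y i -> ~~ asc z i -> covers N (downconj i y) (downconj i z).
Proof.
move=> hi [hy hz hle hne hcov] ha hd.
have [ey ny] := down_desc hy ha; have [ez nz] := down_desc hz hd.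
have hy' := inv_in_downconj hi hy; have hz' := inv_in_downconj hi hz.
split=> //; first by apply: down_mono => //; [case: hy|case: hz].
  by move=> e; apply: hne; rewrite -ey -ez e.
move=> m hm h1 h2; case: (boolP (asc m i)) => hma.
  have hm' := inv_in_conj hi hm; have [em am] := conj_asc hm hma.
  have [||e|e] := hcov _ hm'.
  - by rewrite -ey; apply: conj_mono => //; [case: hy'|case: hm].
  - by rewrite -ez; apply: conj_mono => //; [case: hm|case: hz'].
  - by left; rewrite -em e.
  - by right; rewrite -em e.
have hyz : perm_le N y (downconj i z).
  apply: perm_le_trans h2.
  by rewrite -(conj_desc hm hma) -ey; apply: conj_mono => //; [case: hy'|case: hm].
have [e|e] := hcov _ hz' hyz (down_le hi hz); first by rewrite e (negPf ha) in nz.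
by rewrite e (negPf hd) in nz.
Qed.

(** The identity has rank 0 on the diagonal, which forces f x <= x for every x; an involution with
    this property is trivial. *)
Lemma le_id (N : int) y : inv_in N y -> perm_le N y (id, id) -> y = (id, id).
Proof.
case: y => f g [hp [_ e]] h; rewrite /= in e; subst g.
have [fK _ hfix] := hp; rewrite /= in fK hfix.
have r0 (q x : int) : - N - 1 <= x -> x <= q -> rk N id x q = 0.
  move=> hx; move: x hx; apply: rng_ind => [|x hx IH] hq; first by rewrite rk0.
  by rewrite rkS // IH //=; lia.
have r1 (q x : int) : - N - 1 <= x -> 0 <= rk N f x q.
  move=> hx; move: x hx; apply: rng_ind => [|x hx IH]; first by rewrite rk0.
  by rewrite rkS //; lia.
have le1 (x : int) : f x <= x.
  case: (lerP (- N) x) => hx; last by rewrite hfix ?hx.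
  have := h x x ltac:(lia); rewrite /= r0 //; last lia.
  rewrite rkS //; have := r1 x (x - 1) ltac:(lia).
  by case: (ltrP x (f x)) => //=; lia.
have e : f = id; last by rewrite e.
apply: functional_extensionality => x.
by have := le1 (f x); rewrite fK; have := le1 x; lia.
Qed.

(** * Involution words *)

Definition act (p : dperm) (w : seq int) : dperm := foldl (fun p i => demconj i p) p w.

Definition did : dperm := (id, id).

(** Reducedness as a running test, each letter being an ascent when it acts; [is_inv_wordP]
    identifies it with minimality of length. *)
Fixpoint ok (p : dperm) (w : seq int) : bool :=
  if w is i :: w' then asc p i && ok (demconj i p) w' else true.

Definition bounded (N : int) (w : seq int) : bool := all (in_rng N) w.

Lemma act_cat p u v : act p (u ++ v) = act (act p u) v.
Proof. exact: foldl_cat. Qed.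

Lemma ok_cat p u v : ok p (u ++ v) = ok p u && ok (act p u) v.
Proof. by elim: u p => //= i u IH p; rewrite IH andbA. Qed.

Lemma inv_in_act (N : int) p w : bounded N w -> inv_in N p -> inv_in N (act p w).
Proof.
by elim: w p => //= i w IH p /andP[hi hw] hp; apply: IH => //; apply: inv_in_conj.
Qed.

Lemma bounded_cat (N : int) u v : bounded N (u ++ v) = bounded N u && bounded N v.
Proof. exact: all_cat. Qed.

Lemma in_rng_le (N M : int) i : N <= M -> in_rng N i -> in_rng M i.
Proof. by rewrite /in_rng; lia. Qed.

Lemma bounded_le (N M : int) w : N <= M -> bounded N w -> bounded M w.
Proof. by move=> h; apply: sub_all => i; apply: in_rng_le. Qed.

Lemma ex_bounded w : exists N : int, bounded N w.
Proof.
elim: w => [|i w [N hN]]; first by exists 0.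
exists (`|N| + `|i| + 1); apply/andP; split; first by rewrite /in_rng; lia.
by apply: bounded_le hN; lia.
Qed.

Lemma act_cancel (N : int) p p' w : bounded N w -> inv_in N p -> inv_in N p' ->
  ok p w -> ok p' w -> act p w = act p' w -> p = p'.
Proof.
elim: w p p' => //= i w IH p p' /andP[hi hw] hp hp' /andP[a o] /andP[a' o'] e.
have e' := IH _ _ hw (inv_in_conj hi hp) (inv_in_conj hi hp') o o' e.
have [<- _] := conj_asc hp a; rewrite e'.
by case: (conj_asc hp' a').
Qed.

Lemma take_drop_split (T : Type) (A : seq T) j : (j < size A)%N ->
  exists x, A = take j A ++ x :: drop j.+1 A.
Proof.
elim: A j => //= a A IH [|j] hj; first by exists a; rewrite drop0.
by have [x e] := IH j hj; exists x; rewrite {1}e.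
Qed.

(** Induction on the last letter a. If y ascends at a, lifting shows that deleting a gives y;
    otherwise the cover is pulled down through a. *)
Lemma covers_delete (N : int) A y : bounded N A -> ok did A ->
  covers N y (act did A) ->
  exists A1 x A2, [/\ A = A1 ++ x :: A2, ok did (A1 ++ A2) & act did (A1 ++ A2) = y].
Proof.
elim/last_ind: A y => [|A a IH] y.
  by move=> _ _ [hy _ hle hne _]; have := le_id hy hle.
rewrite -cats1 bounded_cat ok_cat act_cat /= !andbT => /andP[hA ha] /andP[oA asA] hc.
have hz' := inv_in_act hA (inv_in_id N); set z' := act did A in asA hc IH hz' *.
have [e nz] := conj_asc hz' asA; have [hy hz _ _ _] := hc.
case: (boolP (asc y a)) => hya.
  have e2 := covers_lift ha hc hya nz; exists A, a, [::].
  rewrite cats0; split=> //; rewrite -/z' -e e2.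
  by case: (conj_asc hy hya).
have := covers_down ha hc hya nz; rewrite e => hc'.
have [A1 [x [A2 [eA o eact]]]] := IH _ hA oA hc'.
have [ey ay] := down_desc hy hya.
exists A1, x, (A2 ++ [:: a]); rewrite eA -catA; split=> //.
  by rewrite catA ok_cat o eact /= ay.
by rewrite catA act_cat eact.
Qed.

Lemma ok_exchange (N : int) A (s : int) : bounded N A -> in_rng N s -> ok did A ->
  ~~ asc (act did A) s ->
  exists A1 x A2, [/\ A = A1 ++ x :: A2, ok did (A1 ++ A2 ++ [:: s])
    & act did (A1 ++ A2 ++ [:: s]) = act did A].
Proof.
move=> hA hs oA nz; have hz := inv_in_act hA (inv_in_id N).
have [e a] := down_desc hz nz.
have hc := covers_conj hs (inv_in_downconj hs hz) a; rewrite e in hc.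
have [A1 [x [A2 [eA o ea]]]] := covers_delete hA oA hc.
exists A1, x, A2; split=> //; first by rewrite catA ok_cat o ea /= a.
by rewrite catA act_cat ea /=.
Qed.

(** While the letters ascend for both elements the pair stays a cover. At the first letter failing
    for the upper one only, the lifting property makes the two meet. *)
Lemma covers_ok_break (N : int) y z B : bounded N B -> covers N y z -> ok y B -> ~~ ok z B ->
  exists B1 b B2, [/\ B = B1 ++ b :: B2, ok z B1 & act z B1 = act y (B1 ++ [:: b])].
Proof.
elim: B y z => //= b B IH y z /andP[hb hB] hc /andP[ay oy].
case: (boolP (asc z b)) => /= az nz; last first.
  exists [::], b, B; split=> //=; exact: covers_lift hc ay az.
have [B1 [b' [B2 [eB o e]]]] := IH _ _ hB (covers_up hb hc ay az) oy nz.
by exists (b :: B1), b', B2; rewrite eB /= az.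
Qed.

Lemma reduce_ok (N : int) w : bounded N w -> exists v, [/\ bounded N v, ok did v,
  act did v = act did w & (size v <= size w)%N /\ (~~ ok did w -> (size v < size w)%N)].
Proof.
elim/last_ind: w => [|w a IH]; first by exists [::].
rewrite -cats1 bounded_cat act_cat /= andbT => /andP[hw ha].
have [v [hv ov ev [sv sv']]] := IH hw.
case: (boolP (asc (act did v) a)) => h.
  exists (v ++ [:: a]); rewrite bounded_cat hv /= ha act_cat ev ok_cat ov /= h; split=> //.
  rewrite !size_cat /= ok_cat /= -ev h andbT !addn1 ltnS; split=> // nw.
  by rewrite ltnS; apply: sv'; rewrite andbT in nw.
exists v; split=> //.
  by rewrite -ev (conj_desc (inv_in_act hv (inv_in_id N)) h).
by rewrite size_cat addn1; split; [apply: leqW|rewrite ltnS].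
Qed.

(** The exchange property makes the second word end in the last letter of the first; that letter is
    then cancelled from both. *)
Lemma ok_size (N : int) u v : bounded N u -> bounded N v -> ok did u -> ok did v ->
  act did u = act did v -> size u = size v.
Proof.
elim/last_ind: u v => [|u a IH] v.
  case/lastP: v => // v b _; rewrite -cats1 bounded_cat ok_cat act_cat /= !andbT.
  move=> /andP[hv hb] _ /andP[ov av] /esym e.
  have [_] := conj_asc (inv_in_act hv (inv_in_id N)) av.
  by rewrite e /asc /=; lia.
rewrite -cats1 bounded_cat ok_cat act_cat /= !andbT.
move=> /andP[hu ha] hv /andP[ou au] ov e.
have [_ nd] := conj_asc (inv_in_act hu (inv_in_id N)) au; rewrite e in nd.
have [A1 [x [A2 [eA o eact]]]] := ok_exchange hv ha ov nd.
have hA : bounded N (A1 ++ A2).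
  by move: hv; rewrite eA !bounded_cat /= => /and3P[-> _ ->].
rewrite eA !size_cat /= addn1 addnS; congr _.+1; rewrite -size_cat.
rewrite catA ok_cat /= andbT in o; case/andP: o => o1 o2.
apply: IH => //.
apply: (@act_cancel N _ _ [:: a]); rewrite /= ?ha ?au ?o2 //; try exact: inv_in_act.
by rewrite e -eact catA act_cat.
Qed.

Lemma is_inv_wordP w : is_inv_word w <-> ok did w.
Proof.
split=> [[_ hmin]|o].
  apply/negPn/negP => nw; have [N hN] := ex_bounded w.
  have [v [hv ov ev [_ /(_ nw) sv]]] := reduce_ok hN.
  have := hmin v; rewrite /inv_of_word -/(act did v) ev leqNgt sv => h.
  by have := h (fun=> erefl).
split=> // v hv.
have [N1 h1] := ex_bounded w; have [N2 h2] := ex_bounded v.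
pose N := `|N1| + `|N2|.
have {}h1 : bounded N w by apply: bounded_le h1; lia.
have {}h2 : bounded N v by apply: bounded_le h2; lia.
have [v' [hv' ov' ev' [sv _]]] := reduce_ok h2.
rewrite (@ok_size N w v') // ev'.
have [_ /= i1] := inv_in_act h1 (inv_in_id N); have [_ /= i2] := inv_in_act h2 (inv_in_id N).
have : (act did w).1 = (act did v).1.
  by apply: functional_extensionality => x; apply: esym (hv x).
move: i1 i2; case: (act did w) => f g; case: (act did v) => f' g' /=.
by move=> [-> _] [-> _] ->.
Qed.

Lemma inv_word_forP w pi : inv_word_for w pi <-> ok did w /\ (act did w).1 = pi.
Proof.
split=> [[h hmin]|[o e]].
  split; last by apply: functional_extensionality => x; apply: h.
  apply/is_inv_wordP; split=> // v hv; apply: hmin => x; rewrite hv; exact: h.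
by have [_ hmin] := (is_inv_wordP w).2 o; rewrite -e; split.
Qed.

Lemma act_eq w v : (act did w).1 = (act did v).1 -> act did w = act did v.
Proof.
have [N1 h1] := ex_bounded w; have [N2 h2] := ex_bounded v.
have [_] := inv_in_act h1 (inv_in_id N1); have [_] := inv_in_act h2 (inv_in_id N2).
by case: (act did w) => f g; case: (act did v) => f' g' /= [-> _] [-> _] ->.
Qed.

Lemma act_inj w v p C : ok did (w ++ C) -> ok did (v ++ C) ->
  (act did (w ++ C)).1 = p -> (act did (v ++ C)).1 = p -> act did w = act did v.
Proof.
move=> o1 o2 <- /act_eq; move: o1 o2; rewrite !ok_cat !act_cat => /andP[o1 o1'] /andP[o2 o2'] e.
have [N hN] := ex_bounded ((w ++ v) ++ C).
move: hN; rewrite !bounded_cat => /andP[/andP[hw hv] hC].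
apply: (@act_cancel N _ _ C) => //; exact: inv_in_act.
Qed.

(** * Marked words *)

Lemma delete_at_cat A x B : delete_at (A ++ x :: B) (size A) = A ++ B.
Proof.
rewrite /delete_at take_size_cat // -addn1 drop_cat ltnNge leq_addr /=.
by rewrite addnC addnK /= drop0.
Qed.

Lemma marked_cat pi A x B :
  marked pi (A ++ x :: B) (size A) <-> ok did (A ++ B) /\ (act did (A ++ B)).1 = pi.
Proof.
rewrite /marked delete_at_cat size_cat /= addnS ltnS leq_addr inv_word_forP.
by split=> [[]|].
Qed.

Lemma marked_split pi w i : marked pi w i -> exists A x B,
  [/\ w = A ++ x :: B, i = size A, ok did (A ++ B) & (act did (A ++ B)).1 = pi].
Proof.
move=> h; have [hi _] := h; have [x e] := take_drop_split hi.
have hs : size (take i w) = i by rewrite size_takel // ltnW.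
exists (take i w), x, (drop i.+1 w).
have h' : marked pi (take i w ++ x :: drop i.+1 w) (size (take i w)) by rewrite -e hs.
by move/marked_cat: h' => [].
Qed.

(** Cancelling the suffix C shows that A B y and A x B give the same involution. It has a descent at
    y, so y cannot follow A x B in a reduced word. *)
Lemma marked_lt_not_ok pi A x B y C :
  marked pi (A ++ x :: B ++ y :: C) (size A) ->
  marked pi (A ++ x :: B ++ y :: C) (size (A ++ x :: B)) -> ~~ ok did (A ++ x :: B ++ [:: y]).
Proof.
move=> /marked_cat[o1 e1]; rewrite -cat_cons catA => /marked_cat[o2 e2].
have eC : A ++ B ++ y :: C = (A ++ B ++ [:: y]) ++ C by rewrite -!catA.
rewrite eC in o1 e1; have e := act_inj o1 o2 e1 e2.
have [N hN] := ex_bounded (A ++ B ++ [:: y]).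
move: (hN); rewrite catA bounded_cat => /andP[hAB _].
move: o1; rewrite ok_cat catA ok_cat /= andbT => /andP[/andP[_ ay] _].
have [_ nd] := conj_asc (inv_in_act hAB (inv_in_id N)) ay.
by rewrite -cat_cons catA ok_cat -e catA act_cat /= (negPf nd) andbF.
Qed.

Lemma marked_pair pi w i j : (i < j)%N -> marked pi w i -> marked pi w j ->
  exists A x B y C, [/\ w = A ++ x :: B ++ y :: C, i = size A & j = size (A ++ x :: B)].
Proof.
move=> hij [hi _] [hj _].
have [y e] := take_drop_split hj.
have hi' : (i < size (take j w))%N by rewrite size_takel // ltnW.
have [x e'] := take_drop_split hi'.
exists (take i (take j w)), x, (drop i.+1 (take j w)), y, (drop j.+1 w).
split.
- by rewrite [LHS]e [in LHS]e' -catA.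
- by rewrite size_takel // ltnW.
- by rewrite -e' size_takel // ltnW.
Qed.

Lemma marked_lt pi w i j : (i < j)%N -> marked pi w i -> marked pi w j ->
  ~~ ok did (take j.+1 w).
Proof.
move=> hij hi hj; have [A [x [B [y [C [ew ei ej]]]]]] := marked_pair hij hi hj; subst.
have := marked_lt_not_ok hi hj.
have -> : A ++ x :: B ++ y :: C = (A ++ x :: B ++ [:: y]) ++ C by rewrite -!catA /= -catA.
by rewrite take_size_cat // !size_cat /= size_cat addn1 !addnS.
Qed.

Lemma marked_red_uniq pi w i j : is_inv_word w -> marked pi w i -> marked pi w j -> i = j.
Proof.
move=> /is_inv_wordP; rewrite -[w in ok _ w](cat_take_drop (maxn i j).+1) ok_cat => /andP[o _].
move=> hi hj; case: (ltngtP i j) o => // h o.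
  by have := marked_lt h hi hj; rewrite o.
by have := marked_lt h hj hi; rewrite o.
Qed.

(** The two smaller marks make the prefix ending at j non-reduced, but this prefix survives the
    deletion at k. *)
Lemma marked_lt3 pi w i j k : (i < j)%N -> (j < k)%N ->
  marked pi w i -> marked pi w j -> marked pi w k -> False.
Proof.
move=> hij hjk hi hj hk; have /negP := marked_lt hij hi hj; apply.
have [_ /inv_word_forP[o _]] := hk; move: o; rewrite /delete_at ok_cat => /andP[o _].
by move: o; rewrite -(cat_take_drop j.+1 (take k w)) take_takel // ok_cat => /andP[].
Qed.

Lemma marked_uniq pi w i j k : i <> j -> i <> k ->
  marked pi w i -> marked pi w j -> marked pi w k -> j = k.
Proof.
move=> hij hik hi hj hk; apply/eqP/negPn/negP => /eqP hjk.
have L := @marked_lt3 pi w.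
case: (ltngtP i j) => h1 //; case: (ltngtP j k) => h2 //; case: (ltngtP i k) => h3 //.
all: by [apply: (L i j k)|apply: (L i k j)|apply: (L j i k)|apply: (L j k i)|apply: (L k i j)|apply: (L k j i)|lia].
Qed.

(** If x ascends after A, the cover it creates is carried through B until a letter fails, and that
    letter can be deleted instead of x. If x descends after A, it can be exchanged for a letter of
    A. *)
Lemma marked_other pi w i : marked pi w i -> ~ is_inv_word w ->
  exists2 j, j <> i & marked pi w j.
Proof.
move=> /marked_split[A [x [B [-> -> o e]]]] /is_inv_wordP/negP nw.
have [N hN] := ex_bounded (A ++ x :: B).
move: (hN); rewrite bounded_cat /= => /and3P[hA hx hB].
move: (o); rewrite ok_cat => /andP[oA oB].
have hy := inv_in_act hA (inv_in_id N).
case: (boolP (asc (act did A) x)) => ax.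
  have hc := covers_conj hx hy ax.
  have nB : ~~ ok (demconj x (act did A)) B.
    by move: nw; rewrite ok_cat oA /= ax.
  have [B1 [b [B2 [eB o1 e1]]]] := covers_ok_break hB hc oB nB.
  exists (size (A ++ x :: B1)); first by rewrite size_cat /= addnS; lia.
  rewrite eB -cat_cons catA marked_cat -catA /= ok_cat oA /= ax ok_cat o1 e1 /=.
  have eq : act did (A ++ x :: B1 ++ B2) = act did (A ++ B1 ++ b :: B2).
    by rewrite !act_cat /= act_cat e1 !act_cat.
  rewrite eq -eB e; split=> //.
  by move: oB; rewrite eB -cat1s catA ok_cat => /andP[].
have [A1 [a [A2 [eA o1 e1]]]] := ok_exchange hA hx oA ax.
exists (size A1); first by rewrite eA size_cat /=; lia.
rewrite eA -catA /= marked_cat.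
have eq : A1 ++ A2 ++ x :: B = (A1 ++ A2 ++ [:: x]) ++ B by rewrite -!catA.
by rewrite eq ok_cat o1 e1 oB act_cat e1 -act_cat.
Qed.

(** * The letters of a reduced word lie in the support of its involution *)

Lemma rk_pos (N : int) f (k p q : int) : - N <= k -> k <= p -> q < f k -> 0 < rk N f p q.
Proof.
move=> hk hp hq; have r1 (x : int) : - N - 1 <= x -> 0 <= rk N f x q.
  by move: x; apply: rng_ind => [|x hx IH]; [rewrite rk0|rewrite rkS //; lia].
have : k <= p -> 0 < rk N f p q; last by apply.
have hp' : - N - 1 <= p by lia.
move: p hp' {hp}; apply: rng_ind => [|x hx IH] hkx; first lia.
rewrite rkS //; have := r1 (x - 1) ltac:(lia).
case: (k =P x) => [e|ne]; first by rewrite -e hq; lia.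
by have := IH ltac:(lia); lia.
Qed.

Lemma act_le (N : int) p w : bounded N w -> inv_in N p -> perm_le N p (act p w).
Proof.
elim: w p => [|i w IH] p /=; first by move=> *; apply: perm_le_refl.
move=> /andP[hi hw] hp; apply: perm_le_trans (conj_le hi hp.1) (IH _ hw _).
exact: inv_in_conj.
Qed.

(** A letter i makes the rank at (i, i) positive, and later letters cannot decrease it. For i
    outside the range, the final involution would send no k <= i above i, so this rank would
    vanish. *)
Lemma ok_bounded (N : int) w : ok did w ->
  (forall x : int, (x < - N) || (N < x) -> (act did w).1 x = x) -> bounded N w.
Proof.
move=> o hfix; have [M0 hM0] := ex_bounded w.
pose M : int := `|M0| + `|N|; have hM : bounded M w by apply: bounded_le hM0; lia.
apply/allP => /= i /splitPr hi; case: hi hM o hfix => A B; rewrite /= in i A B *.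
rewrite bounded_cat act_cat ok_cat /= => /and3P[hA hi hB] /and3P[oA ai oB] hfix.
have hy := inv_in_act hA (inv_in_id M); set y := act did A in hy ai oB hfix.
have [_ nd] := conj_asc hy ai; have hy' := inv_in_conj hi hy.
set y' := demconj i y in nd hy' oB hfix.
have hlt := asc_neq hy'.1 nd.
have hz := inv_in_act hB hy'; set z := act y' B in hz hfix.
have /andP[h1 h2] := hi.
have pos : 0 < rk M y'.1 i i.
  case: (ltrP i (y'.1 i)) => hi'; first exact: rk_pos hi'.
  have hb := perm_in_bnd (x := i + 1) hy'.1 ltac:(lia).
  apply: (@rk_pos _ _ (y'.1 (i + 1))); [lia|lia|].
  have e2 : y'.2 = y'.1 by case: hy' => _ /(congr1 fst).
  by have [fK _ _] := hy'.1; rewrite -{1}e2 fK; lia.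
have {}pos : 0 < rk M z.1 i i.
  by have := @act_le M y' B hB hy' i i ltac:(lia); rewrite -/z; lia.
apply/negPn/negP => nr; have : rk M z.1 i i = 0; last by lia.
have hzN : perm_in N z by case: hz => [[zK zK' _] _]; split.
have small (k : int) : k <= i -> z.1 k <= i.
  move=> hk; move: nr; rewrite /in_rng => nr.
  case: (boolP ((k < - N) || (N < k))) => hk'; first by rewrite hfix.
  by have := perm_in_bnd hzN (x := k) ltac:(lia); lia.
have hi' : - M - 1 <= i by lia.
have : forall x : int, - M - 1 <= x -> x <= i -> rk M z.1 x i = 0; last by apply.
apply: rng_ind => [|x hx IH] hxi; first by rewrite rk0.
by rewrite rkS // IH; have := small x hxi; lia.
Qed.

Lemma marked_bounded (N : int) pi w i : (forall x : int, (x < - N) || (N < x) -> pi x = x) ->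
  marked pi w i -> bounded N (delete_at w i).
Proof. by move=> h [_ /inv_word_forP[o e]]; apply: ok_bounded => //; rewrite e. Qed.

(** * Coxeter--Knuth equivalences of involution words *)

Lemma inv_word_for_eq v w pi : size v = size w -> act did v = act did w ->
  inv_word_for v pi <-> inv_word_for w pi.
Proof.
by move=> es e; rewrite /inv_word_for /inv_of_word -/(act did v) -/(act did w) es e.
Qed.

Lemma is_inv_word_eq v w : size v = size w -> act did v = act did w ->
  is_inv_word v <-> is_inv_word w.
Proof.
by move=> es e; rewrite /is_inv_word /inv_word_for /inv_of_word -/(act did v) -/(act did w) es e.
Qed.

Lemma act_far u (a b : int) v : (a + 1 < b) || (b + 1 < a) ->
  act did (u ++ a :: b :: v) = act did (u ++ b :: a :: v).
Proof.
move=> h; have [N] := ex_bounded (u ++ a :: b :: v).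
rewrite bounded_cat /= => /and4P[hu ha hb _]; rewrite !act_cat /=.
by rewrite (conj_far ha hb (inv_in_act hu (inv_in_id N)).1 h).
Qed.

Lemma act_braid u (a : int) v :
  act did (u ++ a :: a + 1 :: a :: v) = act did (u ++ a + 1 :: a :: a + 1 :: v).
Proof.
have [N] := ex_bounded (u ++ a :: a + 1 :: a :: v).
rewrite bounded_cat /= => /and4P[hu ha hb _]; rewrite !act_cat /=.
by rewrite (conj_braid ha hb (inv_in_act hu (inv_in_id N)).1).
Qed.

Lemma act_swap (a b : int) v : act did (a :: b :: v) = act did (b :: a :: v).
Proof. by rewrite /= conj_id. Qed.

Lemma inv_word_xx u (a : int) v : ~ is_inv_word (u ++ a :: a :: v).
Proof.
move/is_inv_wordP; have [N] := ex_bounded (u ++ a :: a :: v).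
rewrite bounded_cat ok_cat /= => /and4P[hu ha _ _] /and4P[_ a1 a2 _].
by have [_ /negP] := conj_asc (inv_in_act hu (inv_in_id N)) a1; apply.
Qed.

Lemma inv_word_xyx u (a b : int) v : is_inv_word (u ++ a :: b :: a :: v) ->
  b = a + 1 \/ a = b + 1.
Proof.
move=> h; have [e|h1] := eqVneq a b; first by rewrite e in h; case: (inv_word_xx h).
have [h2|h2] := boolP ((a + 1 < b) || (b + 1 < a)); last by lia.
case: (@inv_word_xx u a (b :: v)).
refine ((is_inv_word_eq _ _).1 h); first by rewrite !size_cat.
by have := @act_far (u ++ [:: a]) b a v; rewrite -!catA /=; apply; rewrite orbC.
Qed.

(** * Dynamics of involution Little bumps *)

Lemma incr_at_cat A x B : incr_at (A ++ x :: B) (size A) = A ++ (x + 1) :: B.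
Proof.
rewrite /incr_at nth_cat ltnn subnn /=.
by elim: A => //= a A ->.
Qed.

Lemma split_at (w : seq int) i : (i < size w)%N -> exists A x B, w = A ++ x :: B /\ i = size A.
Proof.
move=> h; have [x e] := take_drop_split h.
by exists (take i w), x, (drop i.+1 w); rewrite -e size_takel // ltnW.
Qed.

Lemma marked_incr pi w j : marked pi w j -> marked pi (incr_at w j) j.
Proof. by move=> /marked_split[A [x [B [-> -> o e]]]]; rewrite incr_at_cat marked_cat. Qed.

Lemma size_incr w j : (j < size w)%N -> size (incr_at w j) = size w.
Proof. by rewrite /incr_at size_set_nth => /maxn_idPr. Qed.

Lemma ipush_red pi w i : is_inv_word w -> ipush pi (w, i) = (incr_at w i, i).
Proof. by rewrite /ipush; destruct (excluded_middle_informative (is_inv_word w)). Qed.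

Lemma ipush_nonred pi w i j : marked pi w i -> ~ is_inv_word w -> marked pi w j -> j <> i ->
  ipush pi (w, i) = (incr_at w j, j).
Proof.
move=> hi nr hj nij; rewrite /ipush; destruct (excluded_middle_informative (is_inv_word w)) => //.
set P := fun j => _; have [h1 h2] : P (epsilon (inhabits 0%N) P).
  by apply: epsilon_spec; exists j.
by rewrite (marked_uniq (nesym h1) (nesym nij) hi h2 hj).
Qed.

Lemma ipush_spec pi w i : marked pi w i -> exists j,
  [/\ ipush pi (w, i) = (incr_at w j, j), marked pi w j &
      is_inv_word w /\ j = i \/ ~ is_inv_word w /\ j <> i].
Proof.
move=> hi; have [r|nr] := excluded_middle_informative (is_inv_word w).
  by exists i; rewrite ipush_red //; split=> //; left.
have [j nij hj] := marked_other hi nr.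
by exists j; split=> //; [apply: ipush_nonred|right].
Qed.

Lemma ipush_marked pi w i : marked pi w i -> marked pi (ipush pi (w, i)).1 (ipush pi (w, i)).2.
Proof. by move=> hi; have [j [-> hj _]] := ipush_spec hi; apply: marked_incr. Qed.

(** At least one push, with no reduced word strictly between the ends; the end itself may or may not
    be reduced. *)
Inductive trace (pi : int -> int) : seq int * nat -> seq int * nat -> Prop :=
| trace_one m : trace pi m (ipush pi m)
| trace_step m m' : ~ is_inv_word (ipush pi m).1 -> trace pi (ipush pi m) m' -> trace pi m m'.

Lemma trace_marked pi m m' : trace pi m m' -> marked pi m.1 m.2 -> marked pi m'.1 m'.2.
Proof.
elim=> [[w i]|[w i] m'' _ _ IH] /= h; first exact: ipush_marked.
exact/IH/ipush_marked.
Qed.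

Lemma trace_trans pi m m' m'' : trace pi m m' -> ~ is_inv_word m'.1 ->
  trace pi m' m'' -> trace pi m m''.
Proof.
elim=> {m m'} [m|m m' nr _ IH] nr' t; first exact: trace_step.
by apply: trace_step => //; apply: IH.
Qed.

Lemma trace_iter pi m m' : trace pi m m' -> exists N,
  [/\ (0 < N)%N, iter N (ipush pi) m = m' &
      forall M, (0 < M < N)%N -> ~ is_inv_word (iter M (ipush pi) m).1].
Proof.
elim=> {m m'} [m|m m' nr _ [N [hN e h]]].
  by exists 1%N; split=> // M; lia.
exists N.+1; split=> // [|M]; first by rewrite iterSr.
case: M => // [[|M]] // hM; rewrite iterSr; apply: h; lia.
Qed.

(** Resolves the choices in [ib]: the mark is unique because w is reduced, and the number of pushes
    is unique by minimality. *)
Lemma ib_trace pi w i m : is_inv_word w -> marked pi w i -> trace pi (w, i) m ->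
  is_inv_word m.1 -> ib pi w = m.1.
Proof.
move=> r hi t rm; rewrite /ib; case: excluded_middle_informative; last by case; exists i.
move=> ex /=; set i0 := epsilon _ (marked pi w).
have -> : i0 = i by exact: (marked_red_uniq r (epsilon_spec (inhabits 0%N) (marked pi w) ex) hi).
have [N [hN e h]] := trace_iter t.
set P := fun N => _; have [h1 h2 h3] : P (epsilon (inhabits 0%N) P).
  by apply: epsilon_spec; exists N; split=> //; rewrite e.
set N0 := epsilon _ _ in h1 h2 h3 *.
have -> : N0 = N; last by rewrite e.
case: (ltngtP N0 N) => // hlt.
- by case: (h N0) => //; rewrite h1.
- by case: (h3 N); rewrite ?hN ?e.
Qed.

Lemma ib_unmarked pi w : (forall i, ~ marked pi w i) -> ib pi w = w.
Proof. by move=> h; rewrite /ib; case: excluded_middle_informative => // -[i /h]. Qed.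

(** The letter removed by one deletion survives the other, so the bounds for the two reduced words
    cover all of w. *)
Lemma marked2_bounded (N : int) pi w i j : (forall x : int, (x < - N) || (N < x) -> pi x = x) ->
  marked pi w i -> marked pi w j -> i <> j -> bounded N w.
Proof.
move=> hpi; wlog hij : i j / (i < j)%N => [hw hi hj nij|hi hj _].
  by case: (ltngtP i j) => // h; [apply: (hw i j)|apply: (hw j i) => //; lia].
have b1 := marked_bounded hpi hi; have b2 := marked_bounded hpi hj.
have [A [x [B [y [C [ew ei ej]]]]]] := marked_pair hij hi hj; subst.
rewrite -cat_cons catA delete_at_cat in b2; rewrite delete_at_cat in b1; move: b1 b2.
rewrite !bounded_cat /= bounded_cat /= => /and4P[a b c d] /andP[/and3P[_ x_ _] _].
by rewrite a b c d x_.
Qed.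

Definition wsum (f : int -> int) (w : seq int) : int := foldr (fun x s => f x + s) 0 w.

Lemma wsum_split f A (x : int) B : wsum f (A ++ x :: B) = wsum f A + f x + wsum f B.
Proof. by elim: A => [|a A /= ->]; rewrite /= ?add0r ?addrA. Qed.

Lemma wsum_pos (N : int) f w : (forall x, in_rng N x -> 0 <= f x) -> bounded N w ->
  0 <= wsum f w.
Proof.
move=> hf; elim: w => //= x w IH /andP[/hf h1 /IH h2]; exact: addr_ge0.
Qed.

(** Every push lowers the sum of N - x over the letters x by one. A marked word that is not reduced
    has two marks, so this sum is nonnegative on it. *)
Lemma trace_up (N : int) pi m : (forall x : int, (x < - N) || (N < x) -> pi x = x) ->
  marked pi m.1 m.2 -> exists m', [/\ trace pi m m', is_inv_word m'.1 & marked pi m'.1 m'.2].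
Proof.
move=> hpi; pose f (x : int) : int := N - x.
have nonneg w i j : marked pi w i -> marked pi w j -> j <> i -> 0 <= wsum f w.
  move=> hi hj ne; apply: (@wsum_pos N); last exact: marked2_bounded hpi hi hj (nesym ne).
  by move=> x; rewrite /f /in_rng; lia.
have push k m0 : wsum f m0.1 < k%:Z -> marked pi m0.1 m0.2 ->
    exists m', [/\ trace pi m0 m', is_inv_word m'.1 & marked pi m'.1 m'.2].
{ elim: k m0 => [|k IH] [w i] /= hs hm; have [j [e hj hr]] := ipush_spec hm.
  all: have hm' := marked_incr hj.
  all: have [r|nr] := excluded_middle_informative (is_inv_word (incr_at w j)).
  1,3: by exists (incr_at w j, j); split=> //; rewrite -e; apply: trace_one.
  all: have hs' : wsum f (incr_at w j) = wsum f w - 1.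
  1,3: have [A [x [B [ew ej]]]] := split_at hj.1; subst w j;
       by rewrite incr_at_cat !wsum_split /f; lia.
    have [l nl hl] := marked_other hm' nr.
    by have := nonneg _ _ _ hm' hl nl; lia.
  have [|m' [t r' h']] := IH (incr_at w j, j) _ hm'; first by rewrite /=; lia.
  by exists m'; split=> //; apply: trace_step; rewrite e. }
by move=> hm; apply: (push (absz (wsum f m.1)).+1) => //; lia.
Qed.

Definition decr_at (w : seq int) (j : nat) : seq int := set_nth 0 w j (nth 0 w j - 1).

Lemma decr_at_cat A x B : decr_at (A ++ x :: B) (size A) = A ++ (x - 1) :: B.
Proof.
rewrite /decr_at nth_cat ltnn subnn /=.
by elim: A => //= a A ->.
Qed.

Lemma decrK w j : (j < size w)%N -> incr_at (decr_at w j) j = w.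
Proof.
by move=> /split_at[A [x [B [-> ->]]]]; rewrite decr_at_cat incr_at_cat subrK.
Qed.

Lemma marked_decr pi w j : marked pi w j -> marked pi (decr_at w j) j.
Proof. by move=> /marked_split[A [x [B [-> -> o e]]]]; rewrite decr_at_cat marked_cat. Qed.

(** The mark of a pushed word sits on the incremented letter. Decrementing it recovers the earlier
    word, whose mark is the same one or the other one according to reducedness. *)
Lemma ipush_pred pi w j : marked pi w j -> exists i,
  marked pi (decr_at w j) i /\ ipush pi (decr_at w j, i) = (w, j).
Proof.
move=> hj; have hd := marked_decr hj.
have [r|nr] := excluded_middle_informative (is_inv_word (decr_at w j)).
  by exists j; rewrite ipush_red // decrK // hj.1.
have [i nij hi] := marked_other hd nr.
exists i; split=> //; rewrite (ipush_nonred hi nr hd) ?decrK //; first exact: hj.1.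
exact: nesym.
Qed.

Lemma trace_rcons pi m m' : trace pi m m' -> ~ is_inv_word m'.1 -> trace pi m (ipush pi m').
Proof. by move=> t nr; apply: trace_trans t nr _; apply: trace_one. Qed.

Lemma trace_down (N : int) pi m : (forall x : int, (x < - N) || (N < x) -> pi x = x) ->
  marked pi m.1 m.2 -> exists m', [/\ trace pi m' m, is_inv_word m'.1 & marked pi m'.1 m'.2].
Proof.
move=> hpi; pose f (x : int) : int := x + N.
have nonneg w i j : marked pi w i -> marked pi w j -> j <> i -> 0 <= wsum f w.
  move=> hi hj ne; apply: (@wsum_pos N); last exact: marked2_bounded hpi hi hj (nesym ne).
  by move=> x; rewrite /f /in_rng; lia.
have pull k m0 : wsum f m0.1 < k%:Z -> marked pi m0.1 m0.2 ->
    exists m', [/\ trace pi m' m0, is_inv_word m'.1 & marked pi m'.1 m'.2].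
{ elim: k m0 => [|k IH] [w j] /= hs hm; have [i [hi ei]] := ipush_pred hm.
  all: have [r|nr] := excluded_middle_informative (is_inv_word (decr_at w j)).
  1,3: by exists (decr_at w j, i); split=> //; rewrite -ei; apply: trace_one.
  all: have hs' : wsum f (decr_at w j) = wsum f w - 1.
  1,3: have [A [x [B [ew ej]]]] := split_at hm.1; subst w j;
       by rewrite decr_at_cat !wsum_split /f; lia.
    have [l nl hl] := marked_other hi nr.
    by have := nonneg _ _ _ hi hl nl; lia.
  have [|m' [t r' h']] := IH (decr_at w j, i) _ hi; first by rewrite /=; lia.
  by exists m'; split=> //; rewrite -ei; apply: trace_rcons. }
by move=> hm; apply: (pull (absz (wsum f m.1)).+1) => //; lia.
Qed.

Lemma ipush_inj pi w i w' i' : marked pi w i -> marked pi w' i' ->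
  ipush pi (w, i) = ipush pi (w', i') -> (w, i) = (w', i').
Proof.
move=> hi hi'; have [j [-> hj hr]] := ipush_spec hi; have [j' [-> hj' hr']] := ipush_spec hi'.
case=> e ej; subst j'.
have ew : w = w'.
  have [A [x [B [ew ej]]]] := split_at hj.1; subst w j.
  have [A' [x' [B' [ew ej]]]] := split_at hj'.1; subst w'.
  move: e; rewrite ej incr_at_cat -ej incr_at_cat => /eqP.
  by rewrite eqseq_cat // eqseq_cons => /and3P[/eqP-> /eqP/addIr-> /eqP->].
subst w'; congr (_, _).
case: hr hr' => [[r <-]|[nr ne]] [[r' <-]|[nr' ne']] //.
exact: (marked_uniq ne ne' hj hi hi').
Qed.

Lemma iter_marked pi n m : marked pi m.1 m.2 ->
  marked pi (iter n (ipush pi) m).1 (iter n (ipush pi) m).2.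
Proof.
by move=> h; elim: n => //= n; case: (iter n _ m) => w i; apply: ipush_marked.
Qed.

Lemma iter_ipush_inj pi n m m' : marked pi m.1 m.2 -> marked pi m'.1 m'.2 ->
  iter n (ipush pi) m = iter n (ipush pi) m' -> m = m'.
Proof.
move=> h h'; elim: n => //= n IH e; apply: IH.
have := iter_marked n h; have := iter_marked n h'; move: e.
case: (iter n _ m) => w i; case: (iter n _ m') => w' i' /= e h1 h2.
exact: ipush_inj h2 h1 e.
Qed.

(** Undoing the common pushes, the longer run would pass through the reduced starting word of the
    shorter one. *)
Lemma trace_inj pi m m' r : marked pi m.1 m.2 -> marked pi m'.1 m'.2 ->
  is_inv_word m.1 -> is_inv_word m'.1 -> trace pi m r -> trace pi m' r -> m = m'.
Proof.
move=> hm hm' rm rm' /trace_iter[n [n0 e h]] /trace_iter[n' [n0' e' h']].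
wlog hle : m m' n n' hm hm' rm rm' n0 n0' e e' h h' / (n <= n')%N.
  move=> hw; case: (leqP n n') => hn; first exact: (hw m m' n n').
  by apply/esym/(hw m' m n' n) => //; apply: ltnW.
move: e'; rewrite -(subnKC hle) iterD -e => /esym e'.
have em := iter_ipush_inj hm (iter_marked (n' - n) hm') e'.
case: (posnP (n' - n)) => h0; first by rewrite em h0.
by case: (h' (n' - n)%N); [lia|rewrite -em].
Qed.

Lemma ib_markedP (N : int) pi w i : (forall x : int, (x < - N) || (N < x) -> pi x = x) ->
  is_inv_word w -> marked pi w i -> exists j,
  [/\ trace pi (w, i) (ib pi w, j), is_inv_word (ib pi w) & marked pi (ib pi w) j].
Proof.
move=> hpi r hi; have [[v j] [t r' h']] := trace_up (m := (w, i)) hpi hi.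
by exists j; rewrite (ib_trace r hi t).
Qed.

Lemma ib_red (N : int) pi w : (forall x : int, (x < - N) || (N < x) -> pi x = x) ->
  is_inv_word w -> is_inv_word (ib pi w).
Proof.
move=> hpi r; have [[i hi]|nm] := excluded_middle_informative (exists i, marked pi w i).
  by have [j []] := ib_markedP hpi r hi.
by rewrite ib_unmarked // => i hi; apply: nm; exists i.
Qed.

(** Marked reduced words have marked images and unmarked ones are fixed, so the two kinds cannot
    share an image. *)
Lemma ib_inj (N : int) pi w w' : (forall x : int, (x < - N) || (N < x) -> pi x = x) ->
  is_inv_word w -> is_inv_word w' -> ib pi w = ib pi w' -> w = w'.
Proof.
move=> hpi; wlog [i hi] : w w' / exists i, marked pi w i.
  move=> hw r r' e; have [m|nm] := excluded_middle_informative (exists i, marked pi w i).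
    exact: hw.
  have [m'|nm'] := excluded_middle_informative (exists i, marked pi w' i).
    exact/esym/hw.
  move: e; rewrite !ib_unmarked // => i hi; [apply: nm'|apply: nm]; by exists i.
move=> r r' e; have [j [t rb mb]] := ib_markedP hpi r hi.
have [[i' hi']|nm'] := excluded_middle_informative (exists i, marked pi w' i).
  have [j' [t' rb' mb']] := ib_markedP hpi r' hi'.
  rewrite -e in t' rb' mb'; rewrite (marked_red_uniq rb mb' mb) in t'.
  by case: (trace_inj (m := (w, i)) (m' := (w', i')) hi hi' r r' t t').
by exfalso; apply: (nm'); exists j; move: mb; rewrite e ib_unmarked // => k hk; apply: nm'; exists k.
Qed.

Lemma ib_surj (N : int) pi w : (forall x : int, (x < - N) || (N < x) -> pi x = x) ->
  is_inv_word w -> exists2 w', is_inv_word w' & ib pi w' = w.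
Proof.
move=> hpi r; have [[i hi]|nm] := excluded_middle_informative (exists i, marked pi w i).
  have [[w' i'] [t r' hi']] := trace_down (m := (w, i)) hpi hi.
  by exists w' => //; rewrite (ib_trace r' hi' t).
by exists w; rewrite // ib_unmarked // => i hi; apply: nm; exists i.
Qed.

(** * Descents *)

Lemma red_nth_neq w k : is_inv_word w -> (k.+1 < size w)%N -> nth 0 w k <> nth 0 w k.+1.
Proof.
move=> r hk e; have [x ew] := take_drop_split hk.
have hk' : (k < size (take k.+1 w))%N by rewrite size_takel // ltnW.
have [y ew'] := take_drop_split hk'.
rewrite (drop_oversize (n := k.+1)) ?size_takel // in ew'; last exact: ltnW.
rewrite take_takel // in ew'.
have sk : size (take k w) = k by rewrite size_takel //; lia.
move: e r; rewrite ew ew' -catA /=.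
rewrite !nth_cat sk ltnn subnn ltnNge leqnSn /= subSnn /= => ->.
exact: inv_word_xx.
Qed.

Lemma nth_incr w j k : (j < size w)%N ->
  nth 0 (incr_at w j) k = nth 0 w k + (k == j)%:Z.
Proof.
by move=> _; rewrite /incr_at nth_set_nth /=; case: eqP => [->|]; rewrite ?addr0.
Qed.

(* During a bump two adjacent letters can only collide when the left (ascent) or right
   (descent) one has just been incremented; the mark then moves to the other one, which
   restores the order. *)
Definition near_descents (w : seq int) (m : seq int * nat) : Prop :=
  size m.1 = size w /\ forall k, (k.+1 < size w)%N ->
    if nth 0 w k < nth 0 w k.+1
    then nth 0 m.1 k < nth 0 m.1 k.+1 \/ nth 0 m.1 k = nth 0 m.1 k.+1 /\ m.2 = k
    else nth 0 m.1 k.+1 < nth 0 m.1 k \/ nth 0 m.1 k = nth 0 m.1 k.+1 /\ m.2 = k.+1.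

Lemma delete_at_eq w k : (k.+1 < size w)%N -> nth 0 w k = nth 0 w k.+1 ->
  delete_at w k = delete_at w k.+1.
Proof.
move=> hk e; rewrite /delete_at (take_nth 0) ?(drop_nth 0 hk) ?e; last exact: ltnW.
by rewrite cat_rcons.
Qed.

Lemma near_descents_step pi w v i : marked pi v i -> near_descents w (v, i) ->
  near_descents w (ipush pi (v, i)).
Proof.
move=> hi; have [j [-> hj hr]] := ipush_spec hi; move=> [/= sv h].
have hjs := hj.1; split=> /= [|k hk]; first by rewrite size_incr.
(* Deleting either of two equal neighbours gives the same word, so both positions are marks and the
   push goes to the one not held. *)
have collide k' : nth 0 v k = nth 0 v k.+1 -> i = k \/ i = k.+1 ->
    k' = k \/ k' = k.+1 -> k' <> i -> j = k'.
  move=> e hik hk' ne; have hk1 : (k.+1 < size v)%N by rewrite sv.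
  have mk' : marked pi v k'.
    have ed := delete_at_eq hk1 e.
    have hd : delete_at v k' = delete_at v i.
      by case: hik hk' => -> [] -> //.
    split; last by rewrite hd; case: hi.
    by case: hk' => ->; lia.
  case: hr => [[r _]|[_ ne']]; first by case: (red_nth_neq r hk1).
  exact: (marked_uniq (nesym ne') (nesym ne) hi hj mk').
have := h k hk; rewrite !nth_incr //; clear h hr sv hi hj hjs.
move: collide; move: (nth 0 v k) (nth 0 v k.+1) => x y collide; case: ifP => _ [hlt|[e ei]].
- by case: (k =P j); case: (k.+1 =P j); lia.
- by have := collide k.+1 e ltac:(lia) ltac:(lia) ltac:(lia); case: (k =P j); case: (k.+1 =P j); lia.
- by case: (k =P j); case: (k.+1 =P j); lia.
- by have := collide k e ltac:(lia) ltac:(lia) ltac:(lia); case: (k =P j); case: (k.+1 =P j); lia.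
Qed.

Lemma near_descents_trace pi w m m' : trace pi m m' -> marked pi m.1 m.2 ->
  near_descents w m -> near_descents w m'.
Proof.
elim=> {m m'} [[v i]|[v i] m' _ _ IH] /= hm hd; first exact: near_descents_step.
by apply: IH; [apply: ipush_marked|apply: near_descents_step].
Qed.

Lemma ib_descents (N : int) pi w : (forall x : int, (x < - N) || (N < x) -> pi x = x) ->
  is_inv_word w -> size (ib pi w) = size w /\
  forall k, (k.+1 < size w)%N ->
    (nth 0 (ib pi w) k < nth 0 (ib pi w) k.+1) = (nth 0 w k < nth 0 w k.+1).
Proof.
move=> hpi r; have [[i hi]|nm] := excluded_middle_informative (exists i, marked pi w i); last first.
  by rewrite ib_unmarked // => i hi; apply: nm; exists i.
have [j [t rb mb]] := ib_markedP hpi r hi.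
have hd0 : near_descents w (w, i).
  split=> //= k hk; move: (red_nth_neq r hk).
  by move: (nth 0 w k) (nth 0 w k.+1) => x y ne; case: ltrP => ?; left; lia.
have [/= sv h] := near_descents_trace t hi hd0; split=> // k hk.
have ne : nth 0 (ib pi w) k <> nth 0 (ib pi w) k.+1 by apply: red_nth_neq; rewrite ?sv.
move: (h k hk) ne; move: (nth 0 w k) (nth 0 w k.+1) => x y.
by move: (nth 0 _ k) (nth 0 _ k.+1) => x' y'; case: ifP; lia.
Qed.

Lemma inv_word_for_tr v w pi : inv_word_for v pi -> size v = size w -> act did v = act did w ->
  inv_word_for w pi.
Proof. by move=> h es e; apply: (inv_word_for_eq pi es e).1. Qed.

(** * Bumps commute with Coxeter--Knuth moves *)

(* [ckt sw t t' tau]: the blocks [t] and [t'] differ by a Coxeter--Knuth move ([sw = false]),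
   or by exchanging two letters, which is allowed at the start of a word only ([sw = true]);
   [tau] pairs the positions of [t] and [t'] whose deletion gives equivalent blocks. *)
Inductive ckt (sw : bool) : seq int -> seq int -> seq (nat * nat) -> Prop :=
| ckt_bac (a b c : int) of a < b & b < c & ~~ sw :
    ckt sw [:: b; a; c] [:: b; c; a] [:: (0, 0); (1, 2); (2, 1)]%N
| ckt_acb (a b c : int) of a < b & b < c & ~~ sw :
    ckt sw [:: a; c; b] [:: c; a; b] [:: (0, 1); (1, 0); (2, 2)]%N
| ckt_aba (a : int) of ~~ sw :
    ckt sw [:: a; a + 1; a] [:: a + 1; a; a + 1] [:: (0, 2); (2, 0)]%N
| ckt_swap (a b : int) of a != b & sw : ckt sw [:: a; b] [:: b; a] [:: (0, 1); (1, 0)]%N.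

Lemma ckt_size sw t t' tau : ckt sw t t' tau -> size t = size t'.
Proof. by case. Qed.

Lemma ckt_act sw t t' tau u v : ckt sw t t' tau -> (sw -> u = [::]) ->
  act did (u ++ t ++ v) = act did (u ++ t' ++ v).
Proof.
case=> [a b c ab bc _ _|a b c ab bc _ _|a _ _|a b _ -> /(_ isT)->].
- by have := @act_far (u ++ [:: b]) a c v; rewrite -!catA /=; apply; lia.
- by apply: act_far; lia.
- exact: act_braid.
- exact: act_swap.
Qed.

Lemma ckt_del sw t t' tau u v p p' : ckt sw t t' tau -> (p, p') \in tau ->
  [/\ (p < size t)%N, (p' < size t')%N &
   act did (u ++ delete_at t p ++ v) = act did (u ++ delete_at t' p' ++ v)].
Proof.
case=> [a b c ab bc _|a b c ab bc _|a _|a b _ _]; rewrite !inE -?orbA.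
- by case/or3P => /eqP[-> ->]; split=> //=; apply: act_far; lia.
- by case/or3P => /eqP[-> ->]; split=> //=; apply: act_far; lia.
- by case/orP => /eqP[-> ->].
- by case/orP => /eqP[-> ->].
Qed.

(** The only unmatched position is the middle of a braid block; deleting it leaves two equal
    neighbours. *)
Lemma ckt_dom sw t t' tau u v p : ckt sw t t' tau -> (p < size t)%N ->
  (exists p', (p, p') \in tau) \/ ~ is_inv_word (u ++ delete_at t p ++ v).
Proof.
case=> [a b c ab bc _|a b c ab bc _|a _|a b _ _]; case: p => [|[|[|p]]] //= _;
  try (by left; first [exists 0%N; rewrite !inE; done
    | exists 1%N; rewrite !inE; done| exists 2%N; rewrite !inE; done]).
by right; apply: inv_word_xx.
Qed.

Lemma ckt_codom sw t t' tau u v p' : ckt sw t t' tau -> (p' < size t')%N ->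
  (exists p, (p, p') \in tau) \/ ~ is_inv_word (u ++ delete_at t' p' ++ v).
Proof.
case=> [a b c ab bc _|a b c ab bc _|a _|a b _ _]; case: p' => [|[|[|p]]] //= _;
  try (by left; first [exists 0%N; rewrite !inE; done
    | exists 1%N; rewrite !inE; done| exists 2%N; rewrite !inE; done]).
by right; apply: inv_word_xx.
Qed.

Lemma ckt_inj sw t t' tau p p' q q' : ckt sw t t' tau ->
  (p, p') \in tau -> (q, q') \in tau -> (p == q) = (p' == q').
Proof.
case=> [a b c ab bc _|a b c ab bc _|a _|a b _ _]; rewrite !inE -?orbA.
- by case/or3P => /eqP[-> ->]; case/or3P => /eqP[-> ->].
- by case/or3P => /eqP[-> ->]; case/or3P => /eqP[-> ->].
- by case/orP => /eqP[-> ->]; case/orP => /eqP[-> ->].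
- by case/orP => /eqP[-> ->]; case/orP => /eqP[-> ->].
Qed.

(** Here k and l are the start and the length of the block; marks outside it stay in place. *)
Definition mrel (k l : nat) (tau : seq (nat * nat)) (i i' : nat) : Prop :=
  i = i' /\ ((i < k) || (k + l <= i))%N \/
  exists p p', [/\ (p, p') \in tau, i = (k + p)%N & i' = (k + p')%N].

(** [Some k] is a Coxeter--Knuth move at position k, [None] the exchange of the first two letters.
    As [ckt] is oriented this is one half of the symmetric relation [sync]. *)
Definition hsync (o : option nat) (m m' : seq int * nat) : Prop :=
  exists u t t' v tau, [/\ m.1 = u ++ t ++ v, m'.1 = u ++ t' ++ v, size u = odflt 0%N o,
    ckt (o == None) t t' tau & mrel (size u) (size t) tau m.2 m'.2].

Definition sync o m m' := hsync o m m' \/ hsync o m' m.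

Definition ck (o : option nat) (w w' : seq int) : Prop :=
  exists u t t' v tau, [/\ w = u ++ t ++ v, w' = u ++ t' ++ v, size u = odflt 0%N o &
    ckt (o == None) t t' tau \/ ckt (o == None) t' t tau].

Lemma swap_nil o (u : seq int) : size u = odflt 0%N o -> o == None -> u = [::].
Proof. by move=> h /eqP e; rewrite e in h; apply: size0nil. Qed.

Lemma delete_at_block (u t v : seq int) p : (p < size t)%N ->
  delete_at (u ++ t ++ v) (size u + p) = u ++ delete_at t p ++ v.
Proof.
move=> /split_at[A [x [B [-> ->]]]]; rewrite delete_at_cat -catA -size_cat.
by rewrite -catA /= [u ++ _]catA delete_at_cat -!catA.
Qed.

Lemma incr_at_block (u t v : seq int) p : (p < size t)%N ->
  incr_at (u ++ t ++ v) (size u + p) = u ++ incr_at t p ++ v.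
Proof.
move=> /split_at[A [x [B [-> ->]]]]; rewrite incr_at_cat -!catA -size_cat /=.
by rewrite [u ++ _]catA incr_at_cat -!catA.
Qed.

Lemma marked_block pi u t t' v p p' : size t = size t' -> (p < size t)%N -> (p' < size t')%N ->
  act did (u ++ delete_at t p ++ v) = act did (u ++ delete_at t' p' ++ v) ->
  marked pi (u ++ t ++ v) (size u + p) -> marked pi (u ++ t' ++ v) (size u + p').
Proof.
move=> es hp hp' e [h1]; rewrite delete_at_block // => h2; split.
  by rewrite !size_cat; lia.
rewrite delete_at_block //; apply: (inv_word_for_tr h2) => //.
by rewrite /delete_at !size_cat !size_takel 1?ltnW // !size_drop; lia.
Qed.

(** A deletion outside the block changes the context, so the equality of actions is required in
    other contexts as well; the side condition keeps an exchange at the start of the word. *)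
Lemma marked_outside pi u t t' v i : size t = size t' ->
  ((i < size u) || (size u + size t <= i))%N ->
  (forall u' v', (u = [::] -> u' = [::]) -> act did (u' ++ t ++ v') = act did (u' ++ t' ++ v')) ->
  marked pi (u ++ t ++ v) i -> marked pi (u ++ t' ++ v) i.
Proof.
move=> es hi he [h1 h2]; split; first by move: h1; rewrite !size_cat; lia.
case/orP: hi => hi.
  have [A [x [B [eu ei]]]] := split_at hi; subst u i.
  move: h2; rewrite -!catA /= !delete_at_cat => h2.
  apply: (inv_word_for_tr h2); first by rewrite !size_cat es.
  by rewrite !catA -!(catA (A ++ B)) he //; case: (A).
have hv : (i - (size u + size t) < size v)%N by move: h1; rewrite !size_cat; lia.
have [A [x [B [ev ei]]]] := split_at hv; subst v.
have e1 : i = size (u ++ t ++ A) by rewrite !size_cat -ei; lia.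
have e2 : i = size (u ++ t' ++ A) by rewrite e1 !size_cat es.
move: h2; rewrite {1}e1 e2.
have -> : u ++ t ++ A ++ x :: B = (u ++ t ++ A) ++ x :: B by rewrite -!catA.
have -> : u ++ t' ++ A ++ x :: B = (u ++ t' ++ A) ++ x :: B by rewrite -!catA.
rewrite !delete_at_cat => h2; apply: (inv_word_for_tr h2); first by rewrite !size_cat es.
by rewrite -!catA he.
Qed.

Lemma mrel_inj sw t t' tau k i i' j j' : ckt sw t t' tau ->
  mrel k (size t) tau i i' -> mrel k (size t) tau j j' -> i = j <-> i' = j'.
Proof.
move=> ht.
have bnd p p' : (p, p') \in tau -> (p < size t)%N /\ (p' < size t)%N.
  by move=> hp; have [h1] := ckt_del [::] [::] ht hp; rewrite -(ckt_size ht).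
case=> [[-> hi]|[p [p' [hp -> ->]]]]; case=> [[-> hj]|[q [q' [hq -> ->]]]] //.
- by have := bnd _ _ hq; lia.
- by have := bnd _ _ hp; lia.
- by have := ckt_inj ht hp hq; lia.
Qed.

Lemma marked_fwd pi sw u t t' v tau i : ckt sw t t' tau -> (sw -> u = [::]) ->
  marked pi (u ++ t ++ v) i ->
  exists2 i', mrel (size u) (size t) tau i i' & marked pi (u ++ t' ++ v) i'.
Proof.
move=> ht hu hi; case: (boolP ((i < size u) || (size u + size t <= i))%N) => hout.
  exists i; first by left.
  apply: (marked_outside (ckt_size ht) hout _ hi) => u' v' hu'.
  by apply: ckt_act ht _ => /hu.
have hp : (i - size u < size t)%N by lia.
have ei : i = (size u + (i - size u))%N by lia.
rewrite ei in hi; case: (ckt_dom u v ht hp) => [[p' hpp]|nr].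
  have [h1 h2 e] := ckt_del u v ht hpp.
  exists (size u + p')%N; first by right; exists (i - size u)%N, p'.
  exact: (marked_block (ckt_size ht) h1 h2 e hi).
case: nr; case: hi => _; rewrite delete_at_block // => /inv_word_forP[o _].
exact/is_inv_wordP.
Qed.

Lemma marked_bwd pi sw u t t' v tau i' : ckt sw t t' tau -> (sw -> u = [::]) ->
  marked pi (u ++ t' ++ v) i' ->
  exists2 i, mrel (size u) (size t) tau i i' & marked pi (u ++ t ++ v) i.
Proof.
move=> ht hu hi; have es := ckt_size ht.
case: (boolP ((i' < size u) || (size u + size t <= i'))%N) => hout.
  exists i'; first by left.
  rewrite es in hout; apply: (marked_outside (esym es) hout _ hi) => u' v' hu'.
  by apply: esym; apply: ckt_act ht _ => /hu.
have hp : (i' - size u < size t')%N by lia.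
have ei : i' = (size u + (i' - size u))%N by lia.
rewrite ei in hi; case: (ckt_codom u v ht hp) => [[p hpp]|nr].
  have [h1 h2 e] := ckt_del u v ht hpp.
  exists (size u + p)%N; first by right; exists p, (i' - size u)%N.
  exact: (marked_block (esym es) h2 h1 (esym e) hi).
case: nr; case: hi => _; rewrite delete_at_block // => /inv_word_forP[o _].
exact/is_inv_wordP.
Qed.

Lemma ckt_red sw u t t' v tau : ckt sw t t' tau -> (sw -> u = [::]) ->
  is_inv_word (u ++ t ++ v) <-> is_inv_word (u ++ t' ++ v).
Proof.
move=> ht hu; apply: is_inv_word_eq; first by rewrite !size_cat (ckt_size ht).
exact: ckt_act ht hu.
Qed.

Lemma ipush_block pi sw u t t' v tau i i' : ckt sw t t' tau -> (sw -> u = [::]) ->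
  mrel (size u) (size t) tau i i' ->
  marked pi (u ++ t ++ v) i -> marked pi (u ++ t' ++ v) i' ->
  exists j j', [/\ mrel (size u) (size t) tau j j',
    marked pi (u ++ t ++ v) j /\ marked pi (u ++ t' ++ v) j',
    ipush pi (u ++ t ++ v, i) = (incr_at (u ++ t ++ v) j, j) &
    ipush pi (u ++ t' ++ v, i') = (incr_at (u ++ t' ++ v) j', j')].
Proof.
move=> ht hu hm hi hi'; have [r|nr] := excluded_middle_informative (is_inv_word (u ++ t ++ v)).
  by exists i, i'; rewrite !ipush_red //; apply/(ckt_red v ht hu).
have nr' : ~ is_inv_word (u ++ t' ++ v) by move/(ckt_red v ht hu).
have [j nij hj] := marked_other hi nr; have [j' hmj hj'] := marked_fwd ht hu hj.
exists j, j'; rewrite (ipush_nonred hi nr hj nij) (ipush_nonred hi' nr' hj') //.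
by move=> e; apply/nij/(mrel_inj ht hmj hm).
Qed.

(** Two deletions with the same action give two marks, so the word is not reduced and the next push
    is known. *)
Lemma forced pi u t v p q : (p < size t)%N -> (q < size t)%N -> p <> q ->
  act did (u ++ delete_at t p ++ v) = act did (u ++ delete_at t q ++ v) ->
  marked pi (u ++ t ++ v) (size u + p) ->
  ~ is_inv_word (u ++ t ++ v) /\
  ipush pi (u ++ t ++ v, (size u + p)%N) = (u ++ incr_at t q ++ v, (size u + q)%N).
Proof.
move=> hp hq npq e hm; have hm' := marked_block erefl hp hq e hm.
have nr : ~ is_inv_word (u ++ t ++ v) by move=> r; have := marked_red_uniq r hm hm'; lia.
split=> //; rewrite (ipush_nonred hm nr hm') ?incr_at_block //; lia.
Qed.

Definition step12 (pi : int -> int) (m m1 : seq int * nat) : Prop :=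
  m1 = m \/ ~ is_inv_word m.1 /\ m1 = ipush pi m.

Lemma step12_forced pi u t v p q : (p < size t)%N -> (q < size t)%N -> p <> q ->
  act did (u ++ delete_at t p ++ v) = act did (u ++ delete_at t q ++ v) ->
  marked pi (u ++ t ++ v) (size u + p) ->
  step12 pi (u ++ t ++ v, (size u + p)%N) (u ++ incr_at t q ++ v, (size u + q)%N).
Proof. by move=> hp hq npq e hm; right; have [h1 ->] := forced hp hq npq e hm. Qed.

Lemma hsync_block o u t t' v tau p p' : size u = odflt 0%N o -> ckt (o == None) t t' tau ->
  (p, p') \in tau -> hsync o (u ++ t ++ v, (size u + p)%N) (u ++ t' ++ v, (size u + p')%N).
Proof.
by move=> hu ht hp; exists u, t, t', v, tau; split=> //; right; exists p, p'.
Qed.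

(** Without a collision the blocks remain related by the same kind of move. A collision makes the
    next push [forced] on the affected sides; a commutation block may then become a braid block, and
    a braid block becomes a commutation block. *)
Lemma incr_block pi o u t t' v tau p p' : size u = odflt 0%N o -> ckt (o == None) t t' tau ->
  (p, p') \in tau ->
  marked pi (u ++ incr_at t p ++ v) (size u + p) ->
  marked pi (u ++ incr_at t' p' ++ v) (size u + p') ->
  exists m1 m1', [/\ step12 pi (u ++ incr_at t p ++ v, (size u + p)%N) m1,
    step12 pi (u ++ incr_at t' p' ++ v, (size u + p')%N) m1' & sync o m1 m1'].
Proof.
move=> hu ht; have far (a b : int) w : (a + 1 < b) || (b + 1 < a) ->
  act did (u ++ a :: b :: w) = act did (u ++ b :: a :: w) by apply: act_far.
have stay m : step12 pi m m by left.
have H := @step12_forced pi u.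
case: ht => [a b c ab bc sw|a b c ab bc sw|a sw|a b ab sw]; rewrite !inE -?orbA.
- case/or3P => /eqP[-> ->]; rewrite /incr_at /= => m m'.
  + have [e|ne] := eqVneq (b + 1) c.
      subst c; do 2 eexists; split.
      * by apply: (H [:: b + 1; a; b + 1] v 0%N 2%N) => //; apply: far; lia.
      * exact: (H [:: b + 1; b + 1; a] v 0%N 1%N).
      by left; apply: (hsync_block v hu (ckt_bac _ _ sw) _ (p := 2) (p' := 1)) => //=; lia.
    do 2 eexists; split; [exact: stay|exact: stay|left].
    by apply: (hsync_block v hu (ckt_bac _ _ sw) _ (p := 0) (p' := 0)) => //=; lia.
  + have [e|ne] := eqVneq (a + 1) b.
      (* Three consecutive letters: only the left block collides, and one more push there leaves the
         two sides of a braid move. *)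
      subst b; have [e|ne] := eqVneq (a + 1 + 1) c.
        subst c; do 2 eexists; split.
        * exact: (H [:: a + 1; a + 1; a + 1 + 1] v 1%N 0%N).
        * exact: stay.
        by right; apply: (hsync_block v hu (ckt_aba (a + 1) sw) _ (p := 2) (p' := 0)).
      do 2 eexists; split.
      * exact: (H [:: a + 1; a + 1; c] v 1%N 0%N).
      * by apply: (H [:: a + 1; c; a + 1] v 2%N 0%N) => //; apply: far; lia.
      by left; apply: (hsync_block v hu (ckt_bac _ _ sw) _ (p := 0) (p' := 0)) => //=; lia.
    do 2 eexists; split; [exact: stay|exact: stay|left].
    by apply: (hsync_block v hu (ckt_bac _ _ sw) _ (p := 1) (p' := 2)) => //=; lia.
  + do 2 eexists; split; [exact: stay|exact: stay|left].
    by apply: (hsync_block v hu (ckt_bac _ _ sw) _ (p := 2) (p' := 1)) => //=; lia.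
- case/or3P => /eqP[-> ->]; rewrite /incr_at /= => m m'.
  + have [e|ne] := eqVneq (a + 1) b.
      subst b; have [e|ne] := eqVneq (a + 1 + 1) c.
        subst c; do 2 eexists; split.
        * exact: stay.
        * exact: (H [:: a + 1 + 1; a + 1; a + 1] v 1%N 2%N).
        by left; apply: (hsync_block v hu (ckt_aba (a + 1) sw) _ (p := 0) (p' := 2)).
      do 2 eexists; split.
      * by apply: (H [:: a + 1; c; a + 1] v 0%N 2%N) => //; apply: far; lia.
      * exact: (H [:: c; a + 1; a + 1] v 1%N 2%N).
      by left; apply: (hsync_block v hu (ckt_acb _ _ sw) _ (p := 2) (p' := 2)) => //=; lia.
    do 2 eexists; split; [exact: stay|exact: stay|left].
    by apply: (hsync_block v hu (ckt_acb _ _ sw) _ (p := 0) (p' := 1)) => //=; lia.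
  + do 2 eexists; split; [exact: stay|exact: stay|left].
    by apply: (hsync_block v hu (ckt_acb _ _ sw) _ (p := 1) (p' := 0)) => //=; lia.
  + have [e|ne] := eqVneq (b + 1) c.
      subst c; do 2 eexists; split.
      * exact: (H [:: a; b + 1; b + 1] v 2%N 1%N).
      * by apply: (H [:: b + 1; a; b + 1] v 2%N 0%N) => //; apply: far; lia.
      by left; apply: (hsync_block v hu (ckt_acb _ _ sw) _ (p := 1) (p' := 0)) => //=; lia.
    do 2 eexists; split; [exact: stay|exact: stay|left].
    by apply: (hsync_block v hu (ckt_acb _ _ sw) _ (p := 2) (p' := 2)) => //=; lia.
- case/orP => /eqP[-> ->]; rewrite /incr_at /= => m m'.
  + do 2 eexists; split; [exact: (H [:: a + 1; a + 1; a] v 0%N 1%N)|exact: stay|right].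
    by apply: (hsync_block v hu (ckt_bac _ _ sw) _ (p := 2) (p' := 1)) => //=; lia.
  + do 2 eexists; split; [exact: (H [:: a; a + 1; a + 1] v 2%N 1%N)|exact: stay|left].
    by apply: (hsync_block v hu (ckt_acb _ _ sw) _ (p := 1) (p' := 0)) => //=; lia.
- case/orP => /eqP[-> ->]; rewrite /incr_at /= => m m'.
  + have [e|ne] := eqVneq (a + 1) b.
      subst b; do 2 eexists; split.
      * exact: (H [:: a + 1; a + 1] v 0%N 1%N).
      * exact: (H [:: a + 1; a + 1] v 1%N 0%N).
      by left; apply: (hsync_block v hu (ckt_swap _ sw) _ (p := 1) (p' := 0)) => //=; lia.
    do 2 eexists; split; [exact: stay|exact: stay|left].
    exact: (hsync_block v hu (ckt_swap ne sw) _ (p := 0) (p' := 1)).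
  + have [e|ne] := eqVneq a (b + 1).
      subst a; do 2 eexists; split.
      * exact: (H [:: b + 1; b + 1] v 1%N 0%N).
      * exact: (H [:: b + 1; b + 1] v 0%N 1%N).
      by left; apply: (hsync_block v hu (ckt_swap _ sw) _ (p := 0) (p' := 1)) => //=; lia.
    do 2 eexists; split; [exact: stay|exact: stay|left].
    exact: (hsync_block v hu (ckt_swap ne sw) _ (p := 1) (p' := 0)).
Qed.

Lemma incr_outside (u t t' v : seq int) j : size t = size t' ->
  ((j < size u) || (size u + size t <= j))%N -> (j < size (u ++ t ++ v))%N ->
  exists u' v', [/\ size u' = size u, incr_at (u ++ t ++ v) j = u' ++ t ++ v' &
    incr_at (u ++ t' ++ v) j = u' ++ t' ++ v'].
Proof.
move=> es; case/orP => hj hs.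
  have [A [x [B [-> ->]]]] := split_at hj; exists (A ++ (x + 1) :: B), v.
  by rewrite -!catA /= !incr_at_cat !size_cat.
have hv : (j - (size u + size t) < size v)%N by move: hs; rewrite !size_cat; lia.
have [A [x [B [ev ei]]]] := split_at hv; subst v.
have e1 : j = size (u ++ t ++ A) by rewrite !size_cat -ei; lia.
have e2 : j = size (u ++ t' ++ A) by rewrite e1 !size_cat es.
exists u, (A ++ (x + 1) :: B); split=> //.
  have -> : u ++ t ++ A ++ x :: B = (u ++ t ++ A) ++ x :: B by rewrite -!catA.
  by rewrite e1 incr_at_cat -!catA.
have -> : u ++ t' ++ A ++ x :: B = (u ++ t' ++ A) ++ x :: B by rewrite -!catA.
by rewrite e2 incr_at_cat -!catA.
Qed.

Lemma hsync_step pi o m m' : hsync o m m' -> marked pi m.1 m.2 -> marked pi m'.1 m'.2 ->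
  exists m1 m1', [/\ step12 pi (ipush pi m) m1, step12 pi (ipush pi m') m1' & sync o m1 m1'].
Proof.
case: m m' => [w i] [w' i'] [u [t [t' [v [tau [e1 e2 hu ht hm]]]]]] hi hi'.
rewrite /= in e1 e2 hm hi hi'; subst w w'.
have [j [j' [hmj [hj hj'] -> ->]]] := ipush_block ht (swap_nil hu) hm hi hi'.
have mi := marked_incr hj; have mi' := marked_incr hj'.
case: hmj => [[ej hout]|[p [p' [hp ej ej']]]].
  subst j'; have [u' [v' [su -> ->]]] := incr_outside (ckt_size ht) hout hj.1.
  do 2 eexists; split; [by left|by left|left].
  exists u', t, t', v', tau; rewrite su; split=> //=; by left.
subst j j'; have [h1 h2 _] := ckt_del u v ht hp.
rewrite !incr_at_block // in mi mi' *.
exact: incr_block hu ht hp mi mi'.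
Qed.

Lemma sync_sym o m m' : sync o m m' -> sync o m' m.
Proof. by case; [right|left]. Qed.

Lemma sync_step pi o m m' : sync o m m' -> marked pi m.1 m.2 -> marked pi m'.1 m'.2 ->
  exists m1 m1', [/\ step12 pi (ipush pi m) m1, step12 pi (ipush pi m') m1' & sync o m1 m1'].
Proof.
case=> hs hm hm'; first exact: hsync_step hs hm hm'.
have [m1 [m1' [h1 h2 /sync_sym h3]]] := hsync_step hs hm' hm.
by exists m1', m1.
Qed.

Lemma sync_red o m m' : sync o m m' -> is_inv_word m.1 <-> is_inv_word m'.1.
Proof.
case=> -[u [t [t' [v [tau [-> -> hu ht hm]]]]]]; first exact: ckt_red ht (swap_nil hu).
by apply: iff_sym; apply: ckt_red ht (swap_nil hu).
Qed.

Lemma step12_trace pi m m1 : step12 pi (ipush pi m) m1 -> trace pi m m1.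
Proof.
case=> [->|[nr ->]]; first exact: trace_one.
by apply: trace_step => //; apply: trace_one.
Qed.

Lemma sync_run pi o N m m' : sync o m m' -> marked pi m.1 m.2 -> marked pi m'.1 m'.2 ->
  (0 < N)%N -> is_inv_word (iter N (ipush pi) m).1 ->
  (forall M, (0 < M < N)%N -> ~ is_inv_word (iter M (ipush pi) m).1) ->
  exists r', trace pi m' r' /\ sync o (iter N (ipush pi) m) r'.
Proof.
elim/ltn_ind: N m m' => N IH m m' hs hm hm' hN rN nr.
have [m1 [m1' [h1 h1' hs1]]] := sync_step hs hm hm'.
have t1 := step12_trace h1; have t1' := step12_trace h1'.
have hm1 := trace_marked t1 hm; have hm1' := trace_marked t1' hm'.
(* A second push is made only when the first one left a non-reduced word, so it cannot overshoot
   N. *)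
have [K [hK eK]] : exists K, (0 < K <= N)%N /\ m1 = iter K (ipush pi) m.
  case: h1 => [->|[nr1 ->]]; first by exists 1%N.
  exists 2%N; split=> //; case: N hN rN {IH nr} => [|[|N]] // _ rN.
have [eKN|ltKN] := eqVneq K N; first by exists m1'; rewrite -eKN -eK.
have nr1 : ~ is_inv_word m1.1 by rewrite eK; apply: nr; lia.
have nr1' : ~ is_inv_word m1'.1 by move/(sync_red hs1).
have eN : iter N (ipush pi) m = iter (N - K) (ipush pi) m1.
  by rewrite eK -iterD subnK //; lia.
have [||||r' [t' hs']] := IH (N - K)%N _ m1 m1' hs1 hm1 hm1'; try lia.
- by rewrite -eN.
- by move=> M hM; rewrite eK -iterD; apply: nr; lia.
by exists r'; rewrite eN; split=> //; apply: trace_trans t1' nr1' t'.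
Qed.

Lemma sync_ck o m m' : sync o m m' -> ck o m.1 m'.1.
Proof.
by case=> -[u [t [t' [v [tau [-> -> hu ht hm]]]]]]; [exists u, t, t', v, tau|exists u, t', t, v, tau];
  split=> //; [left|right].
Qed.

Lemma ck_sym o w w' : ck o w w' -> ck o w' w.
Proof.
by case=> u [t [t' [v [tau [-> -> hu ht]]]]]; exists u, t', t, v, tau; split=> //; case: ht; [right|left].
Qed.

Lemma ck_sync pi o w w' i : ck o w w' -> marked pi w i ->
  exists2 i', sync o (w, i) (w', i') & marked pi w' i'.
Proof.
case=> u [t [t' [v [tau [-> -> hu [ht|ht]]]]]] hi.
  have [i' hm hi'] := marked_fwd ht (swap_nil hu) hi; exists i' => //.
  by left; exists u, t, t', v, tau.
have [i' hm hi'] := marked_bwd ht (swap_nil hu) hi; exists i' => //.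
by right; exists u, t', t, v, tau.
Qed.

Lemma ck_red o w w' : ck o w w' -> is_inv_word w -> is_inv_word w'.
Proof.
by case=> u [t [t' [v [tau [-> -> hu [ht|ht]]]]]]; [move/(ckt_red v ht (swap_nil hu))
  |move/(ckt_red v ht (swap_nil hu))].
Qed.

Lemma ib_ck (N : int) pi o w w' : (forall x : int, (x < - N) || (N < x) -> pi x = x) ->
  is_inv_word w -> ck o w w' -> ck o (ib pi w) (ib pi w').
Proof.
move=> hpi rw hck; have rw' := ck_red hck rw.
have [[i hi]|nm] := excluded_middle_informative (exists i, marked pi w i); last first.
  rewrite !ib_unmarked // => i hi; last by apply: nm; exists i.
  by have [i' _ hi'] := ck_sync (ck_sym hck) hi; apply: nm; exists i'.
have [i' hs hi'] := ck_sync hck hi.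
have [j [t rb mb]] := ib_markedP hpi rw hi.
have [n [hn en nr]] := trace_iter t.
have [|r' [t' hs']] := sync_run hs hi hi' hn _ nr; first by rewrite en.
rewrite en in hs'; have rr' := (sync_red hs').1 rb.
by rewrite (ib_trace rw' hi' t' rr'); apply: (sync_ck hs').
Qed.

(** * The pairing of two increasing words *)

Lemma minlP (s : seq int) m : minl s = Some m <-> m \in s /\ {in s, forall x, m <= x}.
Proof.
have aux (x : int) t : let n := foldl Order.min x t in n \in x :: t /\ {in x :: t, forall z, n <= z}.
  elim: t x => [|y t IH] x /=; first by rewrite mem_head; split=> // z /[!inE]/eqP->.
  have [h1 h2] := IH (Order.min x y); split.
    move: h1; rewrite !inE => /orP[/eqP->|->]; last by rewrite !orbT.
    by case: (leP x y) => _; rewrite eqxx ?orbT.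
  move=> z; have := h2 (Order.min x y) (mem_head _ _).
  rewrite !inE => h3 /or3P[/eqP->|/eqP->|hz]; [by rewrite (le_trans h3) // ge_min lexx|by rewrite (le_trans h3) // ge_min lexx orbT|].
  by apply: h2; rewrite inE hz orbT.
case: s => [|x t] /=; first by split=> // -[].
have [h1 h2] := aux x t; split=> [[<-]//|[hm hle]]; congr Some; apply/eqP.
by rewrite eq_le h2 //= hle.
Qed.

Lemma maxlP (s : seq int) m : maxl s = Some m <-> m \in s /\ {in s, forall x, x <= m}.
Proof.
have aux (x : int) t : let n := foldl Order.max x t in n \in x :: t /\ {in x :: t, forall z, z <= n}.
  elim: t x => [|y t IH] x /=; first by rewrite mem_head; split=> // z /[!inE]/eqP->.
  have [h1 h2] := IH (Order.max x y); split.
    move: h1; rewrite !inE => /orP[/eqP->|->]; last by rewrite !orbT.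
    by case: (leP x y) => _; rewrite eqxx ?orbT.
  move=> z; have := h2 (Order.max x y) (mem_head _ _).
  rewrite !inE => h3 /or3P[/eqP->|/eqP->|hz]; [by rewrite (le_trans _ h3) // le_max lexx|by rewrite (le_trans _ h3) // le_max lexx orbT|].
  by apply: h2; rewrite inE hz orbT.
case: s => [|x t] /=; first by split=> // -[].
have [h1 h2] := aux x t; split=> [[<-]//|[hm hle]]; congr Some; apply/eqP.
by rewrite eq_le hle //= h2.
Qed.

Lemma minl_none (s : seq int) : minl s = None <-> s = [::].
Proof. by case: s. Qed.

Lemma maxl_none (s : seq int) : maxl s = None <-> s = [::].
Proof. by case: s. Qed.

Definition nxt (y : int) (A : seq int) : option int := minl [seq x <- A | y < x].

Lemma nxtP (y : int) (A : seq int) m :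
  nxt y A = Some m <-> [/\ m \in A, y < m & forall x : int, x \in A -> y < x -> m <= x].
Proof.
rewrite /nxt minlP mem_filter; split=> [[/andP[h1 h2] h3]|[h1 h2 h3]]; split=> //.
- by move=> x hx hy; apply: h3; rewrite mem_filter hx hy.
- by rewrite h1 h2.
- by move=> x; rewrite mem_filter => /andP[hy hx]; apply: h3.
Qed.

Lemma nxt_none (y : int) (A : seq int) : nxt y A = None <-> forall x : int, x \in A -> x <= y.
Proof.
rewrite /nxt minl_none; split=> [h x hx|h].
  have : x \notin [seq x <- A | y < x] by rewrite h.
  by rewrite mem_filter hx andbT -leNgt.
apply/eqP; rewrite -[_ == _]negbK -has_filter; apply/hasPn => x /h hx; by rewrite -leNgt.
Qed.

Definition pst (y : int) (A : seq int) : seq int := if nxt y A is Some m then rem m A else A.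

Lemma pst_uniq (y : int) (A : seq int) : uniq A -> uniq (pst y A).
Proof. by rewrite /pst; case: nxt => // m; apply: rem_uniq. Qed.

Lemma pst_sub (y : int) (A : seq int) : {subset pst y A <= A}.
Proof. by rewrite /pst => x; case: nxt => // m; apply: mem_rem. Qed.

Lemma rem_comm (T : eqType) (x y : T) s : rem x (rem y s) = rem y (rem x s).
Proof.
have [-> //|ne] := eqVneq x y; elim: s => //= z s IH.
have [->|nzy] := eqVneq z y; first by rewrite eq_sym (negPf ne) /= eqxx.
have [->|nzx] := eqVneq z x; first by rewrite /= eqxx.
by rewrite /= (negPf nzy) (negPf nzx) IH.
Qed.

(** What remains after greedy pairing does not depend on the order. For y < z with partners, either
    both have the same partner, and then whoever comes second takes the same next letter, or the
    partner of y is at most z and the choices are independent. *)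
Lemma pst_comm (y z : int) (A : seq int) : uniq A -> pst y (pst z A) = pst z (pst y A).
Proof.
move=> uA; have [-> //|ne] := eqVneq y z.
wlog lt : y z ne / y < z.
  move=> hw; case: (ltgtP y z) => h; [exact: hw|by apply/esym/hw; rewrite 1?eq_sym|].
  by rewrite h eqxx in ne.
case ez: (nxt z A) => [m|]; last first.
  have nz : nxt z (pst y A) = None.
    by apply/nxt_none => x /pst_sub; apply: ((nxt_none z A).1 ez).
  by rewrite [RHS]/pst nz {2}/pst ez.
have [m1 m2 m3] := (nxtP _ _ _).1 ez.
case ey: (nxt y A) => [n|]; last first.
  by have := (nxt_none y A).1 ey _ m1; lia.
have [n1 n2 n3] := (nxtP _ _ _).1 ey.
have -> : pst z A = rem m A by rewrite /pst ez.
have -> : pst y A = rem n A by rewrite /pst ey.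
have [e|nmn] := eqVneq m n.
  subst n; rewrite /pst; suff -> : nxt y (rem m A) = nxt z (rem m A) by [].
  rewrite /nxt; congr minl; apply: eq_in_filter => x; rewrite mem_rem_uniq // !inE => /andP[hx hA].
  apply/idP/idP => h; last by lia.
  by have := n3 x hA h; lia.
have hn : n <= z by case: (lerP n z) => // h; have := m3 n n1 h; have := n3 m m1 ltac:(lia); lia.
have -> : pst y (rem m A) = rem n (rem m A).
  rewrite /pst; suff -> : nxt y (rem m A) = Some n by [].
  apply/nxtP; split=> //; first by rewrite mem_rem_uniq // inE n1 eq_sym nmn.
  by move=> x /mem_rem; apply: n3.
have -> : pst z (rem n A) = rem m (rem n A).
  rewrite /pst; suff -> : nxt z (rem n A) = Some m by [].
  apply/nxtP; split=> //; first by rewrite mem_rem_uniq // inE m1 nmn.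
  by move=> x /mem_rem; apply: m3.
exact: rem_comm.
Qed.

(** [foldr] treats the last letter of b first, which is the largest one when b is increasing, as the
    pairing rule asks. *)
Definition avail (a b : seq int) : seq int := foldr pst a b.

Lemma avail_uniq a b : uniq a -> uniq (avail a b).
Proof. by move=> ua; elim: b => //= y b IH; apply: pst_uniq. Qed.

Lemma avail_sub a b : {subset avail a b <= a}.
Proof. by elim: b => //= y b IH x /pst_sub; apply: IH. Qed.

Lemma avail_pst (y : int) a b : uniq a -> avail (pst y a) b = pst y (avail a b).
Proof. by move=> ua; elim: b => //= z b ->; rewrite pst_comm // avail_uniq. Qed.

Lemma pst_rem (y z : int) (A : seq int) : z <= y -> z \in A -> uniq A ->
  pst y (rem z A) = rem z (pst y A) /\ z \in pst y A.
Proof.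
move=> zy zA uA; rewrite {2 3}/pst; case e: (nxt y A) => [m|]; last first.
  split=> //; rewrite /pst; suff -> : nxt y (rem z A) = None by [].
  by apply/nxt_none => x /mem_rem; apply: (nxt_none y A).1.
have [h1 h2 h3] := (nxtP _ _ _).1 e; have ne : m != z by apply/eqP; lia.
split; last by rewrite mem_rem_uniq // inE zA eq_sym ne.
rewrite /pst; suff -> : nxt y (rem z A) = Some m by rewrite rem_comm.
apply/nxtP; split=> //; first by rewrite mem_rem_uniq // inE h1 ne.
by move=> x /mem_rem; apply: h3.
Qed.

Lemma avail_rem (z : int) a b : uniq a -> z \in a -> {in b, forall y, z <= y} ->
  avail (rem z a) b = rem z (avail a b) /\ z \in avail a b.
Proof.
move=> ua za; elim: b => //= y b IH hb.
have [-> h2] := IH (fun x hx => hb x (mem_behead (s := y :: b) hx)).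
by apply: pst_rem => //; [apply: hb; rewrite mem_head|apply: avail_uniq].
Qed.

Lemma avail_pick (q : int) P Q : uniq P -> q \in Q -> avail P Q = avail (pst q P) (rem q Q).
Proof.
move=> uP; elim: Q => //= y Q IH; have [->|ne] := eqVneq y q.
  by rewrite avail_pst.
by rewrite inE eq_sym (negPf ne) /= => /IH ->.
Qed.

Fixpoint unp (a b : seq int) : seq int :=
  if b is y :: b' then
    if nxt y (avail a b') is None then y :: unp a b' else unp a b'
  else [::].

Lemma sort_sorted_lt (s : seq int) : sorted <%O s -> sort <=%O s = s.
Proof. by rewrite lt_sorted_uniq_le => /andP[_]; apply: sorted_sort; apply: le_trans. Qed.

Lemma ms_pairE a b : sorted <%O b -> ms_pair a b = (avail a b, unp a b).
Proof.
move=> hb; rewrite /ms_pair sort_sorted_lt // foldl_rev {hb}; elim: b => //= y b ->.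
by rewrite /pst /nxt; case: minl.
Qed.

Lemma sorted_splitP (l r : seq int) (c : int) : sorted <%O (l ++ c :: r) <->
  [/\ sorted <%O l, sorted <%O r, {in l, forall x, x < c} & {in r, forall x, c < x}].
Proof.
rewrite !lt_sorted_pairwise pairwise_cat /= allrel_consr.
split=> [/and4P[/andP[/allP h1 _] h2 /allP h3 h4]|[h2 h4 h1 h3]]; first by split.
rewrite h2 h4 !andbT; apply/andP; split; last exact/allP.
apply/andP; split; first exact/allP.
by apply/allrelP => x y /h1 hx /h3; apply: lt_trans.
Qed.

Lemma sorted_consP (r : seq int) (c : int) : sorted <%O (c :: r) <->
  sorted <%O r /\ {in r, forall x, c < x}.
Proof. by rewrite (sorted_splitP [::]); split=> [[]|[]]. Qed.

(** * Inserting a letter into an increasing word *)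

(* Row insertion of Edelman and Greene: [x] bumps the next larger letter [c], except that
   a word containing [x] and [x + 1] is unchanged and bumps [x + 1]. *)
Definition ins (a : seq int) (x c : int) (a1 : seq int) : Prop :=
  (exists l r, [/\ a = l ++ c :: r, a1 = l ++ x :: r, sorted <%O a, {in l, forall z, z < x} & x < c]) \/
  (exists l r, [/\ a = l ++ x :: x + 1 :: r, a1 = a, c = x + 1 & sorted <%O a]).

Lemma sorted_insert (a : seq int) (x : int) : sorted <%O a ->
  exists l r, a = l ++ r /\ {in l, forall z, z < x} /\ {in r, forall z, x <= z}.
Proof.
elim: a => [|y a IH]; first by exists [::], [::].
move/sorted_consP => [/IH[l [r [-> [hl hr]]]] hy].
case: (ltrP y x) => hyx.
  by exists (y :: l), r; split=> //; split=> // z /[!inE]/orP[/eqP->|/hl].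
exists [::], (y :: l ++ r); split=> //; split=> // z /[!inE]/orP[/eqP->//|/hy h].
exact: ltW (le_lt_trans hyx h).
Qed.

Lemma next_absentP (b : seq int) (x : int) : uniq b ->
  [/\ x <= next_absent b x, next_absent b x \notin b &
    forall z : int, x <= z -> z < next_absent b x -> z \in b].
Proof.
move=> ub; rewrite /next_absent.
set go := fix go k y := match k with 0%N => y | k'.+1 => if y \in b then go k' (y + 1) else y end.
have aux k (y : int) : x <= y -> y = x + (size b - k)%N%:Z -> (k <= size b)%N ->
    (forall z : int, x <= z -> z < y -> z \in b) ->
    [/\ x <= go k y, go k y \notin b & forall z : int, x <= z -> z < go k y -> z \in b].
  elim: k y => [|k IH] y hxy ey hk hz /=.
    split=> //; apply/negP => hyb.
    (* If the fuel ran out on a letter of b, the integers from x to x + size b would be too many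
       distinct letters of b. *)
    pose s := [seq x + i%:Z | i <- iota 0 (size b).+1].
    have us : uniq s by rewrite map_inj_uniq ?iota_uniq // => i j; lia.
    have sub : {subset s <= b}.
      move=> z /mapP[i]; rewrite mem_iota add0n /= => hi ->.
      have [->|ne] := eqVneq i (size b); first by move: hyb; rewrite ey subn0.
      by apply: hz; lia.
    by have := uniq_leq_size us sub; rewrite size_map size_iota ltnn.
  case: ifP => hyb; last by rewrite hyb.
  apply: IH; [lia|lia|lia|] => z h1 h2; have [->//|ne] := eqVneq z y.
  by apply: hz; lia.
by apply: aux => //; [lia|move=> z; lia].
Qed.

Lemma next_absent_uniq (b b' : seq int) (x x' : int) : uniq b -> uniq b' ->
  x <= next_absent b' x' -> next_absent b' x' \notin b ->
  (forall z : int, x <= z -> z < next_absent b' x' -> z \in b) ->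
  next_absent b x = next_absent b' x'.
Proof.
move=> ub _; have [h1 h2 h3] := next_absentP x ub.
move: (next_absent b x) (next_absent b' x') h1 h2 h3 => y y' h1 h2 h3 h1' h2' h3'.
case: (ltgtP y y') => // h; first by rewrite h3' in h2.
by rewrite h3 in h2'.
Qed.

Lemma next_absent_notin (b : seq int) (x : int) : x \notin b -> next_absent b x = x.
Proof. by rewrite /next_absent; case: (size b) => //= n /negPf->. Qed.

Definition fpair (a b : seq int) : option (seq int * seq int) :=
  omap (fun x => (rem x a, sort <=%O (next_absent b x :: b))) (maxl (avail a b)).

Lemma sort_cons_small (y x : int) b : sorted <%O (x :: b) -> x < y ->
  sort <=%O (y :: x :: b) = x :: sort <=%O (y :: b).
Proof.
move=> /sorted_consP[sb hx] xy; apply: (@sorted_eq _ <=%O); [exact: le_trans|exact: le_anti| | |].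
- by apply: sort_sorted; apply: le_total.
- rewrite /= path_min_sorted; first by apply: sort_sorted; apply: le_total.
  by apply/allP => z; rewrite mem_sort inE => /orP[/eqP->|/hx]; [apply: ltW|apply: ltW].
- rewrite perm_sort (perm_catCA [:: y] [:: x] b) /= perm_cons perm_sym perm_sort.
  exact: perm_refl.
Qed.

Lemma sort_cons_sorted (x : int) b : sorted <%O (x :: b) -> sort <=%O (x :: b) = x :: b.
Proof. exact: sort_sorted_lt. Qed.

Lemma rem_mid (l r : seq int) (c : int) : sorted <%O (l ++ c :: r) -> rem c (l ++ c :: r) = l ++ r.
Proof.
move/sorted_splitP => [_ _ hl _]; elim: l hl => [|y l IH] hl /=; first by rewrite eqxx.
have : y < c by apply: hl; rewrite mem_head.
by case: eqP => [->|_ _]; rewrite ?ltxx // IH // => z hz; apply: hl; rewrite inE hz orbT.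
Qed.

Lemma rem_right (l r : seq int) (c x : int) : sorted <%O (l ++ c :: r) -> c < x ->
  rem x (l ++ c :: r) = l ++ c :: rem x r.
Proof.
move/sorted_splitP => [_ _ hl _] hx; elim: l hl => [|y l IH] hl /=.
  by case: eqP => // e; rewrite e ltxx in hx.
have : y < c by apply: hl; rewrite mem_head.
by case: eqP => [->|_ _]; [lia|rewrite IH // => z hz; apply: hl; rewrite inE hz orbT].
Qed.

Ltac order_lia :=
  repeat match goal with
  | H : is_true (Order.lt _ _) |- _ => revert H
  | H : is_true (Order.le _ _) |- _ => revert H
  | H : @eq ?T _ _ |- _ => let _ := constr:(erefl : T = int) in revert H
  | H : is_true (~~ (@eq_op ?T _ _)) |- _ =>
      let _ := constr:(erefl : Equality.sort T = int) in revert H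
  end; clear; intros; lia.

Lemma ins_sorted a (x c : int) a1 : ins a x c a1 -> sorted <%O a /\ sorted <%O a1.
Proof.
case=> [[l [r [-> -> s hl xc]]]|[l [r [-> -> _ s]]]]; split=> //.
have /sorted_splitP[h1 h2 h3 h4] := s; apply/sorted_splitP; split=> //.
by move=> z /h4; apply: lt_trans.
Qed.

Lemma sorted_mid (l r : seq int) (c : int) : sorted <%O (l ++ c :: r) -> sorted <%O (l ++ r).
Proof. by apply: subseq_lt_sorted; apply: cat_subseq => //; apply: subseq_cons. Qed.

Lemma pst_bump l (c : int) r (x : int) : sorted <%O (l ++ c :: r) -> {in l, forall z, z < x} ->
  x < c -> pst x (l ++ c :: r) = l ++ r.
Proof.
move=> s hl xc; rewrite /pst; suff -> : nxt x (l ++ c :: r) = Some c by apply: rem_mid.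
have /sorted_splitP[_ _ _ h4] := s.
apply/nxtP; split=> //; first by rewrite mem_cat mem_head orbT.
move=> z; rewrite mem_cat inE => /or3P[/hl|/eqP->|/h4] //; first by lia.
by move=> h _; apply: ltW.
Qed.

(** By order independence x may be paired before b, which leaves the inserted word without z. Since
    z is at most every letter of b, it stays unpaired. *)
Lemma ins_avail a (x c : int) a1 b : ins a x c a1 -> sorted <%O (x :: b) ->
  exists z, [/\ (z = x /\ x \notin a) \/ (z = x + 1 /\ x \in a), z \in avail a1 b,
    avail a (x :: b) = rem z (avail a1 b) & pst x a = rem z a1].
Proof.
move=> hi /sorted_consP[sb hb]; have [sa sa1] := ins_sorted hi.
have ua1 := lt_sorted_uniq sa1; have ua := lt_sorted_uniq sa.
rewrite /= -/(avail a b) -avail_pst //.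
case: hi sa sa1 ua1 ua => [[l [r [-> -> s hl xc]]]|[l [r [-> -> _ s]]]] _ sa1 ua1 ua.
  have e : pst x (l ++ c :: r) = rem x (l ++ x :: r).
    by rewrite (pst_bump s hl xc) (rem_mid sa1).
  exists x; rewrite e; have [||-> h2] := avail_rem (z := x) (b := b) ua1.
  - by rewrite mem_cat mem_head orbT.
  - by move=> y /hb /ltW.
  split=> //; left; split=> //; have /sorted_splitP[_ _ _ h4] := s.
  rewrite mem_cat inE; apply/negP => /or3P[/hl|/eqP e'|/h4]; lia.
have e : pst x (l ++ x :: x + 1 :: r) = rem (x + 1) (l ++ x :: x + 1 :: r).
  rewrite /pst; suff -> : nxt x (l ++ x :: x + 1 :: r) = Some (x + 1) by [].
  have /sorted_splitP[_ _ h3 h4] := s.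
  apply/nxtP; split=> [||y]; [by rewrite mem_cat !inE eqxx !orbT|lia|].
  by lia.
exists (x + 1); rewrite e; have [||-> h2] := avail_rem (z := x + 1) (b := b) ua1.
- by rewrite mem_cat !inE eqxx !orbT.
- by move=> y /hb; lia.
by split=> //; right; rewrite mem_cat mem_head orbT.
Qed.

Lemma ins_count a (x c : int) a1 b : ins a x c a1 -> sorted <%O (x :: b) ->
  size (avail a1 b) = (size (avail a (x :: b))).+1.
Proof.
move=> hi sb; have [z [_ hz -> _]] := ins_avail hi sb.
rewrite size_rem // prednK //; by case: (avail a1 b) hz.
Qed.

Lemma fpair_size a b a' b' : fpair a b = Some (a', b') -> size a = (size a').+1 /\ size b' = (size b).+1.
Proof.
rewrite /fpair; case e: (maxl _) => [x|] //= [<- <-].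
have [/avail_sub hx _] := (maxlP _ _).1 e.
by rewrite size_rem // size_sort prednK //; case: (a) hx.
Qed.

Lemma fpair_none a b : fpair a b = None <-> size (avail a b) = 0%N.
Proof.
rewrite /fpair; case e: (maxl _) => [x|] /=.
  by have [hx _] := (maxlP _ _).1 e; split=> //; case: (avail a b) hx.
by have -> := (maxl_none _).1 e.
Qed.

Lemma fpair_maxl a b (x : int) : x \in avail a b -> {in avail a b, forall z, z <= x} ->
  fpair a b = Some (rem x a, sort <=%O (next_absent b x :: b)).
Proof. by move=> h1 h2; rewrite /fpair ((maxlP _ _).2 (conj h1 h2)). Qed.

(* Inserting the first letter of [b] into [a] intertwines the lowering operators of the
   pairs before and after the insertion, and the bumped letter [c] does not change. *)
Lemma fpair_ins a (x c : int) a1 b a' b' : ins a x c a1 -> sorted <%O (x :: b) ->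
  fpair a (x :: b) = Some (a', b') ->
  exists y b1 a1', [/\ b' = y :: b1, ins a' y c a1' & fpair a1 b = Some (a1', b1)].
Proof.
move=> hi sxb; have [z [hz zav ez _]] := ins_avail hi sxb.
have [sa sa1] := ins_sorted hi; have ua := lt_sorted_uniq sa; have ua1 := lt_sorted_uniq sa1.
have ub := lt_sorted_uniq sxb; have [sb hb] := (sorted_consP _ _).1 sxb.
have ub' := lt_sorted_uniq sb; have xb : x \notin b by move: ub; rewrite cons_uniq => /andP[].
rewrite {1}/fpair; case em: (maxl _) => [m|] //= [<- <-].
have [hm hmax] := (maxlP _ _).1 em.
have uav := avail_uniq b ua1.
have memav w : (w \in avail a1 b) = (w == z) || (w \in avail a (x :: b)).
  by rewrite ez mem_rem_uniq // !inE; case: eqP => [->|].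
have mz : m != z by move: hm; rewrite ez mem_rem_uniq // inE => /andP[].
have ma := avail_sub hm.
(* Letters of a not exceeding x are at most every letter of x :: b, hence unpaired. *)
have low w : w \in a -> w <= x -> w <= m.
  move=> wa wx; apply: hmax; have [|//] := avail_rem (b := x :: b) ua wa.
  move=> y; rewrite inE => /orP[/eqP-> //|/hb xy]; exact: le_trans wx (ltW xy).
have na_big (w : int) : x < w -> next_absent (x :: b) w = next_absent b w.
  move=> xw; have [h1 h2 h3] := next_absentP w ub'; apply: next_absent_uniq => //.
    by rewrite inE negb_or h2 andbT; apply/eqP; order_lia.
  by move=> t t1 t2; rewrite inE h3 ?orbT.
have sort_big (w : int) : x < w -> sort <=%O (next_absent b w :: x :: b) =
    x :: sort <=%O (next_absent b w :: b).
  by move=> xw; apply: sort_cons_small => //; have [h1 _ _] := next_absentP w ub'; order_lia.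
case: hi => [[l [r [ea ea1 s hl xc]]]|[l [r [ea ea1 ec s]]]].
  have xa : x \notin a.
    have /sorted_splitP[_ _ _ h4] : sorted <%O (l ++ c :: r) by rewrite -ea.
    by rewrite ea mem_cat inE; apply/negP => /or3P[/hl|/eqP e'|/h4]; order_lia.
  have zx : z = x by case: hz => [[]//|[_ h]]; rewrite h in xa.
  (* If m < x, then m is the last letter of l: lowering makes it the new letter to insert, while x
     is what the inserted pair passes on. If m > x, then m lies to the right of c and does not meet
     the insertion. *)
  subst z; case: (ltgtP m x) => [mx|xm|e]; last by rewrite e eqxx in mz.
    have ml : m \in l.
      move: ma; rewrite ea mem_cat inE => /or3P[//|/eqP e|hr]; first by order_lia.
      have /sorted_splitP[_ _ _ h4] : sorted <%O (l ++ c :: r) by rewrite -ea.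
      by have := h4 m hr; order_lia.
    case: (lastP l) ml ea ea1 hl => // l0 m0 ml ea ea1 hl.
    have /sorted_splitP[sl sr hlc hrc] : sorted <%O (rcons l0 m0 ++ c :: r) by rewrite -ea.
    have em0 : m0 = m.
      have m0l : m0 \in rcons l0 m0 by rewrite mem_rcons mem_head.
      have h1 : m0 <= m by apply: low; [rewrite ea mem_cat m0l|apply/ltW/hl].
      move: ml; rewrite mem_rcons inE => /orP[/eqP->//|ml].
      have /sorted_splitP[_ _ h _] : sorted <%O (l0 ++ m0 :: [::]) by rewrite cats1.
      by have := h m ml; order_lia.
    subst m0; rewrite cat_rcons in ea; rewrite cat_rcons in ea1.
    have sa' : sorted <%O (l0 ++ m :: c :: r) by rewrite -ea.
    have mb : m \notin x :: b by rewrite inE; apply/negP => /orP[/eqP|/hb]; order_lia.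
    exists m, (x :: b), (l0 ++ m :: r); rewrite (next_absent_notin mb); split.
    + apply: sort_cons_sorted; apply/sorted_consP; split=> // t /[!inE]/orP[/eqP->//|/hb]; order_lia.
    + rewrite ea (rem_mid sa'); left; exists l0, r; split=> //.
      * exact: sorted_mid sa'.
      * by have /sorted_splitP[] := sa'.
      * by order_lia.
    rewrite (fpair_maxl (x := x)) //.
    + rewrite (next_absent_notin xb) ea1 (sort_cons_sorted sxb).
      have -> : l0 ++ m :: x :: r = (l0 ++ [:: m]) ++ x :: r by rewrite -catA.
      by rewrite rem_mid -?catA //= -ea1.
    + by move=> t; rewrite memav => /orP[/eqP->//|/hmax]; order_lia.
  have mr : m \in r.
    move: (hm); rewrite ez; move/mem_rem/avail_sub; rewrite ea1 mem_cat inE.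
    by move=> /or3P[/hl|/eqP|]; [order_lia|order_lia|].
  have sal : sorted <%O (l ++ c :: r) by rewrite -ea.
  have sal1 : sorted <%O (l ++ x :: r) by rewrite -ea1.
  have cm : c < m by have /sorted_splitP[_ _ _] := sal; apply.
  exists x, (sort <=%O (next_absent b m :: b)), (l ++ x :: rem m r); split.
  + by rewrite na_big // sort_big.
  + left; exists l, (rem m r); rewrite ea (rem_right sal) //; split=> //.
    apply: subseq_lt_sorted sal; apply: cat_subseq => //.
    by rewrite /= eqxx rem_subseq.
  rewrite (fpair_maxl (x := m)) ?ea1 ?(rem_right sal1) //.
    by rewrite -ea1 memav hm orbT.
  by move=> t; rewrite -ea1 memav => /orP[/eqP->|/hmax //]; order_lia.
have xa : x \in a by rewrite ea mem_cat mem_head orbT.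
have zx : z = x + 1 by case: hz => [[_ h]|[]//]; rewrite xa in h.
have xm : x <= m by apply: low.
have sal : sorted <%O (l ++ x :: x + 1 :: r) by rewrite -ea.
have /sorted_splitP[sl sr hlx hrx] := sal.
(* If m = x, the letter x of x :: b makes the search for an absent letter go on from x + 1, matching
   the removal of x + 1 from a1; the exceptional insertion becomes an ordinary one. *)
subst z c; have [e|ne] := eqVneq m x.
  subst m; have ena : next_absent (x :: b) x = next_absent b (x + 1).
    have [h1 h2 h3] := next_absentP (x + 1) ub'; apply: next_absent_uniq => //; first by order_lia.
      by rewrite inE negb_or h2 andbT; apply/eqP; order_lia.
    move=> t t1 t2; rewrite inE; have [//|ne /=] := eqVneq t x.
    by apply: h3 => //; order_lia.
  exists x, (sort <=%O (next_absent b (x + 1) :: b)), (l ++ x :: r); split.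
  + rewrite ena; apply: sort_cons_small => //; have [h1 _ _] := next_absentP (x + 1) ub'; order_lia.
  + rewrite ea (rem_mid sal); left; exists l, r; split=> //; first exact: sorted_mid sal.
    by order_lia.
  rewrite (fpair_maxl (x := x + 1)) //.
    rewrite ea1 ea; have -> : l ++ x :: x + 1 :: r = (l ++ [:: x]) ++ x + 1 :: r by rewrite -catA.
    by rewrite rem_mid -?catA.
  by move=> t; rewrite memav => /orP[/eqP->//|/hmax]; order_lia.
have mr : m \in r.
  move: ma; rewrite ea mem_cat !inE (negPf ne) (negPf mz) /= => /orP[/hlx|//]; order_lia.
have x1m : x + 1 < m by move/sorted_consP: sr => [_]; apply.
have e1 : rem m a = l ++ x :: x + 1 :: rem m r.
  rewrite ea (rem_right sal) //; last by order_lia.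
  by rewrite /=; case: eqP => // e; rewrite e eqxx in mz.
exists x, (sort <=%O (next_absent b m :: b)), (rem m a); split.
- by rewrite na_big ?sort_big //; order_lia.
- right; exists l, (rem m r); rewrite e1; split=> //.
  apply: subseq_lt_sorted sal; apply: cat_subseq => //.
  by rewrite /= !eqxx rem_subseq.
rewrite (fpair_maxl (x := m)) ?ea1 //.
  by rewrite -ea1 memav hm orbT.
by move=> t; rewrite -ea1 memav => /orP[/eqP->|/hmax //]; order_lia.
Qed.

(** * Chains of Coxeter--Knuth moves *)

(** Computes the target of a move from its source block alone, in either direction; this makes [ck]
    deterministic at a given place. *)
Definition ckmove (t : seq int) : seq int :=
  match t with
  | [:: x; y] => [:: y; x]
  | [:: x; y; z] =>
      if x == z then [:: y; x; y]
      else if (Num.min y z < x) && (x < Num.max y z) then [:: x; z; y] else [:: y; x; z]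
  | _ => t
  end.

Lemma ckt_move sw t t' tau : ckt sw t t' tau -> t' = ckmove t /\ t = ckmove t'.
Proof.
case=> [a b c ab bc _|a b c ab bc _|a _|a b _ _] //=.
- by split; repeat case: ifP => //; lia.
- by split; repeat case: ifP => //; lia.
- by rewrite !eqxx.
Qed.

Lemma ckt_size_sw sw t t' tau : ckt sw t t' tau -> size t = (if sw then 2 else 3)%N.
Proof. by case=> //= [a b c _ _|a b c _ _|a|a b _ ->] // /negPf->. Qed.

Lemma ck_det o w w1 w2 : ck o w w1 -> ck o w w2 -> w1 = w2.
Proof.
case=> u [t [t1 [v [tau [-> -> su h]]]]] [u' [t' [t2 [v' [tau' [e -> su' h']]]]]].
have [st m] : size t = (if o == None then 2 else 3)%N /\ t1 = ckmove t.
  by case: h => h; have [m1 m2] := ckt_move h; rewrite -?(ckt_size_sw h) ?(ckt_size h).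
have [st' m'] : size t' = (if o == None then 2 else 3)%N /\ t2 = ckmove t'.
  by case: h' => h'; have [m1 m2] := ckt_move h'; rewrite -?(ckt_size_sw h') ?(ckt_size h').
move/eqP: e; rewrite eqseq_cat ?su ?su' // eqseq_cat ?st ?st' // => /and3P[/eqP-> /eqP e /eqP->].
by rewrite m m' e.
Qed.

Lemma ck_bac u (a b c : int) v : a < b -> b < c ->
  ck (Some (size u)) (u ++ b :: a :: c :: v) (u ++ b :: c :: a :: v).
Proof.
move=> ab bc; do 5 eexists; split; last by left; apply: ckt_bac ab bc _.
all: by [].
Qed.

Lemma ck_acb u (a b c : int) v : a < b -> b < c ->
  ck (Some (size u)) (u ++ a :: c :: b :: v) (u ++ c :: a :: b :: v).
Proof.
move=> ab bc; do 5 eexists; split; last by left; apply: ckt_acb ab bc _.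
all: by [].
Qed.

Lemma ck_aba u (a : int) v :
  ck (Some (size u)) (u ++ a :: a + 1 :: a :: v) (u ++ a + 1 :: a :: a + 1 :: v).
Proof.
do 5 eexists; split; last by left; apply: ckt_aba a _.
all: by [].
Qed.

Lemma ck_swap (a b : int) v : a != b -> ck None (a :: b :: v) (b :: a :: v).
Proof.
move=> ab; exists [::]; do 4 eexists; split; last by left; apply: ckt_swap ab _.
all: by [].
Qed.

Inductive chain : seq (option nat) -> seq int -> seq int -> Prop :=
| chain_nil w : chain [::] w w
| chain_cons o os w w1 w2 of ck o w w1 & chain os w1 w2 : chain (o :: os) w w2.

Lemma chain_one o w w' : ck o w w' -> chain [:: o] w w'.
Proof. by move=> h; apply: chain_cons h _; apply: chain_nil. Qed.

Lemma chain_cat os os' w w1 w2 : chain os w w1 -> chain os' w1 w2 -> chain (os ++ os') w w2.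
Proof. by elim=> //= o {}os {}w w' w'' h _ IH h'; apply: chain_cons h (IH h'). Qed.

Lemma chain_rev os w w' : chain os w w' -> chain (rev os) w' w.
Proof.
elim=> [{}w|o {}os {}w w1 w2 h _ IH]; first exact: chain_nil.
by rewrite rev_cons -cats1; apply: chain_cat IH _; apply/chain_one/ck_sym.
Qed.

Lemma chain_det os w w1 w2 : chain os w w1 -> chain os w w2 -> w1 = w2.
Proof.
move=> h; elim: h w2 => {os w w1} [w|o os w w' w1 hc _ IH] w2 h.
  by inversion h.
inversion_clear h as [|? ? ? w3 ? hc' hr]; apply: IH; rewrite (ck_det hc hc'); exact: hr.
Qed.

(** [A] tells which places are allowed for moves. Reversal sends the exchange at the start of a word
    to its end, so only the places [Some k] survive in the conjugated map. *)
Record equivariant (A : pred (option nat)) (R : seq int -> Prop) (phi : seq int -> seq int) :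
  Prop := Equivariant {
  eqv_ck : forall o w w', A o -> R w -> ck o w w' -> R w';
  eqv_xx : forall u (a : int) v, ~ R (u ++ a :: a :: v);
  eqv_xyx : forall u (a b : int) v, R (u ++ a :: b :: a :: v) -> b = a + 1 \/ a = b + 1;
  eqv_R : forall w, R w -> R (phi w);
  eqv_size : forall w, R w -> size (phi w) = size w;
  eqv_descents : forall w, R w -> forall k, (k.+1 < size w)%N ->
    (nth 0 (phi w) k < nth 0 (phi w) k.+1) = (nth 0 w k < nth 0 w k.+1);
  eqv_phi : forall o w w', A o -> R w -> ck o w w' -> ck o (phi w) (phi w') }.

Lemma chain_R A R phi os w w' : equivariant A R phi -> all A os -> R w -> chain os w w' -> R w'.
Proof.
move=> g ha rw h; elim: h ha rw => {os w w'} [w|o os w w' w1 hc _ IH] //= /andP[ho hos] rw.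
by apply: IH => //; apply: eqv_ck g _ _ _ ho rw hc.
Qed.

Lemma chain_phi A R phi os w w' : equivariant A R phi -> all A os -> R w -> chain os w w' ->
  chain os (phi w) (phi w').
Proof.
move=> g ha rw h; elim: h ha rw => {os w w'} [w|o os w w' w1 hc _ IH] /=.
  by move=> *; apply: chain_nil.
move=> /andP[ho hos] rw; apply: chain_cons (eqv_phi g ho rw hc) (IH hos _).
exact: eqv_ck g _ _ _ ho rw hc.
Qed.

Lemma eqv_sortedE A R phi u s v U S V : equivariant A R phi -> R (u ++ s ++ v) ->
  phi (u ++ s ++ v) = U ++ S ++ V -> size U = size u -> size S = size s ->
  sorted <%O S = sorted <%O s.
Proof.
move=> g r e sU sS.
have key k : (k.+1 < size s)%N -> (nth 0 S k < nth 0 S k.+1) = (nth 0 s k < nth 0 s k.+1).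
  move=> hk; have hk' : ((size u + k).+1 < size (u ++ s ++ v))%N by rewrite !size_cat; lia.
  have := eqv_descents g r hk'; rewrite e.
  have nU j (t : seq int) : nth 0 (U ++ t) (size u + j) = nth 0 t j.
    by rewrite nth_cat sU ltnNge leq_addr addKn.
  have nu j (t : seq int) : nth 0 (u ++ t) (size u + j) = nth 0 t j.
    by rewrite nth_cat ltnNge leq_addr addKn.
  by rewrite -addnS !nU !nu !nth_cat sS hk (ltnW hk).
apply/(sortedP 0)/(sortedP 0) => h k hk; first by rewrite -key // h // sS.
by rewrite sS in hk; rewrite key // h.
Qed.

Lemma eqv_sorted A R phi u s v U S V : equivariant A R phi -> R (u ++ s ++ v) ->
  phi (u ++ s ++ v) = U ++ S ++ V -> size U = size u -> size S = size s ->
  sorted <%O s -> sorted <%O S.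
Proof. by move=> g r e sU sS; rewrite (eqv_sortedE g r e sU sS). Qed.

Definition ins_path (k n : nat) : seq (option nat) := map Some (rev (iota k n)).

Lemma ins_pathS k n : ins_path k n.+1 = ins_path k.+1 n ++ [:: Some k].
Proof. by rewrite /ins_path /= rev_cons map_rcons cats1. Qed.

Lemma ins_path_add k m n : ins_path k (m + n) = ins_path (k + m) n ++ ins_path k m.
Proof. by rewrite /ins_path iotaD rev_cat map_cat. Qed.

(** x passes each letter of r by a move whose witness is the letter to the left of both. *)
Lemma chain_left r u (c x : int) v : sorted <%O (c :: r) -> x < c ->
  chain (ins_path (size u) (size r)) (u ++ c :: r ++ x :: v) (u ++ c :: x :: r ++ v).
Proof.
elim: r u c => [|q r IH] u c; first by move=> _ _; apply: chain_nil.
move=> /sorted_consP[s hc] xc; have cq := hc q (mem_head _ _).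
have := IH (u ++ [:: c]) q s (lt_trans xc cq).
rewrite size_cat addn1 -!catA /= ins_pathS => h; apply: chain_cat h _.
by apply/chain_one/ck_sym/ck_bac.
Qed.

(** c passes each letter of l by a move whose witness is the letter to the right of both. *)
Lemma chain_right l u (c y : int) v : sorted <%O (l ++ [:: y]) -> y < c ->
  chain (ins_path (size u) (size l)) (u ++ l ++ c :: y :: v) (u ++ c :: l ++ y :: v).
Proof.
elim: l u => [|d l IH] u; first by move=> _ _; apply: chain_nil.
move=> s yc; have s' : sorted <%O (l ++ [:: y]) by apply: path_sorted s.
have := IH (u ++ [:: d]) s' yc.
rewrite size_cat addn1 -!catA /= ins_pathS => h; apply: chain_cat h _.
apply/chain_one; case: l s {s' IH} => [|e l] /= s.
  by apply: ck_acb => //; case/andP: s.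
case/andP: s => de s; apply: ck_acb => //.
have /sorted_splitP[_ _ h _] : sorted <%O ((e :: l) ++ y :: [::]) by [].
by apply: lt_trans yc; apply: h; rewrite mem_head.
Qed.

(** x travels left to the place of c, then c travels left past l; in the exceptional case one braid
    move joins the two phases. The places are the same in both cases. *)
Lemma ins_chain a (x c : int) a1 u v : ins a x c a1 ->
  chain (ins_path (size u) (size a).-1) (u ++ a ++ x :: v) (u ++ c :: a1 ++ v).
Proof.
case=> [[l [r [-> -> s hl xc]]]|[l [r [-> -> -> s]]]].
  have /sorted_splitP[sl sr h3 h4] := s.
  rewrite size_cat addnS /= ins_path_add -size_cat -!catA.
  have h1 := @chain_left r (u ++ l) c x v ((sorted_consP _ _).2 (conj sr h4)) xc.
  rewrite -!catA in h1; apply: chain_cat h1 _; apply: chain_right => //.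
  by apply/sorted_splitP.
have /sorted_splitP[sl sr h3 h4] := s.
rewrite size_cat !addnS /= -addnS ins_path_add -size_cat -!catA ins_pathS.
have h1 := @chain_left r (u ++ l ++ [:: x]) (x + 1) x v sr ltac:(lia).
rewrite !size_cat addnA addn1 -!catA /= -size_cat in h1.
rewrite -catA; apply: chain_cat h1 _.
have h2 : chain [:: Some (size (u ++ l))] (u ++ l ++ x :: x + 1 :: x :: r ++ v)
    (u ++ l ++ x + 1 :: x :: x + 1 :: r ++ v).
  by apply: chain_one; rewrite !catA; apply: ck_aba.
apply: chain_cat h2 _; apply: chain_right; last by lia.
by apply/sorted_splitP.
Qed.

(** The only obstruction is a letter x of the word followed by some q > x + 1. Moving the new x left
    would then create a factor x q x, excluded by [eqv_xyx]. *)
Lemma ins_exists A R phi u a (p x : int) v : equivariant A R phi -> (forall k, A (Some k)) ->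
  R (u ++ rcons a p ++ x :: v) -> sorted <%O (rcons a p) -> x < p ->
  exists c a1, ins (rcons a p) x c a1.
Proof.
move=> g hA r s xp; have [l [t [e [hl ht]]]] := sorted_insert x s.
case: t e ht => [|c t] e ht.
  have : p < x by apply: hl; rewrite -[l]cats0 -e mem_rcons mem_head.
  by lia.
have [cx|cx] := eqVneq c x; last first.
  exists c, (l ++ x :: t); left; exists l, t; split=> //.
  by rewrite lt_neqAle eq_sym cx ht // mem_head.
subst c; have s' : sorted <%O (l ++ x :: t) by rewrite -e.
case: t e ht s' => [|q t] e ht s'.
  have : p = x by have := congr1 (last x) e; rewrite last_rcons last_cat.
  by lia.
have [qx|qx] := eqVneq q (x + 1).
  by exists (x + 1), (rcons a p); right; exists l, t; rewrite e qx; split=> //; rewrite -qx.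
have /sorted_splitP[_ sq _ hx] := s'.
have xq : x < q by apply: hx; rewrite mem_head.
have := @chain_left t (u ++ l ++ [:: x]) q x v sq xq; rewrite -!catA /= => h.
have r' : R (u ++ l ++ x :: q :: x :: t ++ v).
  apply: (chain_R g _ _ h); first by apply/allP => o /mapP[k _ ->].
  by move: r; rewrite e -!catA.
by rewrite catA in r'; case: (eqv_xyx g r'); lia.
Qed.

(** * Lowering and raising operators *)

Lemma avail_low a b : {in a & b, forall x y : int, x <= y} -> avail a b = a.
Proof.
elim: b => //= y b IH h; rewrite IH; last by move=> x z hx hz; apply: h; rewrite // inE hz orbT.
rewrite /pst; suff -> : nxt y a = None by [].
by apply/nxt_none => x hx; apply: h; rewrite ?mem_head.
Qed.

Lemma rcons_low a (p : int) b : sorted <%O (rcons a p ++ b) ->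
  {in rcons a p & b, forall x y : int, x <= y}.
Proof.
rewrite lt_sorted_pairwise pairwise_cat => /andP[/allrelP h _] x y hx hy.
exact/ltW/h.
Qed.

Lemma fpair_sorted a (p : int) b : sorted <%O (rcons a p ++ b) ->
  fpair (rcons a p) b = Some (a, p :: b).
Proof.
move=> s; have low := rcons_low s; have := s; rewrite cat_rcons => s'.
have [sa sb h1 h2] := (sorted_splitP _ _ _).1 s'.
have ea := avail_low low; rewrite (fpair_maxl (x := p)) ?ea //.
- rewrite next_absent_notin; last by apply/negP => /h2; rewrite ltxx.
  rewrite sort_cons_sorted; last by apply/sorted_consP.
  by rewrite -cats1 rem_mid ?cats0 // -[_ ++ _]cats0 -catA; apply/sorted_splitP.
- by rewrite mem_rcons mem_head.
- by move=> z; rewrite mem_rcons inE => /orP[/eqP->//|/h1/ltW].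
Qed.

(** Induction on b. An ascent at the bar makes a ++ b increasing, on both sides since descents are
    preserved, and then only the bar moves. At a descent the first letter of b is inserted on both
    sides, along the same places as the lengths agree. *)
Lemma fpair_eqv A R phi (b u a v U S B V : seq int) : equivariant A R phi -> (forall k, A (Some k)) ->
  sorted <%O a -> sorted <%O b -> R (u ++ a ++ b ++ v) ->
  phi (u ++ a ++ b ++ v) = U ++ S ++ B ++ V ->
  size U = size u -> size S = size a -> size B = size b ->
  size (avail S B) = size (avail a b) /\
  forall a' b', fpair a b = Some (a', b') ->
    exists S' B', [/\ fpair S B = Some (S', B'), R (u ++ a' ++ b' ++ v) &
      phi (u ++ a' ++ b' ++ v) = U ++ S' ++ B' ++ V].
Proof.
move=> g hA; elim: b u a U S B => [|x b IH] u a U S B sa sb r e sU sS sB.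
  case: B sB e => // _ e; split=> // a' b'.
  case/lastP: a sa r e sS => // a p sa r e.
  case/lastP: S e => [|S q] e; rewrite !size_rcons // => -[sS].
  have sS' : sorted <%O (rcons S q).
    by apply: (eqv_sorted g r e sU _ sa); rewrite !size_rcons sS.
  rewrite (@fpair_sorted a p [::]) ?cats0 // => -[<- <-]; exists S, [:: q].
  by rewrite (@fpair_sorted S q [::]) ?cats0 //; move: r e; rewrite !cat_rcons.
case: B sB e => // X B [sB] e.
have sSs : sorted <%O S by apply: (eqv_sorted g r e sU sS sa).
have sBs : sorted <%O (X :: B).
  have r' := r; rewrite catA in r'; have e' := e; rewrite (catA u) (catA U) in e'.
  by apply: (eqv_sorted g r' e' _ _ sb); rewrite ?size_cat ?sU ?sS //= sB.
case/lastP: a sa r e sS => [|a p] sa r e sS.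
  have -> : S = [::] by apply: size0nil.
  have nil t : avail [::] t = [::] by elim: t => //= y t ->.
  by rewrite !nil; split=> // a' b'; rewrite /fpair nil.
case/lastP: S e sS sSs => [|S q] e; rewrite !size_rcons // => -[sS] sSs.
have npx : p <> x.
  by move=> epx; apply: (eqv_xx g (u := u ++ a) (a := x) (v := b ++ v)); move: r; rewrite cat_rcons -catA epx.
case: (ltrP p x) => [px|xp].
  have s1 : sorted <%O (rcons a p ++ x :: b).
    rewrite cat_rcons; apply/sorted_splitP; split=> //.
    - by move: sa; rewrite -cats1 => /sorted_splitP[].
    - by move: sa; rewrite -cats1 => /sorted_splitP[].
    - by move=> z /[!inE]/orP[/eqP->//|]; have /sorted_consP[_ h] := sb => /h; apply: lt_trans.
  have s2 : sorted <%O (rcons S q ++ X :: B).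
    have r' : R (u ++ (rcons a p ++ x :: b) ++ v) by rewrite -!catA.
    apply: (eqv_sorted g r' (U := U) (V := V) _ sU _ s1); first by rewrite -!catA.
    by rewrite !size_cat !size_rcons /= sS sB.
  rewrite !avail_low ?size_rcons ?sS; [|exact: rcons_low|exact: rcons_low].
  split=> // a' b'; rewrite (fpair_sorted s1) (fpair_sorted s2) => -[<- <-]; exists S, (q :: X :: B).
  by split=> //; move: r e; rewrite !cat_rcons.
have {npx} xp' : x < p by lia.
have QX : X < q.
  have rp := eqv_R g r; rewrite e in rp.
  have nqX : q <> X.
    by move=> eqX; apply: (eqv_xx g (u := U ++ S) (a := X) (v := B ++ V)); move: rp; rewrite cat_rcons -catA eqX.
  have hk : ((size (u ++ a)).+1 < size (u ++ rcons a p ++ (x :: b) ++ v))%N.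
    by rewrite !size_cat size_rcons /=; lia.
  have := eqv_descents g r hk; rewrite e.
  have nn (c1 c2 : int) s1 s2 : nth 0 (s1 ++ c1 :: c2 :: s2) (size s1) = c1 /\
      nth 0 (s1 ++ c1 :: c2 :: s2) (size s1).+1 = c2.
    by rewrite !nth_cat ltnn subnn ltnNge leqnSn /= subSnn.
  have -> : U ++ rcons S q ++ (X :: B) ++ V = (U ++ S) ++ q :: X :: B ++ V by rewrite cat_rcons -catA.
  have -> : u ++ rcons a p ++ (x :: b) ++ v = (u ++ a) ++ p :: x :: b ++ v by rewrite cat_rcons -catA.
  have [-> ->] := nn p x (u ++ a) (b ++ v).
  have -> : size (u ++ a) = size (U ++ S) by rewrite !size_cat sU sS.
  have [-> ->] := nn q X (U ++ S) (B ++ V).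
  by rewrite [p < x]ltNge xp /=; case: (ltgtP q X).
have rp := eqv_R g r; rewrite e in rp.
have [c [a1 hi]] := ins_exists g hA r sa xp'.
have [C [S1 hI]] := ins_exists g hA rp sSs QX.
have pA k n : all A (ins_path k n) by apply/allP => o /mapP[k' _ ->].
have ch := ins_chain u (b ++ v) hi.
have Ch := ins_chain U (B ++ V) hI.
have e1 : phi (u ++ c :: a1 ++ b ++ v) = U ++ C :: S1 ++ B ++ V.
  apply: chain_det (chain_phi g (pA _ _) r ch) _.
  by rewrite e; move: Ch; rewrite sU !size_rcons sS.
have r1 := chain_R g (pA _ _) r ch.
have ins_size a0 (x0 c0 : int) a2 : ins a0 x0 c0 a2 -> size a2 = size a0.
  by case=> [[l [t [-> -> _ _ _]]]|[l [t [-> -> _ _]]]] //; rewrite !size_cat.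
have sS1 : size S1 = size a1 by rewrite (ins_size _ _ _ _ hi) (ins_size _ _ _ _ hI) !size_rcons sS.
have sa1 : sorted <%O a1 by case: (ins_sorted hi).
have sb' : sorted <%O b by case/sorted_consP: sb.
(* The bumped letter joins the prefix, which lowering does not touch. *)
have [|||es ef] := IH (u ++ [:: c]) a1 (U ++ [:: C]) S1 B sa1 sb' _ _ _ sS1 sB.
- by rewrite -catA.
- by rewrite -!catA.
- by rewrite !size_cat sU.
have es' : size (avail (rcons S q) (X :: B)) = size (avail (rcons a p) (x :: b)).
  by apply: succn_inj; rewrite -(ins_count hi sb) -(ins_count hI sBs).
split=> // a' b' ef0; have [y [b1 [a1' [eb' hi' ef1]]]] := fpair_ins hi sb ef0; subst b'.
have [S1' [B1 [EF1 R1 E1]]] := ef _ _ ef1.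
case EF0: (fpair (rcons S q) (X :: B)) => [[S' B']|]; last first.
  by have := (fpair_none _ _).1 EF0; rewrite es' => /fpair_none; rewrite ef0.
have [Y [B2 [S2' [eB' hI' EF2]]]] := fpair_ins hI sBs EF0; subst B'.
rewrite EF1 in EF2; case: EF2 => *; subst S2' B2.
have [sz1 sz2] := fpair_size ef0; have [SZ1 SZ2] := fpair_size EF0.
(* Lowering keeps the bumped letter, so the insertion is undone along the reversed path. *)
have ch' := chain_rev (ins_chain u (b1 ++ v) hi').
have Ch' := chain_rev (ins_chain U (B1 ++ V) hI').
rewrite -!catA /= in R1 E1.
have rA k n : all A (rev (ins_path k n)) by rewrite all_rev.
exists S', (Y :: B1); split=> //=; first exact: chain_R g (rA _ _) R1 ch'.
apply: chain_det (chain_phi g (rA _ _) R1 ch') _.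
rewrite E1; move: Ch'; rewrite sU; suff -> : size S' = size a' by [].
by move: sz1 SZ1; rewrite !size_rcons sS; lia.
Qed.

(** * Reversal and negation exchange lowering and raising *)

Definition negw (s : seq int) : seq int := rev (map -%R s).

Lemma negwK : involutive negw.
Proof.
move=> s; rewrite /negw map_rev revK -map_comp -[RHS]map_id; apply: eq_map => x /=; exact: opprK.
Qed.

Lemma negw_cat s t : negw (s ++ t) = negw t ++ negw s.
Proof. by rewrite /negw map_cat rev_cat. Qed.

Lemma negw_rcons s (x : int) : negw (rcons s x) = - x :: negw s.
Proof. by rewrite /negw map_rcons rev_rcons. Qed.

Lemma size_negw s : size (negw s) = size s.
Proof. by rewrite size_rev size_map. Qed.

Lemma mem_negw s (x : int) : (x \in negw s) = (- x \in s).
Proof. by rewrite mem_rev -{1}(opprK x) mem_map //; apply: oppr_inj. Qed.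

Lemma uniq_negw s : uniq (negw s) = uniq s.
Proof. by rewrite rev_uniq map_inj_uniq //; apply: oppr_inj. Qed.

Lemma sorted_negw s : sorted <%O (negw s) = sorted <%O s.
Proof.
rewrite /negw rev_sorted sorted_map; apply: eq_sorted => x y /=; by rewrite ltrN2.
Qed.

Lemma rem_negw s (x : int) : uniq s -> rem (- x) (negw s) = negw (rem x s).
Proof.
move=> us; rewrite !rem_filter ?uniq_negw // /negw filter_rev filter_map.
by congr (rev (map _ _)); apply: eq_filter => y /=; rewrite eqr_opp.
Qed.

Lemma unp_rcons a b (y : int) :
  unp a (rcons b y) = unp (pst y a) b ++ (if nxt y a is None then [:: y] else [::]).
Proof.
elim: b => [|z b IH]; first by rewrite /=; case: (nxt y a).
by rewrite /= IH /avail foldr_rcons -/(avail _ b); case: nxt.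
Qed.

Lemma mem_unp a b (y : int) : uniq a -> sorted <%O b ->
  (y \in unp a b) = (- y \in avail (negw b) (negw a)).
Proof.
elim/last_ind: b a => [|b z IH] a ua sb.
  by rewrite in_nil; apply/esym/negP => /avail_sub.
have ub := lt_sorted_uniq sb; rewrite -cats1 in sb; have [sb' _ hb _] := (sorted_splitP _ _ _).1 sb.
have uP : uniq (- z :: negw b) by rewrite -negw_rcons uniq_negw.
rewrite unp_rcons mem_cat negw_rcons; case e: (nxt z a) => [x|].
  have [xa zx xmin] := (nxtP _ _ _).1 e; rewrite in_nil orbF.
  rewrite {1}/pst e IH ?rem_uniq // -rem_negw //.
  rewrite (avail_pick (q := - x) (P := - z :: negw b)) ?mem_negw ?opprK //.
  rewrite /pst; suff -> : nxt (- x) (- z :: negw b) = Some (- z) by rewrite /= eqxx.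
  apply/nxtP; split; [by rewrite mem_head|by rewrite ltrN2|].
  move=> t; rewrite inE => /orP[/eqP->//|]; rewrite mem_negw => /hb h _.
  by lia.
have hle := (nxt_none z a).1 e.
have [||h1 h2] := avail_rem (z := - z) (b := negw a) uP.
- by rewrite mem_head.
- by move=> t; rewrite mem_negw => /hle; lia.
rewrite {1}/pst e IH // inE; rewrite /= eqxx in h1; rewrite h1.
rewrite mem_rem_uniq ?avail_uniq // inE eqr_opp.
by case: eqP => [->|] /=; rewrite ?orbF ?h2.
Qed.

Lemma prev_absent_negw a (y : int) : prev_absent a y = - next_absent (negw a) (- y).
Proof.
rewrite /prev_absent /next_absent size_negw; elim: (size a) y => [|k IH] y; first by rewrite opprK.
rewrite mem_negw opprK; case: ifP => _; last by rewrite opprK.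
by rewrite IH opprB addrC.
Qed.

Definition epair (a b : seq int) : option (seq int * seq int) :=
  omap (fun y => (sort <=%O (prev_absent a y :: a), rem y b)) (minl (unp a b)).

Lemma sort_negw s : sort <=%O (negw s) = negw (sort <=%O s).
Proof.
apply: (@sorted_eq _ <=%O); [exact: le_trans|exact: le_anti| | |].
- by apply: sort_sorted; apply: le_total.
- rewrite /negw rev_sorted sorted_map; have : sorted <=%O (sort <=%O s) by apply: sort_sorted; apply: le_total.
  by apply: sub_sorted => x y /=; rewrite lerN2.
- by rewrite perm_sort /negw perm_rev perm_sym perm_rev perm_map // perm_sort.
Qed.

Lemma fpair_negw a b : sorted <%O a -> sorted <%O b ->
  fpair (negw b) (negw a) = omap (fun p => (negw p.2, negw p.1)) (epair a b).
Proof.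
move=> sa sb; have ua := lt_sorted_uniq sa; have ub := lt_sorted_uniq sb.
rewrite /fpair /epair; case e: (minl _) => [y|] /=.
  have [h1 h2] := (minlP _ _).1 e.
  have -> : maxl (avail (negw b) (negw a)) = Some (- y).
    apply/maxlP; split; first by rewrite -mem_unp.
    by move=> z; rewrite -[z]opprK -mem_unp // => /h2; rewrite lerN2.
  rewrite /= rem_negw // -sort_negw prev_absent_negw; congr (Some (_, _)).
  apply/perm_sortP; [exact: le_total|exact: le_trans|exact: le_anti|].
  by rewrite /negw /= rev_cons opprK perm_sym perm_rcons.
have {e} -> : maxl (avail (negw b) (negw a)) = None; last by [].
apply/maxl_none; move/minl_none: e => e.
case e' : (avail _ _) => [//|z t]; have : z \in avail (negw b) (negw a) by rewrite e' mem_head.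
by rewrite -[z]opprK -mem_unp // e.
Qed.

Lemma ckt_negw t t' tau : ckt false t t' tau -> exists tau',
  ckt false (negw t) (negw t') tau' \/ ckt false (negw t') (negw t) tau'.
Proof.
case=> [a b c ab bc _|a b c ab bc _|a _|//]; rewrite /negw /rev /=.
- by eexists; left; apply: ckt_acb; rewrite ?ltrN2.
- by eexists; left; apply: ckt_bac; rewrite ?ltrN2.
- eexists; right; set d := - (a + 1); have -> : - a = d + 1 by rewrite /d opprD subrK.
  exact: ckt_aba.
Qed.

(** A block of three letters starting at k starts at [size w - 3 - k] in the reversed word. *)
Lemma ck_negw k w w' : ck (Some k) w w' -> ck (Some (size w - 3 - k)%N) (negw w) (negw w').
Proof.
case=> u [t [t' [v [tau [-> -> /= su h]]]]].
have [st [tau' ht]] : size t = 3 /\ exists tau', ckt false (negw t) (negw t') tau' \/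
    ckt false (negw t') (negw t) tau'.
  case: h => h.
    by rewrite (ckt_size_sw h); split=> //; apply: ckt_negw h.
  rewrite -(ckt_size h) (ckt_size_sw h); split=> //.
  by have [tau' [h'|h']] := ckt_negw h; exists tau'; [right|left].
exists (negw v), (negw t), (negw t'), (negw u), tau'; rewrite !negw_cat -!catA; split=> //.
by rewrite size_negw /= !size_cat st su; lia.
Qed.

Lemma nth_negw (w : seq int) (k : nat) : (k < size w)%N -> nth 0 (negw w) k = - nth 0 w (size w - k.+1).
Proof.
move=> hk; rewrite /negw nth_rev ?size_map // (nth_map 0) // ltn_subrL /=.
exact: leq_ltn_trans hk.
Qed.

Lemma equivariant_negw A R phi : equivariant A R phi -> (forall k, A (Some k)) ->
  equivariant isSome (R \o negw) (negw \o phi \o negw).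
Proof.
move=> g hA; split=> /=.
- by move=> [k|] // w w' _ r /ck_negw; apply: eqv_ck g _ _ _ (hA _) r.
- by move=> u a v; rewrite negw_cat /negw /= !rev_cons -!cats1 -!catA; apply: eqv_xx g _ _ _.
- move=> u a b v; rewrite negw_cat /negw /= !rev_cons -!cats1 -!catA => /(eqv_xyx g); lia.
- by move=> w r; rewrite negwK; apply: eqv_R g _ r.
- by move=> w r; rewrite size_negw (eqv_size g) // size_negw.
- move=> w r k hk; have sz := eqv_size g r; rewrite size_negw in sz.
  have k1 : (size w - k.+2).+1 = (size w - k.+1)%N by rewrite -subSn.
  have h := eqv_descents g r (k := size w - k.+2); rewrite size_negw k1 in h.
  rewrite !nth_negw ?sz //; try exact: ltnW.
  rewrite ltrN2 h; last by rewrite ltn_subrL /=; apply: leq_ltn_trans hk.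
  have n1 (j : nat) : (j < size w)%N -> nth 0 (negw w) (size w - j.+1) = - nth 0 w j.
    move=> hj; rewrite nth_negw; last by rewrite ltn_subrL /=; apply: leq_ltn_trans hj.
    by rewrite subnSK // subKn // ltnW.
  by rewrite !n1 ?ltrN2 // ltnW.
- move=> [k|] // w w' _ r h; have h1 := ck_negw h.
  have h2 := eqv_phi g (hA _) r h1; have := ck_negw h2.
  rewrite (eqv_size g r) size_negw; suff -> : (size w - 3 - (size w - 3 - k) = k)%N by [].
  by case: h => u [t [t' [v [tau [-> _ /= <- [h|h]]]]]]; rewrite !size_cat -?(ckt_size h)
    (ckt_size_sw h) /=; lia.
Qed.

Lemma epair_eqv A R phi (u a b v U S B V : seq int) : equivariant A R phi ->
  (forall k, A (Some k)) -> sorted <%O a -> sorted <%O b -> R (u ++ a ++ b ++ v) ->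
  phi (u ++ a ++ b ++ v) = U ++ S ++ B ++ V ->
  size U = size u -> size S = size a -> size B = size b ->
  (epair a b = None -> epair S B = None) /\
  forall a' b', epair a b = Some (a', b') ->
    exists S' B', [/\ epair S B = Some (S', B'), R (u ++ a' ++ b' ++ v) &
      phi (u ++ a' ++ b' ++ v) = U ++ S' ++ B' ++ V].
Proof.
move=> g hA sa sb r e sU sS sB; have g' := equivariant_negw g hA.
have sSs : sorted <%O S by apply: (eqv_sorted g r e sU sS sa).
have sBs : sorted <%O B.
  have r' := r; rewrite catA in r'; have e' := e; rewrite (catA u) (catA U) in e'.
  by apply: (eqv_sorted g r' e' _ _ sb); rewrite ?size_cat ?sU ?sS.
have catn s1 s2 s3 s4 : negw (s1 ++ s2 ++ s3 ++ s4) = negw s4 ++ negw s3 ++ negw s2 ++ negw s1.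
  by rewrite !negw_cat -!catA.
have ew : negw (negw v ++ negw b ++ negw a ++ negw u) = u ++ a ++ b ++ v by rewrite catn !negwK.
have sV : size V = size v.
  have := eqv_size g r; rewrite e !size_cat sU sS sB; lia.
have [||||||||es ef] := fpair_eqv (b := negw a) (u := negw v) (a := negw b) (v := negw u)
  (U := negw V) (S := negw B) (B := negw S) (V := negw U) g' _.
- by [].
- by rewrite sorted_negw.
- by rewrite sorted_negw.
- by rewrite /= ew.
- by rewrite /= ew e catn.
- by rewrite !size_negw.
- by rewrite !size_negw.
- by rewrite !size_negw.
split=> [en|a' b' ee].
  have : fpair (negw b) (negw a) = None by rewrite fpair_negw // en.
  by move/fpair_none; rewrite -es => /fpair_none; rewrite fpair_negw //; case: (epair S B).
have [|S' [B' [h1 h2 h3]]] := ef (negw b') (negw a'); first by rewrite fpair_negw // ee.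
rewrite fpair_negw // in h1; case EE: (epair S B) h1 => [[S1 B1]|] //= [eB eS].
rewrite -eB -eS /= !catn !negwK in h2 h3.
exists S1, B1; split=> //.
by apply: (can_inj negwK); rewrite h3 catn.
Qed.

(** * Factorizations *)

Lemma ib_equivariant (N : int) pi : (forall x : int, (x < - N) || (N < x) -> pi x = x) ->
  equivariant predT is_inv_word (ib pi).
Proof.
move=> hpi; split.
- by move=> o w w' _ r h; apply: ck_red h r.
- exact: inv_word_xx.
- exact: inv_word_xyx.
- by move=> w; apply: ib_red hpi.
- by move=> w r; case: (ib_descents hpi r).
- by move=> w r; case: (ib_descents hpi r).
- by move=> o w w' _; apply: ib_ck hpi.
Qed.

Lemma split_shape (L r Ws : seq (seq int)) a b : shape Ws = shape (L ++ a :: b :: r) ->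
  exists LL S B RR, [/\ Ws = LL ++ S :: B :: RR, shape LL = shape L, size S = size a,
    size B = size b & shape RR = shape r].
Proof.
elim: L Ws => [|s L IH] [|S Ws] //=.
  case: Ws => [|B RR] //= [h1 h2 h3]; by exists [::], S, B, RR.
case=> h1 /IH[LL [S' [B [RR [-> h2 h3 h4 h5]]]]].
by exists (S :: LL), S', B, RR; rewrite /= h1 h2.
Qed.

Lemma split_two (ws : seq (seq int)) i : (0 < i)%N -> (i < size ws)%N ->
  exists L a b r, ws = L ++ a :: b :: r /\ i = (size L).+1.
Proof.
case: i => // i _; elim: ws i => [|s ws IH] // [|i] /= hi.
  by case: ws hi {IH} => // b r _; exists [::], s, b, r.
have [L [a [b [r [-> ->]]]]] := IH i hi.
by exists (s :: L), a, b, r.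
Qed.

Lemma set_two (L r : seq (seq int)) a b a' b' :
  set_nth [::] (set_nth [::] (L ++ a :: b :: r) (size L) a') (size L).+1 b' = L ++ a' :: b' :: r.
Proof. by elim: L => //= s L ->. Qed.

Lemma nth_two (L r : seq (seq int)) a b :
  nth [::] (L ++ a :: b :: r) (size L) = a /\ nth [::] (L ++ a :: b :: r) (size L).+1 = b.
Proof. by elim: L. Qed.

Lemma fop_two (L : seq (seq int)) a b r : sorted <%O b ->
  fop (size L).+1 (L ++ a :: b :: r) = omap (fun p => L ++ p.1 :: p.2 :: r) (fpair a b).
Proof.
move=> sb; have [n1 n2] := nth_two L r a b.
have hs : ((size L).+1 < size (L ++ a :: b :: r))%N by rewrite size_cat /=; lia.
rewrite /fop hs /= n1 n2 ms_pairE // /fpair.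
by case: maxl => //= x; rewrite set_two.
Qed.

Lemma eop_two (L : seq (seq int)) a b r : sorted <%O b ->
  eop (size L).+1 (L ++ a :: b :: r) = omap (fun p => L ++ p.1 :: p.2 :: r) (epair a b).
Proof.
move=> sb; have [n1 n2] := nth_two L r a b.
have hs : ((size L).+1 < size (L ++ a :: b :: r))%N by rewrite size_cat /=; lia.
rewrite /eop hs /= n1 n2 ms_pairE // /epair.
by case: minl => //= x; rewrite set_two.
Qed.

Lemma ibF_eq pi (ws Ws : seq (seq int)) : ib pi (flatten ws) = flatten Ws -> shape Ws = shape ws -> ibF pi ws = Ws.
Proof. by rewrite /ibF => -> e; rewrite -[map size ws]e flattenK. Qed.

Lemma size_flatten_shape (T : Type) (s t : seq (seq T)) : shape s = shape t ->
  size (flatten s) = size (flatten t).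
Proof. by rewrite !size_flatten => ->. Qed.

Lemma flatten_two (L r : seq (seq int)) a b :
  flatten (L ++ a :: b :: r) = flatten L ++ a ++ b ++ flatten r.
Proof. by rewrite flatten_cat. Qed.

Lemma eqv_all_sorted A R phi (u U : seq int) (ws Ws : seq (seq int)) : equivariant A R phi ->
  R (u ++ flatten ws) -> phi (u ++ flatten ws) = U ++ flatten Ws -> size U = size u ->
  shape Ws = shape ws -> all (sorted <%O) Ws = all (sorted <%O) ws.
Proof.
move=> g; elim: ws Ws u U => [|s ws IH] [|S Ws] //= u U r e sU [sS sh].
congr (_ && _); first exact: eqv_sortedE g r e sU sS.
by apply: (IH _ (u ++ s) (U ++ S)); rewrite -?catA // !size_cat sU sS.
Qed.

Lemma shape_ibF (N : int) pi ws : (forall x : int, (x < - N) || (N < x) -> pi x = x) ->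
  is_inv_word (flatten ws) ->
  shape (ibF pi ws) = shape ws /\ flatten (ibF pi ws) = ib pi (flatten ws).
Proof.
move=> hpi r; have [sz _] := ib_descents hpi r.
split; first by apply: reshapeKl; rewrite sz size_flatten.
by apply: reshapeKr; rewrite sz size_flatten.
Qed.

Lemma fdom_ibF (N : int) pi n ws : (forall x : int, (x < - N) || (N < x) -> pi x = x) ->
  fdom n ws -> fdom n (ibF pi ws).
Proof.
move=> hpi [sn sw r]; have [sh fl] := shape_ibF hpi r; split.
- by rewrite -sn -(size_map size ws) -[map size ws]sh size_map.
- by rewrite (@eqv_all_sorted _ _ _ [::] [::] ws _ (ib_equivariant hpi)).
- by rewrite fl; apply: ib_red hpi r.
Qed.

Lemma ibF_fop (N : int) pi n i ws : (forall x : int, (x < - N) || (N < x) -> pi x = x) ->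
  (0 < i < n)%N -> fdom n ws ->
  omap (ibF pi) (fop i ws) = fop i (ibF pi ws) /\ omap (ibF pi) (eop i ws) = eop i (ibF pi ws).
Proof.
move=> hpi /andP[i0 i1] hD; have [sn sw r] := hD.
have [sh fl] := shape_ibF hpi r; have [_ sW _] := fdom_ibF hpi hD.
rewrite -sn in i1; have [L [a [b [rs [ew ei]]]]] := split_two i0 i1; subst ws i.
have [LL [S [B [RR [eW sL sS sB sR]]]]] := split_shape sh.
move: sw sW; rewrite eW !all_cat /= => /and4P[_ sa sb _] /and4P[_ sSs sBs _].
have sLL : size LL = size L by rewrite -(size_map size LL) -/(shape _) sL size_map.
have f2 := @fop_two LL S B RR sBs; have e2 := @eop_two LL S B RR sBs.
rewrite sLL in f2 e2; rewrite f2 e2 fop_two // eop_two //.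
have g := ib_equivariant hpi; rewrite eW in fl; move: fl (r); rewrite !flatten_two => fl r'.
have sU := size_flatten_shape sL.
have fin a' b' S' B' : ib pi (flatten L ++ a' ++ b' ++ flatten rs) =
    flatten LL ++ S' ++ B' ++ flatten RR -> size S' = size a' -> size B' = size b' ->
    ibF pi (L ++ a' :: b' :: rs) = LL ++ S' :: B' :: RR.
  move=> e h1 h2; apply: ibF_eq; first by rewrite !flatten_two.
  by rewrite /shape !map_cat /= h1 h2 -!/(shape _) sL sR.
split.
  have [es ef] := fpair_eqv g (fun=> isT) sa sb r' (esym fl) sU sS sB.
  case e: (fpair a b) => [[a' b']|] /=; last first.
    by have /fpair_none := e; rewrite -es => /fpair_none ->.
  have [S' [B' [e' _ E]]] := ef _ _ e; rewrite e' /=.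
  have [z1 z2] := fpair_size e; have [Z1 Z2] := fpair_size e'.
  by congr Some; apply: fin => //; lia.
have [en ef] := epair_eqv g (fun=> isT) sa sb r' (esym fl) sU sS sB.
case e: (epair a b) => [[a' b']|] /=; last by rewrite en.
have [S' [B' [e' _ E]]] := ef _ _ e; rewrite e' /=.
have epair_size a0 b0 a1 b1 : epair a0 b0 = Some (a1, b1) ->
    sorted <%O a0 -> sorted <%O b0 -> size a1 = (size a0).+1 /\ size b0 = (size b1).+1.
  move=> h s1 s2; have := fpair_negw s1 s2; rewrite h /= => /fpair_size.
  by rewrite !size_negw => -[].
have [z1 z2] := epair_size _ _ _ _ e sa sb; have [Z1 Z2] := epair_size _ _ _ _ e' sSs sBs.
by congr Some; apply: fin => //; lia.
Qed.

(** * The operators with index 1-bar *)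

Definition first_path (n : nat) : seq (option nat) :=
  if n is n'.+1 then None :: map Some (iota 0 n') else [::].

(** The first step exchanges the two initial letters; afterwards the letter just passed is the
    witness for passing the next one. *)
Lemma chain_first (x : int) a v : sorted <%O (x :: a) ->
  chain (first_path (size a)) (x :: a ++ v) (a ++ x :: v).
Proof.
have aux (u : seq int) (a0 : int) a' : sorted <%O (a0 :: a') -> x < a0 ->
    chain (map Some (iota (size u) (size a'))) (u ++ a0 :: x :: a' ++ v) (u ++ a0 :: a' ++ x :: v).
  elim: a' u a0 => [|a1 a' IH] u a0 s xa; first exact: chain_nil.
  have [s' h] := (sorted_consP _ _).1 s; have a01 : a0 < a1 by apply: h; rewrite mem_head.
  apply: chain_cons; first by apply: ck_bac xa a01.
  have := IH (u ++ [:: a0]) a1 s' (lt_trans xa a01).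
  by rewrite size_cat addn1 -!catA.
case: a => [|a0 a] s; first exact: chain_nil.
have [s' h] := (sorted_consP _ _).1 s; have xa : x < a0 by apply: h; rewrite mem_head.
apply: chain_cons; first by apply: ck_swap; rewrite lt_eqF.
exact: (aux [::]).
Qed.

Lemma all_lt_sorted (x : int) b : sorted <%O b ->
  all (fun z => x < z) b = sorted <%O (x :: b).
Proof. by move=> s; rewrite /= lt_path_sortedE s andbT. Qed.

(** Once x has slid through the rest of the first factor, the condition on b says that x :: b is
    increasing, which is visible in the descents of the new word. *)
Lemma ibF_fbar1 (N : int) pi n ws : (forall x : int, (x < - N) || (N < x) -> pi x = x) ->
  fdom n ws -> omap (ibF pi) (fbar1 ws) = fbar1 (ibF pi ws).
Proof.
move=> hpi hD; have [sn sw r] := hD.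
have [sh fl] := shape_ibF hpi r; have [_ sW _] := fdom_ibF hpi hD.
move: (ibF pi ws) sh fl sW {hD sn} => Ws sh fl sW.
have g := ib_equivariant hpi.
case: ws sh fl sw r => [|[|x a] [|b ws]]; case: Ws sW => [|[|X S] [|B Ws]] //=.
move=> /and3P[sS sB _] [zS zB sh] fl /and3P[sa sb _] r.
have ch := chain_first (b ++ flatten ws) sa; have Ch := chain_first (B ++ flatten Ws) sS.
have r' := chain_R g (all_predT _) r ch.
have e : ib pi (a ++ (x :: b) ++ flatten ws) = S ++ (X :: B) ++ flatten Ws.
  apply: chain_det (chain_phi g (all_predT _) r ch) _.
  by rewrite -fl -zS.
have E := @eqv_sortedE _ _ _ a (x :: b) (flatten ws) S (X :: B) (flatten Ws) g r' e zS.
rewrite !all_lt_sorted // E /= ?zB //.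
case: ifP => // _ /=; congr Some; apply: ibF_eq => //=.
by rewrite zS zB sh.
Qed.

(** The condition compares y with all of a and is not read off from the descents of a y b. It
    becomes a descent condition once y is slid to the front, which is possible only when it holds;
    so the implication is proved from either side separately. *)
Lemma ibF_ebar1 (N : int) pi n ws : (forall x : int, (x < - N) || (N < x) -> pi x = x) ->
  fdom n ws -> omap (ibF pi) (ebar1 ws) = ebar1 (ibF pi ws).
Proof.
move=> hpi hD; have [sn sw r] := hD.
have [sh fl] := shape_ibF hpi r; have [_ sW _] := fdom_ibF hpi hD.
move: (ibF pi ws) sh fl sW {hD sn} => Ws sh fl sW.
have g := ib_equivariant hpi.
case: ws sh fl sw r => [|a [|[|y b] ws]]; case: Ws sW => [|S [|[|Y B] Ws]] //=.
move=> /and3P[sS sB _] [zS zB sh] fl /and3P[sa sb _] r.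
have rp := eqv_R g r; rewrite -fl in rp.
rewrite !all_lt_sorted //.
have down (w : seq int) : is_inv_word w -> forall n0, (n0 < size w)%N ->
    exists x t v, w = x :: t ++ v /\ size t = n0.
  case: w => // x w _ n0 hn; exists x, (take n0 w), (drop n0 w).
  by rewrite cat_take_drop size_takel.
have match_ y' a' v' Y' S' V' : is_inv_word (y' :: a' ++ v') ->
    ib pi (y' :: a' ++ v') = Y' :: S' ++ V' -> size S' = size a' ->
    sorted <%O (Y' :: S') = sorted <%O (y' :: a') /\
    (sorted <%O (y' :: a') -> ib pi (a' ++ y' :: v') = S' ++ Y' :: V').
  move=> r0 e0 z0; have E := @eqv_sortedE _ _ _ [::] (y' :: a') v' [::] (Y' :: S') V' g r0 e0 erefl _.
  rewrite /= in E; rewrite /= E ?z0 //; split=> // s0.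
  have s0' : sorted <%O (Y' :: S') by rewrite /= E ?z0.
  apply: chain_det (chain_phi g (all_predT _) r0 (chain_first v' s0)) _.
  by rewrite e0 -z0; apply: chain_first.
have inj2 (s1 s2 v1 v2 : seq int) (x1 x2 : int) : s1 ++ x1 :: v1 = s2 ++ x2 :: v2 ->
    size s1 = size s2 -> [/\ s1 = s2, x1 = x2 & v1 = v2].
  by move=> /eqP h hs; move: h; rewrite eqseq_cat // eqseq_cons => /and3P[/eqP-> /eqP-> /eqP->].
case: (boolP (sorted <%O (y :: a))) => [sya|nya].
  have ch := chain_first (b ++ flatten ws) sya.
  have r1 := chain_R g (all_predT _) r (chain_rev ch).
  have r1s := eqv_R g r1.
  have [|Y' [S' [V' [eW zS']]]] := down _ r1s (size a).
    by rewrite (eqv_size g r1) /= size_cat; lia.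
  have [eS ih] := match_ _ _ _ _ _ _ r1 eW zS'.
  have e := ih sya; rewrite -fl in e.
  have [|e1 e2 e3] := inj2 _ _ _ _ _ _ e; first by rewrite zS.
  subst S' Y' V'; rewrite /= in eS sya *; rewrite eS sya /=; congr Some.
  by apply: ibF_eq; rewrite //= zS sh; case: zB => ->.
case: ifP => // sYS.
(* Here the image satisfies the condition: slide Y to the front, take a preimage under the bump,
   slide its first letter back, and identify the result with the given word by injectivity. *)
have Ch := chain_first (B ++ flatten Ws) sYS.
have R1 := chain_R g (all_predT _) rp (chain_rev Ch).
have [w0 r0 e0] := ib_surj hpi R1.
have [|y' [a' [v' [ew zs]]]] := down _ r0 (size a).
  by rewrite -(eqv_size g r0) e0 /= size_cat zS; lia.
subst w0; have [|eS ih] := match_ _ _ _ _ _ _ r0 e0; first by rewrite zS zs.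
have s0 : sorted <%O (y' :: a') by rewrite -eS.
have e1 := ih s0; rewrite fl in e1.
have r2 := chain_R g (all_predT _) r0 (chain_first v' s0).
have := ib_inj hpi r2 r e1 => /inj2[//|e2 e3 _].
by subst y' a'; rewrite s0 in nya.
Qed.

Theorem theorem4p17 (n : nat) (pi : int -> int) :
  (0 < n)%N -> is_involution_Z pi -> qcrystal_iso n (fdom n) (ibF pi).
Proof.
move=> _ [_ [M hM]]; pose N : int := M%:Z.
have hpi (x : int) : (x < - N) || (N < x) -> pi x = x by move=> hx; apply: hM; rewrite /N in hx; lia.
split; first by move=> ws; apply: fdom_ibF hpi.
split.
- move=> b1 b2 [_ _ r1] [_ _ r2] e.
  have [s1 f1] := shape_ibF hpi r1; have [s2 f2] := shape_ibF hpi r2.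
  apply: eq_from_flatten_shape; last by rewrite -s1 -s2 e.
  by apply: (ib_inj hpi r1 r2); rewrite -f1 -f2 e.
- move=> b [sn sb r]; have [w r0 e0] := ib_surj hpi r.
  have [sz _] := ib_descents hpi r0; rewrite e0 size_flatten in sz.
  have k1 : shape (reshape (shape b) w) = shape b by apply: reshapeKl; rewrite sz.
  have k2 : flatten (reshape (shape b) w) = w by apply: reshapeKr; rewrite sz.
  exists (reshape (shape b) w); last by apply: ibF_eq; rewrite ?k2.
  split; last by rewrite k2.
    by rewrite -sn -(size_map size (reshape _ _)) -/(shape _) k1 size_map.
  by rewrite -(@eqv_all_sorted _ _ _ [::] [::] _ b (ib_equivariant hpi)) //= k2.
- by move=> b [_ _ r]; case: (shape_ibF hpi r).
- by move=> i hi b hb; apply: ibF_fop hpi hi hb.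
- by move=> b hb; split; [apply: ibF_fbar1 hpi hb|apply: ibF_ebar1 hpi hb].
Qed.
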